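(* The operators $f\mapsto\mathcal{F}_o f$ and $f\mapsto f\mathcal{F}_o$ from $L_2$ to $L_2$ are Hilbert space isomorphisms.
   Context: $\mathcal{G}_{2n}$ is the real Clifford algebra generated by an orthonormal basis $e_1,\dots,e_n,e'_1,\dots,e'_n$ of $\mathbb{R}^{2n}$, with $v^2=v\cdot v$ for all vectors $v$ (so basis vectors square to $1$ and distinct basis vectors anticommute). The reversion $\dagger$ is the anti-involution of $\mathcal{G}_{2n}$ fixing every vector, $\langle A\rangle_0$ is the scalar part of $A$, and $A\cdot B=\langle AB^{\dagger}\rangle_0$ is the scalar product of multivectors, with norm $|A|^2=A\cdot A$. Put $B_i=e_ie'_i$; then $B_i^2=-1$ and $B_iB_j=B_jB_i$. The measure is $dm(x)=(2\pi)^{-n/2}dx$ on $\mathbb{R}^n$, with $dx$ Lebesgue measure; for $p=1,2$, $L_p$ is the space of (classes of) measurable functions $f\colon\mathbb{R}^n\to\mathcal{G}_{2n}$ with $\|f\|_p=\left(\int_{\mathbb{R}^n}|f|^p\,dm\right)^{1/p}<\infty$. $L_2$ is regarded as a real Hilbert space with scalar product $(f,g)_2=\int_{\mathbb{R}^n}f(x)\cdot g(x)\,dx$. With $I(x,y)=\sum_{i=1}^nB_ix_iy_i$ for $x,y\in\mathbb{R}^n$, the left and right Clifford-Fourier transforms are, for $f\in L_1\cap L_2$, $$(\mathcal{F}_o f)(y)=\int_{\mathbb{R}^n}e^{-I(x,y)}f(x)\,dm(x),\qquad (f\mathcal{F}_o)(y)=\int_{\mathbb{R}^n}f(x)e^{-I(x,y)}\,dm(x);$$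 these maps are $L_2$-isometric on $L_1\cap L_2$, and for general $f\in L_2$ the symbols $\mathcal{F}_of$ and $f\mathcal{F}_o$ denote their unique continuous extensions to $L_2$. *)

(* Defs.v *)
From HB Require Import structures.
From mathcomp Require Import all_boot all_order all_algebra.
From mathcomp Require Import all_classical all_reals all_analysis.
From mathcomp Require Import measurable_realfun.
From mathcomp Require Import ring lra.

Set Implicit Arguments.
Unset Strict Implicit.
Unset Printing Implicit Defensive.
Import Order.TTheory GRing.Theory Num.Theory.
Import numFieldNormedType.Exports.

Local Open Scope classical_set_scope.
Local Open Scope ring_scope.

(* Multivectors are given by their coordinates A S in the basis of the blades
   e_S = e_{i_1} ... e_{i_k}, S = {i_1 < ... < i_k} (see blade_prod). *)

Definition symdiff m (S T : {set 'I_m}) : {set 'I_m} :=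
  [set i | (i \in S) (+) (i \in T)].

Section Clifford.
Context {R : realType} {m : nat}.

(* e_S e_T = blade_sign S T *: e_(symdiff S T): sorting the product costs a sign
   for each pair (i, j) in S x T with j < i, and repeated generators square
   to 1. *)
Definition blade_sign (S T : {set 'I_m}) : R :=
  \prod_(i in S) \prod_(j in T | (j < i)%N) -1.

Definition clifford := {ffun {set 'I_m} -> R^o}.
HB.instance Definition _ := GRing.Lmodule.on clifford.

Implicit Types (A B C : clifford) (S T U : {set 'I_m}).

Definition blade S : clifford := [ffun T => (T == S)%:R].
Definition clifford_mul A B : clifford :=
  \sum_S \sum_T (A S * B T * blade_sign S T) *: blade (symdiff S T).

Lemma symdiffC S T : symdiff S T = symdiff T S.
Proof. by apply/setP => i; rewrite !inE addbC. Qed.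
Lemma symdiffA S T U : symdiff S (symdiff T U) = symdiff (symdiff S T) U.
Proof. by apply/setP => i; rewrite !inE addbA. Qed.
Lemma symdiff0 S : symdiff S finset.set0 = S.
Proof. by apply/setP => i; rewrite !inE addbF. Qed.
Lemma symdiff0l S : symdiff finset.set0 S = S.
Proof. by rewrite symdiffC symdiff0. Qed.
Lemma symdiffv S : symdiff S S = finset.set0.
Proof. by apply/setP => i; rewrite !inE addbb. Qed.
Lemma symdiffK S : involutive (symdiff S).
Proof. by move=> T; rewrite symdiffA symdiffv symdiff0l. Qed.
Lemma symdiff_eq S T U : (U == symdiff S T) = (T == symdiff S U).
Proof. by apply/eqP/eqP => ->; rewrite symdiffK. Qed.

Lemma prod_symdiff (F : 'I_m -> R) S T : (forall i, F i * F i = 1) ->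
  \prod_(i in symdiff S T) F i = (\prod_(i in S) F i) * \prod_(i in T) F i.
Proof.
move=> F1; rewrite big_mkcond [X in X * _]big_mkcond [X in _ * X]big_mkcond.
rewrite -big_split/=; apply: eq_bigr => i _; rewrite inE.
by case: (i \in S); case: (i \in T); rewrite /= ?mulr1 ?mul1r ?F1.
Qed.

Lemma blade_signDl S T U :
  blade_sign (symdiff S T) U = blade_sign S U * blade_sign T U.
Proof.
rewrite /blade_sign prod_symdiff// => i; rewrite -big_split/=.
by apply: big1 => j _; rewrite mulrNN mulr1.
Qed.

Lemma blade_signDr S T U :
  blade_sign S (symdiff T U) = blade_sign S T * blade_sign S U.
Proof.
rewrite /blade_sign -big_split/=; apply: eq_bigr => i _.
rewrite !big_mkcondr/= prod_symdiff// => j.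
by case: ifP; rewrite ?mulr1 ?mulrNN ?mulr1.
Qed.

Lemma blade_sign0l S : blade_sign finset.set0 S = 1.
Proof. by rewrite /blade_sign big_set0. Qed.
Lemma blade_sign0r S : blade_sign S finset.set0 = 1.
Proof. by rewrite /blade_sign big1// => i _; rewrite big_pred0// => j; rewrite inE. Qed.
Lemma blade_sign2 S T : blade_sign S T * blade_sign S T = 1.
Proof. by rewrite -blade_signDl symdiffv blade_sign0l. Qed.

Lemma clifford_mulE A B U :
  clifford_mul A B U =
  \sum_S A S * B (symdiff S U) * blade_sign S (symdiff S U).
Proof.
rewrite sum_ffunE; apply: eq_bigr => S _; rewrite sum_ffunE.
rewrite (bigD1 (symdiff S U))//= big1 => [|T TU].
  by rewrite !ffunE symdiffK eqxx addr0 /GRing.scale/= mulr1.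
by rewrite !ffunE symdiff_eq (negbTE TU) scaler0.
Qed.

Lemma clifford_mulA : associative clifford_mul.
Proof.
move=> A B C; apply/ffunP => U; rewrite !clifford_mulE.
under eq_bigr => S _.
  rewrite clifford_mulE mulr_sumr mulr_suml.
  over.
under [RHS]eq_bigr => W _.
  rewrite clifford_mulE !mulr_suml.
  over.
rewrite [RHS]exchange_big/=; apply: eq_bigr => S _.
rewrite [RHS](reindex_inj (inv_inj (symdiffK S)))/=; apply: eq_bigr => T _.
rewrite symdiffK !symdiffA (symdiffC T S).
set V := symdiff (symdiff S T) U.
have -> : symdiff S U = symdiff T V by rewrite /V (symdiffC S T) -symdiffA symdiffK.
rewrite blade_signDl blade_signDr.
ring.
Qed.

Lemma clifford_mul1l : left_id (blade finset.set0) clifford_mul.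
Proof.
move=> A; apply/ffunP => U; rewrite clifford_mulE.
rewrite (bigD1 finset.set0)//= big1 => [|S S0]; rewrite !ffunE.
  by rewrite eqxx symdiff0l blade_sign0l addr0 mul1r mulr1.
by rewrite (negbTE S0) !mul0r.
Qed.

Lemma symdiff_eq0 S T : (symdiff S T == finset.set0) = (S == T).
Proof. by rewrite eq_sym symdiff_eq symdiff0 eq_sym. Qed.

Lemma clifford_mul1r : right_id (blade finset.set0) clifford_mul.
Proof.
move=> A; apply/ffunP => U; rewrite clifford_mulE.
rewrite (bigD1 U)//= big1 => [|S SU]; rewrite !ffunE.
  by rewrite symdiffv eqxx blade_sign0r addr0 !mulr1.
by rewrite symdiff_eq0 (negbTE SU) mulr0 mul0r.
Qed.

Lemma clifford_mulDl : left_distributive clifford_mul +%R.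
Proof.
move=> A B C; apply/ffunP => U; rewrite ffunE !clifford_mulE -big_split/=.
by apply: eq_bigr => S _; rewrite ffunE !mulrDl.
Qed.

Lemma clifford_mulDr : right_distributive clifford_mul +%R.
Proof.
move=> A B C; apply/ffunP => U; rewrite ffunE !clifford_mulE -big_split/=.
by apply: eq_bigr => S _; rewrite ffunE mulrDr mulrDl.
Qed.

Lemma clifford_1neq0 : blade finset.set0 != 0.
Proof. by apply/eqP => /ffunP/(_ finset.set0)/eqP; rewrite !ffunE eqxx oner_eq0. Qed.

HB.instance Definition _ := GRing.Zmodule_isNzRing.Build clifford
  clifford_mulA clifford_mul1l clifford_mul1r clifford_mulDl clifford_mulDr
  clifford_1neq0.

Lemma clifford_scalerAl (a : R) A B : a *: (A * B) = (a *: A) * B.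
Proof.
apply/ffunP => U; rewrite ffunE !clifford_mulE scaler_sumr.
by apply: eq_bigr => S _; rewrite ffunE /GRing.scale/= !mulrA.
Qed.
HB.instance Definition _ :=
  GRing.Lmodule_isLalgebra.Build R clifford clifford_scalerAl.

Lemma clifford_scalerAr (a : R) A B : a *: (A * B) = A * (a *: B).
Proof.
apply/ffunP => U; rewrite ffunE !clifford_mulE scaler_sumr.
by apply: eq_bigr => S _; rewrite ffunE /GRing.scale/= -!mulrA mulrCA.
Qed.
HB.instance Definition _ :=
  GRing.Lalgebra_isAlgebra.Build R clifford clifford_scalerAr.

Definition generator (i : 'I_m) : clifford := blade [set i]%SET.

Lemma cliffordE A : A = \sum_S A S *: blade S.
Proof.
apply/ffunP => T; rewrite sum_ffunE (bigD1 T)//= big1 => [|S ST]; rewrite !ffunE.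
  by rewrite eqxx addr0 /GRing.scale/= mulr1.
by rewrite eq_sym (negbTE ST) scaler0.
Qed.

Lemma blade_mul S T : blade S * blade T = blade_sign S T *: blade (symdiff S T).
Proof.
apply/ffunP => U; rewrite clifford_mulE !ffunE.
rewrite (bigD1 S)//= big1 => [|S' S'S]; rewrite !ffunE.
  rewrite eqxx mul1r addr0 (eq_sym _ T) -symdiff_eq.
  by case: eqP => [->|_]; rewrite /GRing.scale/= ?symdiffK ?mulr1 ?mulr0 ?mul1r ?mul0r.
by rewrite (negbTE S'S) !mul0r.
Qed.

Lemma blade_prod S : blade S = \prod_(i <- enum S) generator i.
Proof.
have : sorted (fun i j : 'I_m => (i < j)%N) (enum S).
  rewrite {1}/enum_mem -enumT; apply: sorted_filter.
    by move=> i j k; exact: ltn_trans.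
  by rewrite -(@sorted_map _ _ val ltn) val_enum_ord iota_ltn_sorted.
rewrite -[in blade _](set_enum S).
elim: (enum S) => [_|i s IHs /= ps].
  by rewrite big_nil; congr blade; apply/setP => i; rewrite !inE.
rewrite big_cons -IHs ?(path_sorted ps)// /generator blade_mul.
have is_ j : j \in s -> (i < j)%N.
  by move: ps; rewrite path_sortedE => [/andP[/allP + _]|? ? ?]; [exact|exact: ltn_trans].
rewrite /blade_sign big_set1 big_pred0 => [|j].
  rewrite scale1r; congr blade; apply/setP => j; rewrite !inE.
  by case: eqVneq => [->|//]; case: (boolP (i \in s)) => // /is_; rewrite ltnn.
rewrite inE; apply/negbTE/negP => /andP[/is_ ij ji].
by have := ltn_trans ij ji; rewrite ltnn.
Qed.

Lemma generator_sqr i : generator i * generator i = 1.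
Proof.
rewrite /generator blade_mul symdiffv /blade_sign !big_set1 big_pred0 ?scale1r// => j.
by rewrite inE; case: eqVneq => // ->; rewrite ltnn.
Qed.

Lemma generator_anticomm i j : i != j ->
  generator i * generator j = - (generator j * generator i).
Proof.
move=> ij; rewrite /generator !blade_mul symdiffC -scaleNr; congr (_ *: _).
rewrite /blade_sign !big_set1 !big_mkcondr/= !big_set1.
case: ltngtP => [||/val_inj ijE]; rewrite ?opprK//.
by rewrite ijE eqxx in ij.
Qed.

(* Reversing e_{i_1} ... e_{i_k} takes k(k-1)/2 transpositions of anticommuting
   generators, and blade_sign S S = (-1)^(k(k-1)/2) when #|S| = k. The lemmas
   reversionM, reversion_linear and reversion_generator show that this is the
   anti-involution fixing the vectors. *)
Definition reversion A : clifford := [ffun S => blade_sign S S * A S].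

Lemma reversionM A B : reversion (A * B) = reversion B * reversion A.
Proof.
apply/ffunP => U; rewrite ffunE !clifford_mulE mulr_sumr.
rewrite (reindex_inj (inv_inj (symdiffK U)))/=; apply: eq_bigr => S _.
rewrite !ffunE (symdiffC U S) -symdiffA symdiffv symdiff0 (symdiffC S U).
set T := symdiff U S.
have UE : U = symdiff S T by rewrite /T symdiffC -symdiffA symdiffv symdiff0.
clearbody T; rewrite {U}UE.
rewrite !blade_signDl !blade_signDr.
have := blade_sign2 T S; set x := blade_sign T S => x2.
transitivity (blade_sign S S * B S * (blade_sign T T * A T) * blade_sign S T * (x * x)).
  ring.
by rewrite x2 mulr1.
Qed.

Lemma reversion_linear (a : R) A B :
  reversion (a *: A + B) = a *: reversion A + reversion B.
Proof.
by apply/ffunP => S; rewrite !ffunE mulrDr /GRing.scale/= mulrCA.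
Qed.

Lemma reversion_generator i : reversion (generator i) = generator i.
Proof.
apply/ffunP => S; rewrite !ffunE; case: eqVneq => [->|_]; last by rewrite mulr0.
rewrite /blade_sign !big_set1 big_mkcondr/= big_set1 ltnn mulr1//.
Qed.

Lemma reversionK : involutive reversion.
Proof. by move=> A; apply/ffunP => S; rewrite !ffunE mulrA blade_sign2 mul1r. Qed.

Definition scalar_part A : R := A finset.set0.
Definition scalar_prod A B : R := scalar_part (A * reversion B).

Lemma scalar_prodE A B : scalar_prod A B = \sum_S A S * B S.
Proof.
rewrite /scalar_prod /scalar_part clifford_mulE; apply: eq_bigr => S _.
by rewrite symdiff0 ffunE -[RHS]mulr1 -(blade_sign2 S S); ring.
Qed.

Definition clifford_norm A : R := Num.sqrt (scalar_prod A A).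

Lemma scalar_prod_ge0 A : 0 <= scalar_prod A A.
Proof. by rewrite scalar_prodE; apply: sumr_ge0 => S _; rewrite -expr2 sqr_ge0. Qed.

Lemma clifford_normD A B :
  clifford_norm (A + B) <= clifford_norm A + clifford_norm B.
Proof.
have CS : scalar_prod A B ^+ 2 <= scalar_prod A A * scalar_prod B B.
  rewrite !scalar_prodE -subr_ge0.
  set a := \sum_S A S * A S; set b := \sum_S B S * B S; set c := \sum_S _.
  suff H : 0 <= b * (a * b - c ^+ 2).
    have := scalar_prod_ge0 B; rewrite scalar_prodE -/b le_eqVlt => /predU1P[b0|b0].
      suff -> : c = 0 by rewrite -b0; nra.
      rewrite /c big1// => S _; suff -> : B S = 0 by rewrite mulr0.
      have /eqP := esym b0; rewrite psumr_eq0 => [/allP/(_ S)|T _].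
        by rewrite mem_index_enum mulf_eq0 orbb => /(_ isT)/eqP.
      by rewrite -expr2 sqr_ge0.
    by rewrite -(pmulr_rge0 _ b0).
  have := scalar_prod_ge0 (b *: A - c *: B); rewrite scalar_prodE.
  rewrite (_ : \sum_S _ = b * (a * b - c ^+ 2))//.
  transitivity (\sum_S (b ^+ 2 * (A S * A S) - 2 * b * c * (A S * B S) +
                        c ^+ 2 * (B S * B S) : R)).
    by apply: eq_bigr => S _; rewrite !ffunE /GRing.scale/=; ring.
  by rewrite big_split sumrB/= -!mulr_sumr -/a -/b -/c; ring.
rewrite /clifford_norm.
have := scalar_prod_ge0 A; have := scalar_prod_ge0 B => b0 a0.
set a := scalar_prod A A in CS a0 *; set b := scalar_prod B B in CS b0 *.
have -> : scalar_prod (A + B) (A + B) = a + scalar_prod A B *+ 2 + b.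
  rewrite /a /b !scalar_prodE -sumrMnl -!big_split/=.
  by apply: eq_bigr => S _; rewrite !ffunE; ring.
rewrite -[leRHS]ger0_norm ?addr_ge0 ?sqrtr_ge0// -sqrtr_sqr ler_wsqrtr//.
rewrite sqrrD !sqr_sqrtr// lerD2r lerD2l lerMn2r/= -sqrtrM//.
by rewrite (le_trans (ler_norm _))// -sqrtr_sqr ler_wsqrtr.
Qed.

Lemma clifford_normZ (a : R) A : clifford_norm (a *: A) = `|a| * clifford_norm A.
Proof.
rewrite /clifford_norm -sqrtr_sqr -sqrtrM ?sqr_ge0//; congr Num.sqrt.
rewrite !scalar_prodE mulr_sumr; apply: eq_bigr => S _.
by rewrite ffunE /GRing.scale/=; ring.
Qed.

Lemma clifford_norm0_eq0 A : clifford_norm A = 0 -> A = 0.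
Proof.
move=> /eqP; rewrite sqrtr_eq0 scalar_prodE => A0.
have /eqP : \sum_S A S * A S = 0.
  by apply/eqP; rewrite eq_le A0; apply: sumr_ge0 => S _; rewrite -expr2 sqr_ge0.
rewrite psumr_eq0 => [/allP H|S _]; last by rewrite -expr2 sqr_ge0.
apply/ffunP => S; have := H S; rewrite mem_index_enum mulf_eq0 orbb => /(_ isT)/eqP ->.
by rewrite ffunE.
Qed.

HB.instance Definition _ := @Lmodule_isNormed.Build R clifford clifford_norm
  clifford_normD clifford_normZ clifford_norm0_eq0.

Definition clifford_exp A : clifford :=
  limn (series (fun k => k`!%:R^-1 *: A ^+ k)).

End Clifford.
Arguments clifford : clear implicits.

Section TupleMeasure.
Context {d} {T : measurableType d} {R : realType}.
Variable mu : {sigma_finite_measure set T -> \bar R}.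
Local Open Scope ereal_scope.

Section Cons.
Variables (n : nat) (nu : {sigma_finite_measure set (n.-tuple T) -> \bar R}).

Definition tcons (x : T * n.-tuple T) : n.+1.-tuple T := [tuple of x.1 :: x.2].

Lemma measurable_tcons : measurable_fun setT tcons.
Proof. by apply: measurable_cons; [exact: measurable_fst|exact: measurable_snd]. Qed.

Definition cons_measure : set (n.+1.-tuple T) -> \bar R :=
  pushforward (mu \x nu) tcons.

Let cons_measure0 : cons_measure set0 = 0.
Proof. by rewrite /cons_measure /pushforward preimage_set0 measure0. Qed.

Let cons_measure_ge0 A : 0 <= cons_measure A.
Proof. by rewrite /cons_measure /pushforward measure_ge0. Qed.

Let cons_measure_sigma_additive : semi_sigma_additive cons_measure.
Proof.
move=> F mF tF mUF; rewrite /cons_measure /pushforward preimage_bigcup.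
have mp B : measurable B -> measurable (tcons @^-1` B).
  by move=> mB; rewrite -[X in measurable X]setTI; exact: measurable_tcons.
apply: measure_semi_sigma_additive.
- by move=> i; exact: mp.
- apply/trivIsetP => /= i j _ _ ij; rewrite -preimage_setI.
  by move/trivIsetP : tF => /(_ _ _ _ _ ij) ->//; rewrite preimage_set0.
- by rewrite -preimage_bigcup; exact: mp.
Qed.

HB.instance Definition _ := isMeasure.Build _ _ _ cons_measure
  cons_measure0 cons_measure_ge0 cons_measure_sigma_additive.

Let cons_measure_sigma_finite : sigma_finite setT cons_measure.
Proof.
have /sigma_finiteP[F [FT ndF Ffin]] := sigma_finiteT mu.
have /sigma_finiteP[G [GT ndG Gfin]] := sigma_finiteT nu.
pose g (t : n.+1.-tuple T) := (thead t, [tuple of behead t]).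
have mg : measurable_fun setT g.
  by apply/measurable_fun_pairP; split; [exact: measurable_tnth|exact: measurable_behead].
have gK : cancel tcons g.
  by move=> [x t]; rewrite /g /tcons theadE; congr pair; exact/val_inj.
exists (fun k => g @^-1` (F k `*` G k)).
  apply/esym; rewrite -subTset => t _.
  have [i _ Fi] : (\bigcup_i F i) (thead t) by rewrite -FT.
  have [j _ Gj] : (\bigcup_i G i) [tuple of behead t] by rewrite -GT.
  exists (maxn i j) => //; split => /=.
  - by move: Fi; exact/subsetPset/ndF/leq_maxl.
  - by move: Gj; exact/subsetPset/ndG/leq_maxr.
move=> k; have [mF Fk] := Ffin k; have [mG Gk] := Gfin k; split.
  by rewrite -[X in measurable X]setTI; apply: mg => //; exact: measurableX.
rewrite /cons_measure /pushforward -comp_preimage.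
rewrite (_ : g \o tcons = id); last by apply/funext => x; exact: gK.
by rewrite preimage_id product_measure1E// lte_mul_pinfty// ge0_fin_numE.
Qed.

HB.instance Definition _ := @Measure_isSigmaFinite.Build _ _ _ cons_measure
  cons_measure_sigma_finite.

End Cons.

(* The n-fold product of mu with itself (see tuple_measure_box). *)
Fixpoint tuple_measure n : {sigma_finite_measure set (n.-tuple T) -> \bar R} :=
  match n with
  | 0 => [the {sigma_finite_measure set (0.-tuple T) -> \bar R} of dirac [tuple]]
  | k.+1 => [the {sigma_finite_measure set (k.+1.-tuple T) -> \bar R}
               of cons_measure (tuple_measure k)]
  end.

Lemma tuple_measure_box n (A : 'I_n -> set T) :
  (forall i, measurable (A i)) ->
  tuple_measure n [set x | forall i, A i (tnth x i)] = \prod_(i < n) mu (A i).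
Proof.
elim: n A => [|n IHn] A mA.
  by rewrite big_ord0/= diracE mem_set// => -[].
rewrite big_ord_recl -IHn//= /cons_measure /pushforward -product_measure1E//.
  congr (product_measure1 _ _ _); apply/seteqP; split => -[x t]/=.
    move=> H; split; first exact: (H ord0).
    by move=> i; have := H (lift ord0 i); rewrite tnthS.
  by move=> [H0 H] i; case: (unliftP ord0 i) => [j|] ->; rewrite ?tnth0// tnthS; exact: H.
rewrite (_ : mkset _ =
    \bigcap_(i in setT) ((@tnth n _ ^~ i) @^-1` A (lift ord0 i))).
  apply: fin_bigcap_measurable => // i _.
  by rewrite -[X in measurable X]setTI; exact: measurable_tnth.
by apply/seteqP; split => t /= H i; [move=> _|]; exact: H.
Qed.

End TupleMeasure.

Section L2.
Context {R : realType} {n : nat}.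
Local Notation Rn := (n.-tuple (measurableTypeR R)).
Local Notation G := (clifford R (n + n)).
Implicit Types (f g h : Rn -> G).

Definition dx : {measure set Rn -> \bar R} := tuple_measure lebesgue_measure n.

(* dm = (2 pi)^(-n/2) dx *)
Definition dm : {measure set Rn -> \bar R} :=
  mscale (NngNum (powR_ge0 (2 * pi) (- (n%:R / 2)))) dx.

(* Borel measurability; every Lebesgue measurable function agrees almost
   everywhere with such a function, so the classes in L_p are the same. *)
Definition cmeasurable f :=
  forall S : {set 'I_(n + n)}, measurable_fun setT (fun x => f x S : R).

Definition Lp_norm (p : \bar R) f : \bar R := 'N[dm]_p[EFin \o (fun x => `|f x|%R)]%E.

Definition in_Lp (p : \bar R) f := cmeasurable f /\ (Lp_norm p f < +oo)%E.

Lemma cmeasurable_norm f : cmeasurable f ->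
  measurable_fun setT (fun x => `|f x| : R).
Proof.
move=> mf; have -> : (fun x => `|f x| : R) =
    Num.sqrt \o (fun x => \sum_S (f x S : R) * f x S).
  by apply/funext => x; rewrite /= -scalar_prodE.
apply: measurableT_comp.
  by apply: continuous_measurable_fun; exact: sqrt_continuous.
by apply: measurable_sum => S; exact: measurable_funM.
Qed.

Lemma cmeasurable_lincomb (a : R) f g : cmeasurable f -> cmeasurable g ->
  cmeasurable (a *: f + g).
Proof.
move=> mf mg S; rewrite (_ : (fun x => _) = (fun x => a * (f x S : R) + g x S)).
  by apply: measurable_funD => //; apply: measurable_funM.
by apply/funext => x; rewrite /= !ffunE.
Qed.

Lemma in_Lp2E f : in_Lp 2%:E f <->
  cmeasurable f /\ (fun x => `|f x| : R) \in Lfun dm 2%:E.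
Proof.
split=> -[mf nf]; split=> //.
  by rewrite inE; apply/andP; split; rewrite inE//=; exact: cmeasurable_norm.
by move: nf; rewrite inE => /andP[_]; rewrite inE.
Qed.

Lemma measurable_sqr_norm (w : Rn -> R) : measurable_fun setT w ->
  measurable_fun setT (fun x => `|(EFin \o w) x| `^ 2)%E.
Proof.
move=> mw; apply/measurable_EFinP => /=.
apply: (@measurableT_comp _ _ _ _ _ _ (fun x : R => x `^ 2)) => //.
exact: measurableT_comp.
Qed.

Lemma Lnorm2_le (u v : Rn -> R) : measurable_fun setT u -> measurable_fun setT v ->
  (forall x, 0 <= u x <= v x) ->
  ('N[dm]_2%:E[EFin \o u] <= 'N[dm]_2%:E[EFin \o v])%E.
Proof.
move=> mu mv uv; rewrite unlock.
rewrite gt0_ler_poweR//.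
- by rewrite in_itv/= leey integral_ge0// => x _; exact: poweR_ge0.
- by rewrite in_itv/= leey integral_ge0// => x _; exact: poweR_ge0.
- apply: ge0_le_integral => //; [by move=> x _; exact: poweR_ge0|exact: measurable_sqr_norm|exact: measurable_sqr_norm|] => x _ /=.
  have /andP[u0 uvx] := uv x.
  by rewrite lee_fin ge0_ler_powR// ?nnegrE ?ger0_norm ?(le_trans u0 uvx).
Qed.

Definition L2_pred : {pred Rn -> G} := fun f => `[< in_Lp 2%:E f >].

Lemma L2_predP f : reflect (in_Lp 2%:E f) (f \in L2_pred).
Proof. exact: asboolP. Qed.

Lemma L2_submod_closed : submod_closed L2_pred.
Proof.
split.
  apply/L2_predP; split.
    move=> S; rewrite (_ : (fun x => _) = cst 0); first exact: measurable_cst.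
    by apply/funext => x; rewrite /= ffunE.
  rewrite /Lp_norm (_ : EFin \o _ = cst 0%E) ?Lnorm0 ?ltry ?eqe//.
  by apply/funext => x /=; rewrite normr0.
move=> a f g /L2_predP/in_Lp2E[mf nf] /L2_predP/in_Lp2E[mg ng].
apply/L2_predP; have mfg := cmeasurable_lincomb a mf mg; split => //.
have H : (`|a| \o* (fun x => `|f x| : R)) \+ (fun x => `|g x| : R) \in Lfun dm 2%:E.
  apply: rpredD => // [|?]; first by rewrite lee_fin ler1n.
  by apply: Lfun_scale => //; rewrite ler1n.
move: (H); rewrite inE => /andP[/[!inE]/= mH Hlt].
apply: le_lt_trans Hlt; apply: Lnorm2_le => //; first exact: cmeasurable_norm.
by move=> x; rewrite normr_ge0/= mulrC -normrZ ler_normD.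
Qed.

HB.instance Definition _ := GRing.isSubmodClosed.Build _ _ L2_pred L2_submod_closed.

Record L2fun := MkL2fun { L2fun_val :> Rn -> G; _ : L2fun_val \in L2_pred }.
HB.instance Definition _ := [isSub for L2fun_val].
HB.instance Definition _ := [Choice of L2fun by <:].
HB.instance Definition _ := [SubChoice_isSubLmodule of L2fun by <:].

Definition L2_eq (f g : L2fun) : bool :=
  `[< (f : Rn -> G) = g %[ae dm] >].

Lemma L2_eq_refl : reflexive L2_eq.
Proof. by move=> f; apply/asboolP; exact: ae_eq_refl. Qed.
Lemma L2_eq_sym : symmetric L2_eq.
Proof. by move=> f g; apply/asboolP/asboolP => /ae_eq_sym. Qed.
Lemma L2_eq_trans : transitive L2_eq.
Proof. by move=> g f h /asboolP fg /asboolP gh; apply/asboolP/(ae_eq_trans fg gh). Qed.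

Canonical L2_eq_equiv := EquivRel L2_eq L2_eq_refl L2_eq_sym L2_eq_trans.

Definition L2 := {eq_quot L2_eq}%qT.
HB.instance Definition _ := Choice.on L2.
HB.instance Definition _ := EqQuotient.on L2.
Definition L2_to_fun (F : L2) : Rn -> G := (repr F : L2fun).
Coercion L2_to_fun : L2 >-> Funclass.

Definition L2_class (f : L2fun) : L2 := \pi_L2%qT f.

Lemma L2_eqP (f g : L2fun) :
  L2_class f = L2_class g <-> (f : Rn -> G) = g %[ae dm].
Proof.
split=> [/eqmodP/asboolP //|fg].
by apply/eqmodP/asboolP.
Qed.

Lemma L2_reprE (f : L2fun) : (repr (L2_class f) : Rn -> G) = f %[ae dm].
Proof. by apply/L2_eqP; rewrite /L2_class reprK. Qed.

Lemma L2W (P : L2 -> Type) : (forall f : L2fun, P (L2_class f)) -> forall F, P F.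
Proof. exact: quotW. Qed.

Definition L2_add (F H : L2) : L2 := L2_class (repr F + repr H).
Definition L2_opp (F : L2) : L2 := L2_class (- repr F).
Definition L2_scale (a : R) (F : L2) : L2 := L2_class (a *: repr F).

Lemma pi_L2_add (f g : L2fun) : L2_add (L2_class f) (L2_class g) = L2_class (f + g).
Proof.
apply/L2_eqP; have := L2_reprE f; have := L2_reprE g.
by apply: filterS2 => x gx fx _; rewrite /= !fctE (fx I) (gx I).
Qed.

Lemma pi_L2_opp (f : L2fun) : L2_opp (L2_class f) = L2_class (- f).
Proof.
apply/L2_eqP; have := L2_reprE f.
by apply: filterS => x fx _; rewrite /= !fctE (fx I).
Qed.

Lemma pi_L2_scale a (f : L2fun) : L2_scale a (L2_class f) = L2_class (a *: f).
Proof.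
apply/L2_eqP; have := L2_reprE f.
by apply: filterS => x fx _; rewrite /= !fctE (fx I).
Qed.

Lemma L2_addA : associative L2_add.
Proof.
by elim/L2W => f; elim/L2W => g; elim/L2W => h; rewrite !pi_L2_add addrA.
Qed.
Lemma L2_addC : commutative L2_add.
Proof. by elim/L2W => f; elim/L2W => g; rewrite !pi_L2_add addrC. Qed.
Lemma L2_add0 : left_id (L2_class 0) L2_add.
Proof. by elim/L2W => f; rewrite pi_L2_add add0r. Qed.
Lemma L2_addN : left_inverse (L2_class 0) L2_opp L2_add.
Proof. by elim/L2W => f; rewrite pi_L2_opp pi_L2_add addNr. Qed.

HB.instance Definition _ := GRing.isZmodule.Build L2
  L2_addA L2_addC L2_add0 L2_addN.

Lemma L2_scaleA a b F : L2_scale a (L2_scale b F) = L2_scale (a * b) F.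
Proof. by elim/L2W: F => f; rewrite !pi_L2_scale scalerA. Qed.
Lemma L2_scale1 : left_id 1 L2_scale.
Proof. by elim/L2W => f; rewrite pi_L2_scale scale1r. Qed.
Lemma L2_scaleDr : right_distributive L2_scale +%R.
Proof.
move=> a; elim/L2W => f; elim/L2W => g.
by rewrite [LHS](congr1 _ (pi_L2_add f g)) !pi_L2_scale scalerDr -pi_L2_add.
Qed.
Lemma L2_scaleDl F : {morph L2_scale^~ F : a b / a + b}.
Proof.
by move=> a b; elim/L2W: F => f; rewrite !pi_L2_scale scalerDl -pi_L2_add.
Qed.

HB.instance Definition _ := GRing.Zmodule_isLmodule.Build R L2
  L2_scaleA L2_scale1 L2_scaleDr L2_scaleDl.

Definition L2_norm (F : L2) : R := fine (Lp_norm 2%:E F).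

Lemma L2funP (f : L2fun) :
  cmeasurable f /\ (fun x => `|(f : Rn -> G) x| : R) \in Lfun dm 2%:E.
Proof. exact/in_Lp2E/L2_predP/valP. Qed.

Lemma Lp_norm2_fin (f : L2fun) : Lp_norm 2%:E f \is a fin_num.
Proof.
have /L2_predP[_ fy] := valP f.
by rewrite ge0_fin_numE//; exact: Lnorm_ge0.
Qed.

Lemma Lp_norm2_ae (f g : L2fun) : (f : Rn -> G) = g %[ae dm] ->
  Lp_norm 2%:E f = Lp_norm 2%:E g.
Proof.
move=> fg; rewrite /Lp_norm unlock; apply: (congr1 (fun z => z `^ 2^-1)%E).
have [mf _] := L2funP f; have [mg _] := L2funP g.
apply: ge0_ae_eq_integral => //.
- exact: (measurable_sqr_norm (cmeasurable_norm mf)).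
- exact: (measurable_sqr_norm (cmeasurable_norm mg)).
- by move=> x _; exact: poweR_ge0.
- by move=> x _; exact: poweR_ge0.
- by apply: filterS fg => x fgx xT /=; rewrite (fgx I).
Qed.

Lemma L2_normE (f : L2fun) : (L2_norm (L2_class f))%:E = Lp_norm 2%:E f.
Proof. by rewrite fineK ?Lp_norm2_fin//; exact/Lp_norm2_ae/L2_reprE. Qed.

Lemma L2_normD F H : L2_norm (F + H) <= L2_norm F + L2_norm H.
Proof.
elim/L2W: F => f; elim/L2W: H => h.
rewrite [F in L2_norm F <= _]pi_L2_add -lee_fin EFinD !L2_normE.
have [mf _] := L2funP f; have [mh _] := L2funP h; have [mfh _] := L2funP (f + h).
have mF := cmeasurable_norm mf; have mH := cmeasurable_norm mh.
rewrite /Lp_norm.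
apply: le_trans (eminkowski _ mF mH _); last by rewrite lee_fin ler1n.
apply: Lnorm2_le; [exact: cmeasurable_norm|exact: measurable_funD|move=> x].
by rewrite normr_ge0 ler_normD.
Qed.

Lemma L2_normZ a F : L2_norm (a *: F) = `|a| * L2_norm F.
Proof.
elim/L2W: F => f; apply/EFin_inj.
rewrite [F in L2_norm F]pi_L2_scale EFinM !L2_normE.
have p1 : (1 <= 2%:E :> \bar R)%E by rewrite lee_fin ler1n.
have [_ Lf] := L2funP f.
have := LnormZ (Lfun_Sub p1 Lf) `|a|; rewrite /= normr_id => <-.
by rewrite /Lp_norm; congr (Lnorm _ _ (EFin \o _)); apply/funext => x; exact: normrZ.
Qed.

Lemma L2_norm0_eq0 F : L2_norm F = 0 -> F = 0.
Proof.
elim/L2W: F => f f0; have := L2_normE f; rewrite {}f0 => /esym f0.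
have [mf _] := L2funP f.
have /Lnorm_eq0_eq0 : measurable_fun setT (EFin \o (fun x => `|(f : Rn -> G) x| : R)).
  by apply/measurable_EFinP; exact: cmeasurable_norm.
move=> /(_ dm 2%:E); rewrite lte_fin ltr0n => /(_ isT f0) f00.
apply/L2_eqP; apply: filterS f00 => x /= fx _.
by apply/normr0_eq0; have [] := fx I.
Qed.

HB.instance Definition _ := @Lmodule_isNormed.Build R L2 L2_norm
  L2_normD L2_normZ L2_norm0_eq0.

(* The inner product is taken with respect to dx while the norm is taken with
   respect to dm: they match up to the factor in L2_norm_inner. *)
Definition L2_inner (F H : L2) : R := \int[dx]_x scalar_prod (F x) (H x).

Lemma L2_norm_inner (F : L2) : `|F| ^+ 2 = (2 * pi) `^ (- (n%:R / 2)) * L2_inner F F.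
Proof.
have [mF _] := L2funP (repr F).
have fF := Lp_norm2_fin (repr F).
have sE x : scalar_prod (F x) (F x) = `|F x| ^+ 2.
  by rewrite sqr_sqrtr// scalar_prod_ge0.
have N2 : ((`|F| ^+ 2)%:E = \int[dm]_x (`|F x| ^+ 2)%:E)%E.
  rewrite -powR_mulrn// -poweR_EFin fineK// poweR_Lnorm//.
  by apply: eq_integral => x _ /=; rewrite ger0_norm// powR_mulrn.
have mF2 : measurable_fun setT (fun x => (`|F x| ^+ 2)%:E).
  by apply/measurable_EFinP; apply: measurable_funX; exact: cmeasurable_norm.
have F2_ge0 x : (0 <= (`|F x| ^+ 2)%:E)%E by rewrite lee_fin sqr_ge0.
move: N2; rewrite ge0_integral_mscale//=.
have -> : L2_inner F F = fine (\int[dx]_x (`|F x| ^+ 2)%:E).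
  by congr fine; apply: eq_integral => x _; rewrite sE.
set c := _ `^ _; have c0 : 0 < c by rewrite powR_gt0// mulr_gt0// pi_gt0.
have : (0 <= \int[dx]_x (`|F x| ^+ 2)%:E)%E by exact: integral_ge0.
case: (\int[dx]_x _)%E => [r _ [->]//|_|//].
by rewrite gt0_muley ?lte_fin.
Qed.

End L2.

Arguments L2 : clear implicits.

Section CliffordFourier.
Context {R : realType} {n : nat}.
Local Notation Rn := (n.-tuple (measurableTypeR R)).
Local Notation G := (clifford R (n + n)).
Implicit Types (f : Rn -> G) (x y : Rn).

(* The first n generators are e_1, ..., e_n, the last n are e'_1, ..., e'_n. *)
Definition bivector (i : 'I_n) : G :=
  generator (lshift n i) * generator (rshift n i).

Lemma bivector_sqr i : bivector i * bivector i = -1.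
Proof.
rewrite /bivector mulrA -[X in X * _]mulrA generator_anticomm; last first.
  by rewrite eq_sym eq_lrshift.
by rewrite mulrN mulNr mulrA generator_sqr mul1r generator_sqr.
Qed.

Definition phase x y : G :=
  \sum_(i < n) ((tnth x i : R) * (tnth y i : R)) *: bivector i.

Definition cintegral f : G := [ffun S => \int[dm]_x (f x S : R)].

(* These integrals are meaningful for f in L_1; they are extended to L_2 below. *)
Definition fourier_left f y : G :=
  cintegral (fun x => clifford_exp (- phase x y) * f x).

Definition fourier_right f y : G :=
  cintegral (fun x => f x * clifford_exp (- phase x y)).

Definition continuous_extension (T : (Rn -> G) -> (Rn -> G)) : set (L2 R n -> L2 R n) :=
  [set U : L2 R n -> L2 R n | continuous U /\
           forall F : L2 R n, in_Lp 1 F -> (U F : Rn -> G) = T F %[ae dm]].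

(* The continuous extension of T from L_1 :&: L_2 to L_2. The default value 0
   is not an isomorphism, so that hilbert_isomorphism (L2_extend T) entails that
   T has a continuous extension. *)
Definition L2_extend T : L2 R n -> L2 R n :=
  xget (fun=> 0) (continuous_extension T).

Definition L2_fourier_left := L2_extend fourier_left.
Definition L2_fourier_right := L2_extend fourier_right.

Definition hilbert_isomorphism (U : L2 R n -> L2 R n) : Prop :=
  [/\ linear U, bijective U & forall F H, L2_inner (U F) (U H) = L2_inner F H].

End CliffordFourier.
Arguments L2_fourier_left : clear implicits.
Arguments L2_fourier_right : clear implicits.

(* Main.v *)
Require Import Defs.
From mathcomp Require Import all_boot all_algebra all_classical all_reals all_analysis.
From HB Require Import structures.
From mathcomp Require Import all_order.
From mathcomp Require Import measurable_realfun.
From mathcomp Require Import ring lra.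

(** The B_i commute and square to -1, so e^(-I(x, y)) is the product of the factors
    cos (x_i y_i) - B_i sin (x_i y_i). Hence the transform of the indicator of a box times a
    blade is explicit, and the scalar product of two such transforms factors over the
    coordinates: the mixed terms vanish by parity, the other ones reduce to the integral
    of (1 - cos (t y)) / y^2, which is pi |t|. This is the isometry on box functions.
    The adjoint of the transform is, by Fubini, the transform on the same side with the
    opposite sign, for which the same computation holds. As L2 is complete and only 0 is
    orthogonal to all box functions, both extend by density to isometries of L2, inverse
    to each other. *)

Set Implicit Arguments.
Unset Strict Implicit.
Unset Printing Implicit Defensive.
Import Order.TTheory GRing.Theory Num.Theory.
Import numFieldNormedType.Exports.

Local Open Scope classical_set_scope.
Local Open Scope ring_scope.

(** Boxes serve both halves of the argument. They are closed under intersection and generate the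
    Borel sets, which gives totality; their indicators are products over the coordinates, which
    gives explicit transforms. The integral defining a transform makes sense only on L1, so the
    unitary map is first built abstractly from its values on box functions and compared with the
    integral afterwards. An isometry given on generators extends only to an isometric embedding;
    surjectivity is what the adjoint is for. The scalar product of two interval transforms involves
    the four differences t of endpoints: the values pi |t| add up, with signs, to 2 pi times the
    length of the overlap, and the square of (2 pi)^(-n/2) cancels one factor 2 pi per coordinate.
    Noncommutativity stays inside finite sums: the kernel is a sum over subsets P of real functions
    times products of the B_i, so the analysis concerns real functions only, and left and right
    multiplication are treated at once. *)

(** * Integrals of real functions and almost everywhere statements *)

Section RealIntegral.
Context {R : realType} d (T : measurableType d) (nu : {measure set T -> \bar R}).
Implicit Types (f g h k : T -> R).

(** Since |f g| <= f^2 + g^2. The bounds [h] and [k] replace the squares so that one dominating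
    function, such as the sum of the squares of [cosint] and [sinint], serves for either factor. *)
Lemma integrable_mul_sqr (f g h k : T -> R) :
  measurable_fun setT f -> measurable_fun setT g ->
  nu.-integrable setT (EFin \o h) -> nu.-integrable setT (EFin \o k) ->
  (forall t, f t ^+ 2 <= h t) -> (forall t, g t ^+ 2 <= k t) ->
  nu.-integrable setT (EFin \o (fun x => f x * g x)).
Proof.
move=> mf mg hi ki fh gk.
apply: (@le_integrable _ _ _ nu _ measurableT _ (EFin \o (fun x => h x + k x))).
- by apply/measurable_EFinP; exact: measurable_funM.
- move=> x _ /=; rewrite lee_fin [leRHS]ger0_norm; last first.
    by rewrite addr_ge0// (le_trans (sqr_ge0 _) (fh x), le_trans (sqr_ge0 _) (gk x)).
  apply: le_trans (lerD (fh x) (gk x)).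
  by rewrite ler_norml; apply/andP; split; nra.
- exact: (integrableD measurableT hi ki).
Qed.

Lemma ae_imp (P Q : T -> Prop) : (forall t, P t -> Q t) ->
  {ae nu, forall t, P t} -> {ae nu, forall t, Q t}.
Proof. exact: filterS. Qed.

Lemma Rintegral_ae_eq (f g : T -> R) :
  measurable_fun setT f -> measurable_fun setT g -> {ae nu, forall x, f x = g x} ->
  \int[nu]_x f x = \int[nu]_x g x.
Proof.
move=> mf mg fg; congr fine; apply: ae_eq_integral => //; try exact/measurable_EFinP.
by apply: filterS fg => x -> _.
Qed.

Lemma ae_forall_finType (I : finType) (P : I -> T -> Prop) :
  (forall i, {ae nu, forall t, P i t}) -> {ae nu, forall t i, P i t}.
Proof.
move=> aeP.
(* The finite index is coded by its rank, so that the countable case [ae_foralln] applies; ranks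
   beyond [#|I|] are vacuous. *)
have : {ae nu, forall t (k : nat) i, enum_rank i = k :> nat -> P i t}.
  apply/ae_foralln => k; have [kI|kI] := ltnP k #|I|.
    apply: filterS (aeP (enum_val (Ordinal kI))) => t Pt i ik.
    have -> // : i = enum_val (Ordinal kI).
    by rewrite -(enum_rankK i); congr enum_val; exact/val_inj.
  by apply: nearW => t i ik; have := ltn_ord (enum_rank i); rewrite ik ltnNge kI.
by apply: filterS => t Pt i; exact: (Pt (enum_rank i)).
Qed.

Lemma integrable_sumR I (s : seq I) (f : I -> T -> R) :
  (forall i, nu.-integrable setT (EFin \o f i)) ->
  nu.-integrable setT (EFin \o (fun x => \sum_(i <- s) f i x)).
Proof.
move=> fi; have := @integrable_sum _ _ _ nu setT measurableT I s xpredT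
  (fun i => EFin \o f i) (fun i _ => fi i).
by apply: eq_integrable => // x _; rewrite /= sumEFin.
Qed.

Lemma Rintegral_sum I (s : seq I) (f : I -> T -> R) :
  (forall i, nu.-integrable setT (EFin \o f i)) ->
  \int[nu]_x (\sum_(i <- s) f i x) = \sum_(i <- s) \int[nu]_x f i x.
Proof.
move=> fi; elim: s => [|i s IHs].
  rewrite big_nil; under eq_Rintegral do rewrite big_nil.
  by rewrite /Rintegral integral0_eq.
rewrite big_cons -IHs; under eq_Rintegral do rewrite big_cons.
by rewrite RintegralD//; exact: integrable_sumR.
Qed.

Lemma integrableZR (k : R) (f : T -> R) : nu.-integrable setT (EFin \o f) ->
  nu.-integrable setT (EFin \o (fun x => k * f x)).
Proof. by move=> fi; have := integrableZl measurableT k fi. Qed.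

Lemma integrableDR (f g : T -> R) : nu.-integrable setT (EFin \o f) ->
  nu.-integrable setT (EFin \o g) -> nu.-integrable setT (EFin \o (fun x => f x + g x)).
Proof. by move=> fi gi; have := integrableD measurableT fi gi. Qed.

Lemma integrable_le (f g : T -> R) : measurable_fun setT f -> (forall x, `|f x| <= g x) ->
  nu.-integrable setT (EFin \o g) -> nu.-integrable setT (EFin \o f).
Proof.
move=> mf fg; apply: le_integrable => //; first exact/measurable_EFinP.
by move=> x _; rewrite lee_fin (le_trans (fg x))// ler_norm.
Qed.

End RealIntegral.

(** * The transform of intervals *)

Section OneDim.
Context {R : realType}.
Local Notation mu := (@lebesgue_measure R).
Implicit Types (a b s t x y : R).

Lemma is_derive_scale_fun (f : R -> R) t y d : is_derive (t * y) 1 f d ->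
  is_derive y 1 (fun y => f (t * y)) (t * d).
Proof.
move=> fd; have lin : is_derive y 1 (fun y : R => t * y) t.
  have := @is_deriveZ _ _ _ (id : R -> R) t y 1 1 (is_derive_id _ _).
  by rewrite /GRing.scale/= mulr1.
by have := @is_derive1_comp _ f (fun y => t * y) y _ _ fd lin; rewrite mulrC.
Qed.

Lemma is_derive_mul (f g : R -> R) y a b : is_derive y 1 f a -> is_derive y 1 g b ->
  is_derive y 1 (fun y => f y * g y) (a * g y + f y * b).
Proof.
move=> df dg; apply: (is_derive_eq (is_deriveM df dg)).
by rewrite /GRing.scale/=; ring.
Qed.

Lemma is_derive_lin (f g : R -> R) k l m y a b : is_derive y 1 f a -> is_derive y 1 g b ->
  is_derive y 1 (fun y => k * f y + l * g y + m) (k * a + l * b).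
Proof.
move=> df dg.
have := is_deriveD (is_deriveD (is_deriveZ k df) (is_deriveZ l dg)) (is_derive_cst m y 1).
by rewrite addr0.
Qed.

Lemma continuous_is_derive (F f : R -> R) : (forall y, is_derive y 1 F (f y)) ->
  continuous F.
Proof.
move=> dF y; apply/differentiable_continuous/derivable1_diffP.
by have [] := dF y.
Qed.

Lemma ge0_FTC2y (f F : R -> R) (l : R) : (forall y, 0 <= y -> 0 <= f y) ->
  continuous f -> (forall y, is_derive y 1 F (f y)) ->
  F y @[y --> +oo%R] --> l ->
  (\int[mu]_(y in `[0%R, +oo[) (f y)%:E = (l - F 0)%:E)%E.
Proof.
move=> f0 cf dF Fl; rewrite (@ge0_continuous_FTC2y _ f F 0 l)//.
- exact: continuous_subspaceT.
- by apply: cvg_at_right_filter; exact: (continuous_is_derive dF).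
- by move=> y _; rewrite derive1E; have [_ ->] := dF y.
Qed.

Lemma is_derive_expRN s y : is_derive y 1 (fun y => expR (- s * y)) (- s * expR (- s * y)).
Proof. exact: is_derive_scale_fun. Qed.

Lemma cvg_dominated_expR (F : R -> R) s C : 0 < s ->
  (forall y, 0 <= y -> `|F y| <= C * expR (- s * y)) -> F y @[y --> +oo%R] --> 0.
Proof.
move=> s0 FC; apply/norm_cvg0P.
apply: (@squeeze_cvgr _ _ _ _ (cst 0) (fun y => C * expR (- s * y))).
- near=> y; rewrite normr_ge0/= FC//; near: y; exact: nbhs_pinfty_ge.
- exact: cvg_cst.
- rewrite -[X in _ --> X](mulr0 C); apply: cvgMr.
  rewrite (_ : (fun y => _) = (fun y => expR (- y)) \o (fun y => s * y)); last first.
    by apply/funext => y /=; rewrite mulNr.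
  apply: cvg_comp; last exact: cvgr_expR.
  exact: gt0_cvgMry.
Unshelve. all: by end_near. Qed.

Lemma pos_eq0y (f : R -> \bar R) : (\int[mu]_x (if (0 < x)%R then f x else 0%E) =
  \int[mu]_(x in `]0%R, +oo[) f x)%E.
Proof.
rewrite [RHS]integral_mkcond; apply: eq_integral => x _.
rewrite patchE; case: ifPn => x0; case: ifPn => //.
  by rewrite notin_setE/= in_itv/= andbT x0.
by rewrite inE/= in_itv/= andbT (negbTE x0).
Qed.

Lemma pos_eq0yc (f : R -> R) : measurable_fun setT f ->
  (\int[mu]_x (if (0 < x)%R then (f x)%:E else 0%E) =
  \int[mu]_(x in `[0%R, +oo[) (f x)%:E)%E.
Proof.
move=> mf; rewrite (pos_eq0y (EFin \o f))/= integral_itv_obnd_cbnd//.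
by apply/measurable_EFinP; exact: measurable_funTS.
Qed.

Lemma integral_xexp y : 0 < y ->
  (\int[mu]_(s in `[0%R, +oo[) (s * expR (- y * s))%:E = (y ^- 2)%:E)%E.
Proof.
move=> y0; have yn0 := lt0r_neq0 y0.
pose F s := - (s / y + y ^- 2) * expR (- y * s).
have dF s : is_derive s 1 F (s * expR (- y * s)).
  have E : F = (fun s => (- y^-1 * s + 0 * s + - y ^- 2) * expR (- y * s)).
    by apply/funext => z; rewrite /F; congr (_ * _); field.
  rewrite {}E; apply: (is_derive_eq (is_derive_mul
    (is_derive_lin _ _ _ (is_derive_id s 1) (is_derive_id s 1)) (is_derive_expRN y s))).
  by field.
rewrite (ge0_FTC2y (l := 0) _ _ dF).
- by rewrite /F mul0r mulr0 expR0 mulr1 !add0r opprK.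
- by move=> s s0; rewrite mulr_ge0 ?expR_ge0.
- move=> s; apply: cvgM; first exact: cvg_id.
  exact: (continuous_is_derive (is_derive_expRN y)).
(* Half of the decay rate absorbs the linear factor: y s + 1 <= 2 (1 + y s / 2) <= 2 e^(y s / 2). *)
- apply: (@cvg_dominated_expR F (y / 2) (2 * y ^- 2)); first by rewrite divr_gt0.
  move=> s s0; rewrite /F normrM (ger0_norm (expR_ge0 _)) normrN ger0_norm; last first.
    by rewrite addr_ge0 ?mulr_ge0 ?invr_ge0 ?exprn_ge0// ltW.
  have -> : expR (- y * s) = expR (- (y / 2) * s) * expR (- (y / 2) * s).
    by rewrite -expRD; congr expR; field.
  rewrite mulrA ler_wpM2r ?expR_ge0// mulNr expRN ler_pdivrMr ?expR_gt0//.
  have : 1 + y / 2 * s <= expR (y / 2 * s) by exact: expR_ge1Dx.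
  set e := expR _ => he.
  have -> : s / y + y ^- 2 = y ^- 2 * (y * s + 1) by field.
  rewrite [2 * _]mulrC -mulrA ler_wpM2l ?invr_ge0 ?exprn_ge0 ?ltW//; lra.
Qed.

Lemma integral_exp_cos s t : 0 < s ->
  (\int[mu]_(y in `[0%R, +oo[) ((1 - cos (t * y)) * expR (- s * y))%:E =
   (s^-1 - s / (s ^+ 2 + t ^+ 2))%:E)%E.
Proof.
move=> s0.
have st0 : 0 < s ^+ 2 + t ^+ 2 by rewrite ltr_pwDl ?exprn_gt0 ?sqr_ge0.
(* The first quotient yields an antiderivative of - cos (t y) e^(-s y), obtained by integrating by
   parts twice; the term [s^-1] accounts for e^(-s y). *)
pose F y : R := ((s * cos (t * y) - t * sin (t * y)) / (s ^+ 2 + t ^+ 2) - s^-1) * expR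
  (- s * y).
have dF y : is_derive y 1 F ((1 - cos (t * y)) * expR (- s * y)).
  have dcos := is_derive_scale_fun (is_derive_cos (t * y)).
  have dsin := is_derive_scale_fun (is_derive_sin (t * y)).
  pose q := (s ^+ 2 + t ^+ 2)^-1.
  have E : F = (fun y => (s * q * cos (t * y) + - t * q * sin (t * y) + - s^-1) * expR
    (- s * y)).
    by apply/funext => z; rewrite /F -/q; congr (_ * _); ring.
  rewrite {}E; apply: (is_derive_eq (is_derive_mul
    (is_derive_lin _ _ _ dcos dsin) (is_derive_expRN s y))).
  by rewrite /q; field; rewrite !gt_eqF.
rewrite (ge0_FTC2y (l := 0) _ _ dF).
- by rewrite /F !mulr0 cos0 sin0 expR0 !mulr1 mulr0 subr0 sub0r opprB.
- by move=> y _; rewrite mulr_ge0 ?expR_ge0// subr_ge0 cos_le1.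
- have dcos y := is_derive_scale_fun (is_derive_cos (t * y)).
  move=> y; apply: cvgM; last exact: (continuous_is_derive (is_derive_expRN s)).
  apply: cvgB; first exact: cvg_cst.
  exact: (continuous_is_derive dcos).
- apply: (@cvg_dominated_expR F s ((s + `|t|) / (s ^+ 2 + t ^+ 2) + s^-1)) => // y _.
  rewrite /F normrM (ger0_norm (expR_ge0 _)) ler_wpM2r ?expR_ge0//.
  have sV0 : 0 <= s^-1 by rewrite invr_ge0 ltW.
  have stV0 : 0 <= (s ^+ 2 + t ^+ 2)^-1 by rewrite invr_ge0 ltW.
  apply: le_trans (ler_normB _ _) _.
  rewrite [X in _ + X <= _]ger0_norm// lerD2r normrM [X in _ * X]ger0_norm//.
  rewrite ler_wpM2r//; apply: le_trans (ler_normB _ _) _; rewrite lerD// normrM.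
    by rewrite (gtr0_norm s0) ler_piMr ?(ltW s0)// ler_norml cos_geN1 cos_le1.
  by rewrite ler_piMr// ler_norml sin_geN1 sin_le1.
Qed.

(** The integrand is [s] times the value found in [integral_exp_cos], and its antiderivative is t
    atan (s / t). *)
Lemma integral_lorentz t : 0 < t ->
  (\int[mu]_(s in `[0%R, +oo[) (t ^+ 2 / (s ^+ 2 + t ^+ 2))%:E = (t * (pi / 2))%:E)%E.
Proof.
move=> t0; have t1 : t != 0 by exact: lt0r_neq0.
have st0 s : 0 < s ^+ 2 + t ^+ 2 by rewrite ltr_pwDr ?exprn_gt0 ?sqr_ge0.
have dF s : is_derive s 1 (fun s => t * atan (t^-1 * s)) (t ^+ 2 / (s ^+ 2 + t ^+ 2)).
  have := is_derive_scale_fun (is_derive1_atan (t^-1 * s)) => da.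
  rewrite (_ : (fun s => _) = t *: (fun y => atan (t^-1 * y)))//.
  apply: is_derive_eq; rewrite /GRing.scale/=; field; rewrite t1/=.
  by rewrite gt_eqF ?st0.
rewrite (ge0_FTC2y (l := t * (pi / 2)) _ _ dF).
- by rewrite mulr0 atan0 mulr0 subr0.
- by move=> s _; rewrite divr_ge0 ?sqr_ge0// ltW.
- move=> s; apply: cvgM; first exact: cvg_cst.
  apply: cvgV; first exact: lt0r_neq0.
  by apply: cvgD; [exact: exprn_continuous|exact: cvg_cst].
- have h : t^-1 * s @[s --> +oo%R] --> +oo%R.
    by apply: gt0_cvgMry; rewrite ?invr_gt0.
  by apply: cvgMr; exact: (cvg_comp _ _ h (@cvgy_atan R)).
Qed.

Lemma ge0_integral_opp (f : R -> \bar R) : measurable_fun setT f ->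
  (forall x, (0 <= f x)%E) -> (\int[mu]_x f (- x)%R = \int[mu]_x f x)%E.
Proof.
move=> mf f0.
have := @ge0_integral_pushforward _ _ (measurableTypeR R) (measurableTypeR R) R (-%R) _ mu
  setT f.
rewrite preimage_setT => H; rewrite -[LHS]H//.
by apply: eq_measure_integral => A mA _; exact: lebesgue_measureN.
Qed.

Lemma Rintegral_odd (f : R -> R) : mu.-integrable setT (EFin \o f) ->
  (forall x, f (- x) = - f x) -> \int[mu]_x f x = 0.
Proof.
move=> fi fN.
have mf := measurable_int _ fi.
have fiN : mu.-integrable setT (EFin \o (fun x => f (- x))).
  have := integrableN fi; apply: eq_integrable => //= x _.
  by rewrite fN.
have E : (\int[mu]_x (f (- x))%:E = \int[mu]_x (f x)%:E)%E.
  have := @integral_pushforward _ _ (measurableTypeR R) (measurableTypeR R) R (-%R) _ mu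
    setT (EFin \o f).
  rewrite preimage_setT => H; rewrite -[LHS]H//.
  by apply: eq_measure_integral => A mA _; exact: lebesgue_measureN.
suff H : - (\int[mu]_x f x) = \int[mu]_x f x by apply/eqP; rewrite -eqNr H.
apply/esym; rewrite {1}/Rintegral -E; transitivity (\int[mu]_x (-1 * f x)).
  by apply: eq_Rintegral => x _; rewrite fN mulN1r.
by rewrite RintegralZl// mulN1r.
Qed.

(** Products of interval transforms are combinations of these functions, see [cosint_sinint]. The
    value at y = 0 is 0, because division by 0 gives 0. *)
Definition cosdiv t y : R := (1 - cos (t * y)) / y ^+ 2.

Lemma cosdiv_ge0 t y : 0 <= cosdiv t y.
Proof. by rewrite divr_ge0 ?sqr_ge0// subr_ge0 cos_le1. Qed.

Lemma cosdivN t y : cosdiv t (- y) = cosdiv t y.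
Proof. by rewrite /cosdiv mulrN cosN sqrrN. Qed.

Lemma measurable_cos_scale t : measurable_fun setT (fun y : R => cos (t * y)).
Proof.
apply: continuous_measurable_fun => y.
apply: (@continuous_comp _ _ _ (fun y => t * y) cos); last exact: continuous_cos.
exact: mulrl_continuous.
Qed.

Lemma measurable_invR : measurable_fun setT (fun x : R => x^-1).
Proof.
rewrite -(setvU [set 0 : R]).
apply/measurable_funU => //; first exact: measurableC.
split; last exact: measurable_fun_set1.
apply: open_continuous_measurable_fun; first by rewrite openC; exact: closed_eq.
by move=> x /set_mem/= /eqP x0; exact: inv_continuous.
Qed.

Lemma measurable_cosdiv t : measurable_fun setT (cosdiv t).
Proof.
apply: measurable_funM; first by apply: measurable_funB => //; exact: measurable_cos_scale.
apply: (@measurableT_comp _ _ _ _ _ _ (fun y : R => y^-1) _ (fun y : R => y ^+ 2)).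
  exact: measurable_invR.
exact: exprn_measurable.
Qed.

(* For y > 0, y^-2 is the integral of s e^(-y s) over s > 0; exchanging the integrals
   leaves elementary Laplace transforms. *)
Lemma integral_cosdiv_pos t : 0 < t ->
  (\int[mu]_y (if (0 < y)%R then (cosdiv t y)%:E else 0) = (t * (pi / 2))%:E)%E.
Proof.
move=> t0.
pose k (p : measurableTypeR R * measurableTypeR R) : R :=
  (1 - cos (t * p.1)) * (p.2 * expR (- p.1 * p.2)).
(* Cutting off to the open quadrant makes the integrand non-negative on the whole plane, so Tonelli
   applies to [mu] itself. *)
pose f (p : measurableTypeR R * measurableTypeR R) : \bar R :=
  if (0 < p.1) && (0 < p.2) then (k p)%:E else 0%E.
have mk : measurable_fun setT k.
  apply: measurable_funM.
    apply: measurable_funB => //.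
    by apply: (measurableT_comp (measurable_cos_scale t)); exact: measurable_fst.
  apply: measurable_funM; first exact: measurable_snd.
  apply: measurableT_comp; first exact: measurable_expR.
  apply: measurable_funM; last exact: measurable_snd.
  by apply: measurable_funN; exact: measurable_fst.
have mf : measurable_fun setT f.
  apply: measurable_fun_ifT => //; last exact/measurable_EFinP.
  apply: measurable_and; apply: (@measurable_fun_ltr _ _ R setT (cst 0)) => //.
have f0 p : (0 <= f p)%E.
  rewrite /f; case: ifP => // /andP[p1 p2].
  by rewrite lee_fin mulr_ge0 ?subr_ge0 ?cos_le1// mulr_ge0 ?expR_ge0// ltW.
transitivity (\int[mu]_y \int[mu]_s f (y, s))%E.
  apply: eq_integral => y _; rewrite /f/=.
  case: ifPn => y0; last by rewrite integral0_eq.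
  rewrite (pos_eq0yc (f := fun s => k (y, s))); last exact: (measurableT_comp mk).
  rewrite /k/=; under eq_integral do rewrite EFinM.
  rewrite ge0_integralZl//=.
  - by rewrite integral_xexp// -EFinM.
  - apply/measurable_EFinP; apply: measurable_funTS.
    apply: measurable_funM => //; apply: continuous_measurable_fun.
    exact: (continuous_is_derive (is_derive_expRN y)).
  - by move=> s /=; rewrite in_itv/= andbT => s0; rewrite lee_fin mulr_ge0// expR_ge0.
rewrite fubini_tonelli//.
transitivity (\int[mu]_s (if (0 < s)%R then (t ^+ 2 / (s ^+ 2 + t ^+ 2))%:E else 0))%E.
  apply: eq_integral => s _; rewrite /f/=.
  case: ifPn => s0; last by under eq_integral do rewrite andbF; rewrite integral0_eq.
  under eq_integral do rewrite andbT.
  rewrite (pos_eq0yc (f := fun y => k (y, s))); last exact: (measurableT_comp mk).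
  transitivity (\int[mu]_(y in `[0%R, +oo[) (s%:E * ((1 - cos (t * y)) * expR (- s * y))%:E))%E.
    by apply: eq_integral => y _; rewrite /k/= -EFinM; congr EFin; rewrite mulNr (mulrC y)
      -mulNr; ring.
  rewrite ge0_integralZl//=.
  - rewrite integral_exp_cos// -EFinM; congr EFin; field.
    by rewrite !gt_eqF// ltr_pwDl ?exprn_gt0 ?sqr_ge0.
  - apply/measurable_EFinP; apply: measurable_funTS.
    apply: measurable_funM.
      by apply: measurable_funB => //; exact: measurable_cos_scale.
    by apply: continuous_measurable_fun; exact: (continuous_is_derive (is_derive_expRN s)).
  - by rewrite lee_fin ltW.
rewrite (pos_eq0yc (f := fun s => t ^+ 2 / (s ^+ 2 + t ^+ 2))); first exact: integral_lorentz.
apply: measurable_funM => //.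
apply: (@measurableT_comp _ _ _ _ _ _ (fun y : R => y^-1) _ (fun y : R => y ^+ 2 + t ^+ 2)).
  exact: measurable_invR.
by apply: measurable_funD => //; exact: exprn_measurable.
Qed.

Lemma integral_cosdiv t : (\int[mu]_y (cosdiv t y)%:E = (pi * `|t|)%:E)%E.
Proof.
wlog t0 : t / 0 < t => [H|].
  have [t0|t0|->] := ltgtP t 0; last 2 first.
  - exact: H.
  - rewrite normr0 mulr0 integral0_eq// => y _.
    by rewrite /cosdiv mul0r cos0 subrr mul0r.
  - rewrite -normrN -H ?oppr_gt0//; apply: eq_integral => y _.
    by rewrite /cosdiv mulNr cosN.
pose f y : \bar R := if 0 < y then (cosdiv t y)%:E else 0%E.
have f0 y : (0 <= f y)%E by rewrite /f; case: ifP => // _; rewrite lee_fin cosdiv_ge0.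
have mf : measurable_fun setT f.
  apply: measurable_fun_ifT => //; first exact: measurable_fun_ltr.
  by apply/measurable_EFinP; exact: measurable_cosdiv.
(* The even function is split into its two halves; the identity holds at 0 too, where all three
   terms vanish. *)
transitivity (\int[mu]_y (f y + f (- y)%R))%E.
  apply: eq_integral => y _; rewrite /f oppr_gt0 cosdivN.
  case: ltgtP => [||<-]; rewrite ?adde0 ?add0e//.
  by rewrite /cosdiv expr0n invr0 mulr0.
rewrite ge0_integralD//.
  rewrite ge0_integral_opp// integral_cosdiv_pos// -EFinD (gtr0_norm t0).
  by congr EFin; field.
by apply: measurableT_comp mf _; exact: oppr_measurable.
Qed.

Lemma integrable_cosdiv t : mu.-integrable setT (EFin \o cosdiv t).
Proof.
apply/integrableP; split; first by apply/measurable_EFinP; exact: measurable_cosdiv.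
under eq_integral do rewrite /= ger0_norm ?cosdiv_ge0//.
by rewrite integral_cosdiv ltry.
Qed.

(** With [sinint], the two real components of the unnormalised transform of the indicator of ]a,
    b]. *)
Definition cosint a b y : R := \int[mu]_(x in `]a, b]) cos (x * y).
Definition sinint a b y : R := \int[mu]_(x in `]a, b]) sin (x * y).

Lemma Rintegral_oc_FTC2 (F f : R -> R) a b : a <= b -> continuous f ->
  (forall x, is_derive x 1 F (f x)) -> \int[mu]_(x in `]a, b]) f x = F b - F a.
Proof.
rewrite le_eqVlt => /predU1P[<- _ _|ab cf dF].
  by rewrite set_itv_ge ?bnd_simp ?ltxx// Rintegral_set0 subrr.
rewrite /Rintegral integral_itv_obnd_cbnd//; last first.
  by apply/measurable_EFinP/measurable_funTS; exact: continuous_measurable_fun.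
rewrite (@continuous_FTC2 _ f F)//.
- exact: continuous_subspaceT.
- have cF := continuous_is_derive dF.
  split.
  + by move=> x _; have [] := dF x.
  + by apply: cvg_at_right_filter; exact: cF.
  + by apply: cvg_at_left_filter; exact: cF.
- by move=> x _; rewrite derive1E; have [_ ->] := dF x.
Qed.

Lemma continuous_cos_scaler y : continuous (fun x : R => cos (x * y)).
Proof.
move=> x; apply: (@continuous_comp _ _ _ (fun x => x * y) cos); last exact: continuous_cos.
exact: mulrr_continuous.
Qed.

Lemma continuous_sin_scaler y : continuous (fun x : R => sin (x * y)).
Proof.
move=> x; apply: (@continuous_comp _ _ _ (fun x => x * y) sin); last exact: continuous_sin.
exact: mulrr_continuous.
Qed.

Lemma cosintE a b y : a <= b ->
  cosint a b y = if y == 0 then b - a else (sin (b * y) - sin (a * y)) / y.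
Proof.
move=> ab; have cc := @continuous_cos_scaler y.
case: eqVneq => y0.
  have dF (x : R) : is_derive x 1 id (cos (x * y)).
    by rewrite y0 mulr0 cos0; exact: is_derive_id.
  by rewrite /cosint (Rintegral_oc_FTC2 ab cc dF).
have dF (x : R) : is_derive x 1 (fun x => y^-1 * sin (y * x) + 0 * sin (y * x) + 0)
  (cos (x * y)).
  have ds := is_derive_scale_fun (is_derive_sin (y * x)).
  apply: (is_derive_eq (is_derive_lin _ _ _ ds ds)).
  by rewrite (mulrC x); field.
by rewrite /cosint (Rintegral_oc_FTC2 ab cc dF) !mul0r !addr0 ![y * _]mulrC; field.
Qed.

Lemma sinintE a b y : a <= b ->
  sinint a b y = if y == 0 then 0 else (cos (a * y) - cos (b * y)) / y.
Proof.
move=> ab; have cc := @continuous_sin_scaler y.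
case: eqVneq => y0.
  have dF (x : R) : is_derive x 1 (cst 0) (sin (x * y)).
    by rewrite y0 mulr0 sin0; exact: is_derive_cst.
  by rewrite /sinint (Rintegral_oc_FTC2 ab cc dF) subrr.
have dF (x : R) : is_derive x 1 (fun x => - y^-1 * cos (y * x) + 0 * cos (y * x) + 0)
  (sin (x * y)).
  have ds := is_derive_scale_fun (is_derive_cos (y * x)).
  apply: (is_derive_eq (is_derive_lin _ _ _ ds ds)).
  by rewrite (mulrC x); field.
by rewrite /sinint (Rintegral_oc_FTC2 ab cc dF) !mul0r !addr0 ![y * _]mulrC; field.
Qed.

Lemma measurable_cosint a b : a <= b -> measurable_fun setT (cosint a b).
Proof.
move=> ab; rewrite (_ : cosint a b = fun y => if y ==
  0 then b - a else (sin (b * y) - sin (a * y)) / y); last first.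
  by apply/funext => y; exact: cosintE.
apply: measurable_fun_ifT => //.
  exact: measurable_fun_eqr.
apply: measurable_funM; last exact: measurable_invR.
apply: continuous_measurable_fun => y.
apply: cvgB; apply: (@continuous_comp _ _ _ (fun x => _ * x) sin);
  try exact: continuous_sin; exact: mulrl_continuous.
Qed.

Lemma measurable_sinint a b : a <= b -> measurable_fun setT (sinint a b).
Proof.
move=> ab; rewrite (_ : sinint a b = fun y => if y ==
  0 then 0 else (cos (a * y) - cos (b * y)) / y); last first.
  by apply/funext => y; exact: sinintE.
apply: measurable_fun_ifT => //.
  exact: measurable_fun_eqr.
apply: measurable_funM; last exact: measurable_invR.
by apply: measurable_funB; exact: measurable_cos_scale.
Qed.

Lemma cosintN a b y : cosint a b (- y) = cosint a b y.
Proof. by apply: eq_Rintegral => x _; rewrite mulrN cosN. Qed.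

Lemma sinintN a b y : a <= b -> sinint a b (- y) = - sinint a b y.
Proof.
move=> ab; rewrite !sinintE// oppr_eq0; case: eqP => [_|y0]; first by rewrite oppr0.
by rewrite !mulrN !cosN invrN mulrN.
Qed.

(** The addition formula for the cosine turns the numerator into cosines of the four endpoint
    differences. Their signs add up to 0, so each - cos may be replaced by 1 - cos, which makes
    every quotient integrable on its own. *)
Lemma cosint_sinint a b a' b' y : a <= b -> a' <= b' -> y != 0 ->
  cosint a b y * cosint a' b' y + sinint a b y * sinint a' b' y =
  cosdiv (b - a') y + cosdiv (a - b') y - cosdiv (b - b') y - cosdiv (a - a') y.
Proof.
move=> ab ab' y0; rewrite !cosintE// !sinintE// (negbTE y0) /cosdiv !mulrBl !cosB.
by field.
Qed.

Lemma ae_neq0 : {ae mu, forall y : R, y != 0}.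
Proof.
exists [set 0]; split => //; first exact: lebesgue_measure_set1.
by move=> y /= /negP; rewrite negbK => /eqP.
Qed.

(** For equal intervals [cosint_sinint] reduces to twice [cosdiv (b - a)] away from 0, as [cosdiv]
    is even in its first argument and vanishes when that argument is 0. *)
Lemma integrable_cosint2 a b : a <= b ->
  mu.-integrable setT (EFin \o (fun y => cosint a b y ^+ 2 + sinint a b y ^+ 2)).
Proof.
move=> ab.
have mc := measurable_cosint ab; have ms := measurable_sinint ab.
have mcs : measurable_fun setT (EFin \o (fun y => cosint a b y ^+ 2 + sinint a b y ^+ 2)).
  apply/measurable_EFinP; apply: measurable_funD; apply: measurable_funX => //.
apply/integrableP; split => //.
rewrite (@ge0_ae_eq_integral _ _ _ mu _ _ (fun y => (2 * cosdiv (b - a) y)%:E))//.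
- under eq_integral do rewrite EFinM.
  rewrite ge0_integralZl//=.
  + by rewrite integral_cosdiv -EFinM ltry.
  + by apply/measurable_EFinP; exact: measurable_cosdiv.
  + by move=> y _; rewrite lee_fin cosdiv_ge0.
- exact: measurableT_comp.
- by apply/measurable_EFinP; apply: measurable_funM => //; exact: measurable_cosdiv.
- by move=> y _; rewrite lee_fin mulr_ge0// cosdiv_ge0.
- apply: ae_imp ae_neq0 => y y0 _ /=.
  rewrite ger0_norm; last by rewrite addr_ge0 ?sqr_ge0.
  rewrite !expr2 cosint_sinint//; congr EFin.
  by rewrite !subrr -(opprB b a) /cosdiv mulNr cosN !mul0r cos0; ring.
Qed.

Lemma integrable_cos_cosint a b a' b' : a <= b -> a' <= b' -> 
  mu.-integrable setT (EFin \o (fun y => cosint a b y * cosint a' b' y)).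
Proof.
move=> ab ab'; apply: (integrable_mul_sqr _ _ (integrable_cosint2 ab) (integrable_cosint2 ab')).
- exact: measurable_cosint.
- exact: measurable_cosint.
- by move=> y; rewrite lerDl sqr_ge0.
- by move=> y; rewrite lerDl sqr_ge0.
Qed.

Lemma integrable_cos_sinint a b a' b' : a <= b -> a' <= b' -> 
  mu.-integrable setT (EFin \o (fun y => cosint a b y * sinint a' b' y)).
Proof.
move=> ab ab'; apply: (integrable_mul_sqr _ _ (integrable_cosint2 ab) (integrable_cosint2 ab')).
- exact: measurable_cosint.
- exact: measurable_sinint.
- by move=> y; rewrite lerDl sqr_ge0.
- by move=> y; rewrite lerDr sqr_ge0.
Qed.

Lemma integrable_sin_sinint a b a' b' : a <= b -> a' <= b' -> 
  mu.-integrable setT (EFin \o (fun y => sinint a b y * sinint a' b' y)).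
Proof.
move=> ab ab'; apply: (integrable_mul_sqr _ _ (integrable_cosint2 ab) (integrable_cosint2 ab')).
- exact: measurable_sinint.
- exact: measurable_sinint.
- by move=> y; rewrite lerDr sqr_ge0.
- by move=> y; rewrite lerDr sqr_ge0.
Qed.

Lemma Rintegral_cos_sinint a b a' b' : a <= b -> a' <= b' ->
  \int[mu]_y (cosint a b y * sinint a' b' y) = 0.
Proof.
move=> ab ab'; apply: Rintegral_odd; first exact: integrable_cos_sinint.
by move=> y; rewrite cosintN sinintN// mulrN.
Qed.

Lemma Rintegral_cosdiv t : \int[mu]_y cosdiv t y = pi * `|t|.
Proof. by rewrite /Rintegral integral_cosdiv. Qed.

Lemma Rintegral_cosint_sinint a b a' b' : a <= b -> a' <= b' ->
  \int[mu]_y (cosint a b y * cosint a' b' y) + \int[mu]_y (sinint a b y * sinint a' b' y) =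
  pi * (`|b - a'| + `|a - b'| - `|b - b'| - `|a - a'|).
Proof.
move=> ab ab'; have Ic := integrable_cos_cosint ab ab'; have Is := integrable_sin_sinint ab ab'.
have Id := integrable_cosdiv; have Id2 t t' : mu.-integrable setT
  (EFin \o (fun y => cosdiv t y + cosdiv t' y)).
  exact: (integrableD measurableT (Id t) (Id t')).
rewrite -RintegralD//.
transitivity (\int[mu]_y ((cosdiv (b - a') y + cosdiv (a - b') y) -
  (cosdiv (b - b') y + cosdiv (a - a') y))).
  apply: Rintegral_ae_eq.
  - by apply: measurable_funD; apply: measurable_funM; try exact: measurable_cosint;
    exact: measurable_sinint.
  - by apply: measurable_funB; apply: measurable_funD; exact: measurable_cosdiv.
  - by apply: ae_imp ae_neq0 => y y0; rewrite cosint_sinint//; ring.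
rewrite RintegralB// !RintegralD// !Rintegral_cosdiv; ring.
Qed.

(** The length of the overlap, brought into the form in which [Rintegral_cosint_sinint] delivers it;
    the proof compares the endpoints in every possible order. *)
Lemma Rintegral_indic_itv a b a' b' : a <= b -> a' <= b' ->
  2 * \int[mu]_x (\1_(`]a, b]%classic) x * \1_(`]a', b']%classic) x) =
  `|b - a'| + `|a - b'| - `|b - b'| - `|a - a'|.
Proof.
move=> ab ab'.
rewrite (_ : (fun x => _) = \1_(`]Num.max a a', Num.min b b']%classic)); last first.
  apply/funext => x; rewrite -[LHS]/((\1_(`]a, b]%classic) \* \1_(`]a', b']%classic)) x)
    -indicI.
  congr (\1_ _ x); apply/predeqP => z; rewrite /= !in_itv/= gt_max le_min.
  by split=> [[/andP[-> ->] /andP[-> ->]]|/andP[/andP[-> ->] /andP[-> ->]]].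
rewrite /Rintegral integral_indic// setIT.
set m := Num.max a a'; set M := Num.min b b'.
transitivity (2 * fine (if (m%:E < M%:E)%E then (M%:E - m%:E)%E else 0%E)).
  by congr (2 * fine _); exact: (lebesgue_measure_itv `]m, M]).
rewrite lte_fin {}/m {}/M.
have n1 (x y : R) : `|x - y| = if y <= x then x - y else y - x.
  by case: leP => [h|h]; [rewrite ger0_norm ?subr_ge0|rewrite ltr0_norm ?subr_lt0// opprB].
rewrite !n1 /Num.min /Num.max.
by case: (ltP a a') => ?; case: (ltP b b') => ?; case: (leP a' b) => ?; case: (leP b' a) => ?;
   try (case: ifPn => h; rewrite -?leNgt in h); rewrite /=; lra.
Qed.

(** For b < a both intervals are empty. This removes the assumption a <= b, so that boxes can be
    indexed by arbitrary endpoints. *)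
Lemma cosint_max a b y : cosint a b y = cosint a (Num.max a b) y.
Proof.
rewrite /cosint; congr Rintegral; have [//|ba] := leP a b.
by rewrite set_itv_ge -?leNgt ?bnd_simp ?ltW// set_itv_ge// bnd_simp ltxx.
Qed.

Lemma sinint_max a b y : sinint a b y = sinint a (Num.max a b) y.
Proof.
rewrite /sinint; congr Rintegral; have [//|ba] := leP a b.
by rewrite set_itv_ge -?leNgt ?bnd_simp ?ltW// set_itv_ge// bnd_simp ltxx.
Qed.

End OneDim.

(** * Integrals of products *)

Section ProductIntegral.
Context d1 d2 (T1 : measurableType d1) (T2 : measurableType d2) (R : realType).
Variables (m1 : {sigma_finite_measure set T1 -> \bar R}).
Variables (m2 : {sigma_finite_measure set T2 -> \bar R}).

Lemma integrable_tensor (f : T1 -> R) (g : T2 -> R) :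
  m1.-integrable setT (EFin \o f) -> m2.-integrable setT (EFin \o g) ->
  (m1 \x m2)%E.-integrable setT (EFin \o (fun p => f p.1 * g p.2)).
Proof.
move=> fi gi.
have mf : measurable_fun setT f by apply/measurable_EFinP; exact: measurable_int fi.
have mg : measurable_fun setT g by apply/measurable_EFinP; exact: measurable_int gi.
have mfg : measurable_fun setT (EFin \o (fun p : T1 * T2 => f p.1 * g p.2)).
  apply/measurable_EFinP; apply: measurable_funM.
    exact: (measurableT_comp mf measurable_fst).
  exact: (measurableT_comp mg measurable_snd).
apply/(integrable12ltyP _ _ mfg).
have /integrableP[_ gy] := gi; have /integrableP[_ fy] := fi.
pose c := fine (\int[m2]_y `|(g y)%:E|)%E.
have cE : (\int[m2]_y `|(g y)%:E|)%E = c%:E.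
  by rewrite fineK// ge0_fin_numE// integral_ge0.
rewrite (eq_integral (fun x => c%:E * `|(f x)%:E|))%E; last first.
  move=> x _; rewrite -cE muleC -ge0_integralZl//.
  - by apply: eq_integral => y _ /=; rewrite normrM EFinM.
  - by apply: measurableT_comp => //; exact/measurable_EFinP.
rewrite ge0_integralZl//.
- by rewrite lte_mul_pinfty// lee_fin fine_ge0// integral_ge0.
- by apply: measurableT_comp => //; exact/measurable_EFinP.
- by rewrite lee_fin fine_ge0// integral_ge0.
Qed.

Lemma Rintegral_tensor (f : T1 -> R) (g : T2 -> R) :
  m1.-integrable setT (EFin \o f) -> m2.-integrable setT (EFin \o g) ->
  \int[(m1 \x m2)%E]_p (f p.1 * g p.2) = (\int[m1]_x f x) * (\int[m2]_y g y).
Proof.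
move=> fi gi; rewrite {1}/Rintegral -(integral12_prod_meas1 (integrable_tensor fi gi)).
rewrite /fubini_F /= -RintegralZr//; congr fine; apply: eq_integral => x _.
under eq_integral do rewrite EFinM.
rewrite integralZl//= [in RHS]EFinM; congr (_ * _)%E.
by rewrite fineK//; exact: integrable_fin_num.
Qed.

Lemma integrable_dominated_tensor (w : T1 * T2 -> R) (f : T1 -> R) (g : T2 -> R) :
  measurable_fun setT w -> (forall p, `|w p| <= 1) ->
  m1.-integrable setT (EFin \o f) -> m2.-integrable setT (EFin \o g) ->
  (m1 \x m2)%E.-integrable setT (EFin \o (fun p => w p * (f p.1 * g p.2))).
Proof.
move=> mw w1 fi gi; have fgi := integrable_tensor fi gi.
apply: (@le_integrable _ _ _ _ _ measurableT _ (EFin \o (fun p => f p.1 * g p.2))) => //.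
  apply/measurable_EFinP; apply: measurable_funM => //.
  by apply/measurable_EFinP; exact: measurable_int fgi.
by move=> p _ /=; rewrite lee_fin normrM ler_piMl.
Qed.

End ProductIntegral.

Section TupleIntegral.
Context {R : realType}.
Local Notation mu := (@lebesgue_measure R).
Local Notation Rn n := (n.-tuple (measurableTypeR R)).

Lemma tcons_tnth0 n (p : measurableTypeR R * Rn n) : tnth (tcons p) ord0 = p.1.
Proof. by case: p. Qed.

Lemma tcons_tnthS n (p : measurableTypeR R * Rn n) i : tnth (tcons p) (lift ord0 i) =
  tnth p.2 i.
Proof. by rewrite /tcons tnthS. Qed.

Lemma measurable_prod_tnth n (phi : 'I_n -> R -> R) :
  (forall i, measurable_fun setT (phi i)) ->
  measurable_fun setT (fun x : Rn n => \prod_(i < n) phi i (tnth x i)).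
Proof.
move=> mphi; apply: measurable_prod => i _.
apply: (@measurableT_comp _ _ _ _ _ _ (phi i) _ (fun x : Rn n => tnth x i)) => //.
exact: measurable_tnth.
Qed.

(** Induction along the definition of [tuple_measure]: a pushforward by [tcons] at each step, and
    Fubini for a product of two functions. Integrability and value go together because the step uses
    both for the tail. *)
Lemma integral_prod_tnth n (phi : 'I_n -> R -> R) :
  (forall i, mu.-integrable setT (EFin \o phi i)) ->
  dx.-integrable setT (EFin \o (fun x : Rn n => \prod_(i < n) phi i (tnth x i))) /\
  \int[dx]_x (\prod_(i < n) phi i (tnth x i)) = \prod_(i < n) \int[mu]_t phi i t.
Proof.
elim: n phi => [|n IHn] phi iphi.
  (* In dimension 0 the measure is a Dirac mass, whose total mass 1 matches the empty product. *)
  have E : (fun x : Rn 0 => \prod_(i < 0) phi i (tnth x i)) = cst 1.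
    by apply/funext => x; rewrite big_ord0.
  have d1 : (@dx R 0) setT = 1%E by exact: diracT.
  rewrite E big_ord0 Rintegral_cst// mul1r d1; split=> //.
  apply/integrableP; split; first by apply/measurable_EFinP; exact: measurable_cst.
  rewrite (eq_integral (cst 1%E)) => [|x _]; last by rewrite /= normr1.
  by rewrite integral_cst// d1 mule1 ltry.
have mphi i : measurable_fun setT (phi i) by apply/measurable_EFinP; exact: measurable_int
  (iphi i).
have [ipsi psiE] := IHn (fun i => phi (lift ord0 i)) (fun i => iphi _).
have mP := measurable_prod_tnth mphi.
have E (p : measurableTypeR R * Rn n) : \prod_(i < n.+1) phi i (tnth (tcons p) i) =
   phi ord0 p.1 * \prod_(i < n) phi (lift ord0 i) (tnth p.2 i).
  rewrite big_ord_recl tcons_tnth0; congr (_ * _).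
  by apply: eq_bigr => i _; rewrite tcons_tnthS.
have I1 := integrable_tensor (iphi ord0) ipsi.
have I2 : (mu \x tuple_measure mu n)%E.-integrable (@tcons _ _ n @^-1` setT)
   ((EFin \o (fun x : Rn n.+1 => \prod_(i < n.+1) phi i (tnth x i))) \o @tcons _ _ n).
  rewrite preimage_setT; apply: eq_integrable I1 => // p _ /=.
  by rewrite E.
have mP' : measurable_fun setT (EFin \o (fun x : Rn n.+1 => \prod_(i < n.+1) phi i (tnth x i))).
  exact/measurable_EFinP.
split; first exact: (integrable_pushforward (@measurable_tcons _ _ n) mP' I2).
rewrite big_ord_recl -psiE -(Rintegral_tensor (iphi ord0) ipsi).
congr fine; rewrite [LHS](integral_pushforward (@measurable_tcons _ _ n) mP' I2)//
  preimage_setT.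
by apply: eq_integral => p _ /=; rewrite E.
Qed.

End TupleIntegral.

(** * The Clifford exponential and the kernel *)

(** The diagonals of a Cauchy product with k < N fill the triangle i + j < N, which is then summed
    by rows. *)
Lemma sum_antidiagonal (V : nmodType) (F : nat -> nat -> V) N :
  \sum_(0 <= k < N) \sum_(i < k.+1) F (k - i)%N i =
  \sum_(0 <= i < N) \sum_(0 <= j < N - i) F j i.
Proof.
elim: N => [|N IHN]; first by rewrite !big_geq.
rewrite !big_nat_recr//= subSnn big_nat1 {}IHN big_ord_recr/= subnn addrA; congr (_ + _).
rewrite -(big_mkord xpredT (fun i => F (N - i)%N i)) -big_split/=.
by apply: eq_big_nat => i /andP[_ iN]; rewrite subSn 1?ltnW// big_nat_recr.
Qed.

Section CliffordAlgebra.
Context {R : realType} {m : nat}.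
Local Notation G := (clifford R m).
Implicit Types (A B C D : G) (a : R).

(** Only equal blades contribute to the scalar part, with a sign [blade_sign S S] that is the same
    in both orders. This trace property is what lets a left factor change sides in
    [scalar_prodMl]. *)
Lemma scalar_part_mulC A B : scalar_part (A * B) = scalar_part (B * A).
Proof.
rewrite /scalar_part !clifford_mulE; apply: eq_bigr => S _.
by rewrite !symdiff0 (mulrC (A S)).
Qed.

Lemma scalar_prodC A B : scalar_prod A B = scalar_prod B A.
Proof. by rewrite !scalar_prodE; apply: eq_bigr => S _; rewrite mulrC. Qed.

Lemma scalar_prodMl C A B : scalar_prod (C * A) B = scalar_prod A (reversion C * B).
Proof.
by rewrite /scalar_prod reversionM reversionK -mulrA scalar_part_mulC -mulrA.
Qed.

Lemma scalar_prodMr C A B : scalar_prod (A * C) B = scalar_prod A (B * reversion C).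
Proof. by rewrite /scalar_prod reversionM reversionK mulrA. Qed.

Lemma scalar_prodDl A B C : scalar_prod (A + B) C = scalar_prod A C + scalar_prod B C.
Proof.
by rewrite !scalar_prodE -big_split; apply: eq_bigr => S _; rewrite ffunE mulrDl.
Qed.

Lemma scalar_prodZl a A B : scalar_prod (a *: A) B = a * scalar_prod A B.
Proof.
by rewrite !scalar_prodE mulr_sumr; apply: eq_bigr => S _; rewrite ffunE -mulrA.
Qed.

Lemma scalar_prodZr a A B : scalar_prod A (a *: B) = a * scalar_prod A B.
Proof. by rewrite scalar_prodC scalar_prodZl scalar_prodC. Qed.

Lemma scalar_prod_suml I (r : seq I) (P : pred I) (F : I -> G) A :
  scalar_prod (\sum_(i <- r | P i) F i) A = \sum_(i <- r | P i) scalar_prod (F i) A.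
Proof.
elim/big_rec2: _ => [|i x y _ <-]; last by rewrite scalar_prodDl.
by rewrite -(scale0r (0 : G)) scalar_prodZl mul0r.
Qed.

Lemma scalar_prod_sumr I (r : seq I) (P : pred I) (F : I -> G) A :
  scalar_prod A (\sum_(i <- r | P i) F i) = \sum_(i <- r | P i) scalar_prod A (F i).
Proof. by rewrite scalar_prodC scalar_prod_suml; apply: eq_bigr => i _;
  rewrite scalar_prodC. Qed.

(** One Boolean covers both transforms, so that everything below is proved once. *)
Definition act (left : bool) C A := if left then C * A else A * C.

Lemma scalar_prod_act b C A B :
  scalar_prod (act b C A) B = scalar_prod A (act b (reversion C) B).
Proof. by case: b; [exact: scalar_prodMl|exact: scalar_prodMr]. Qed.

Lemma actZ b a C A : act b (a *: C) A = a *: act b C A.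
Proof. by case: b => /=; [rewrite scalerAl|rewrite scalerAr]. Qed.

Lemma actZr b a C A : act b C (a *: A) = a *: act b C A.
Proof. by case: b => /=; [rewrite scalerAr|rewrite scalerAl]. Qed.

Lemma act_suml b I (r : seq I) (P : pred I) (F : I -> G) A :
  act b (\sum_(i <- r | P i) F i) A = \sum_(i <- r | P i) act b (F i) A.
Proof. by case: b; rewrite /= ?mulr_suml ?mulr_sumr. Qed.

Lemma act_sumr b I (r : seq I) (P : pred I) (F : I -> G) A :
  act b A (\sum_(i <- r | P i) F i) = \sum_(i <- r | P i) act b A (F i).
Proof. by case: b; rewrite /= ?mulr_suml ?mulr_sumr. Qed.

Lemma act_isometry b C A B : reversion C * C = 1 -> C * reversion C = 1 ->
  scalar_prod (act b C A) (act b C B) = scalar_prod A B.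
Proof.
move=> C1 C2; rewrite scalar_prod_act; congr scalar_prod.
by case: b; rewrite /= ?mulrA ?C1 ?mul1r// -mulrA C2 mulr1.
Qed.

Lemma clifford_sqr_norm A : `|A| ^+ 2 = scalar_prod A A.
Proof. by rewrite sqr_sqrtr ?scalar_prod_ge0. Qed.

Lemma clifford_coord_le A S : `|A S : R| <= `|A|.
Proof.
rewrite -(@ler_pXn2r _ 2)// ?nnegrE// clifford_sqr_norm scalar_prodE.
rewrite (bigD1 S)//= -normrX expr2 ger0_norm ?lerDl; last by rewrite -expr2 sqr_ge0.
by apply: sumr_ge0 => T _; rewrite -expr2 sqr_ge0.
Qed.

Lemma reversion_blade S : reversion (blade S) = blade_sign S S *: blade S :> G.
Proof.
by apply/ffunP => T; rewrite !ffunE; case: eqP => [->//|]; rewrite /GRing.scale/= !mulr0.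
Qed.

Lemma reversion_blade_mul S : reversion (blade S) * blade S = 1 :> G.
Proof.
by rewrite reversion_blade -scalerAl blade_mul scalerA blade_sign2 scale1r symdiffv.
Qed.

Lemma norm_blade_mul S A : `|blade S * A| = `|A|.
Proof.
congr Num.sqrt; rewrite scalar_prodMl mulrA.
by rewrite reversion_blade_mul mul1r.
Qed.

(** The coordinate norm need not be submultiplicative. The constant counts the blades in the
    expansion of [A]: each acts isometrically, with a coefficient bounded by the norm of [A]. *)
Lemma clifford_normM A B : `|A * B| <= #|{set 'I_m}|%:R * (`|A| * `|B|).
Proof.
rewrite {1}(cliffordE A) mulr_suml (le_trans (ler_norm_sum _ _ _))//.
rewrite -sum1_card natr_sum mulr_suml; apply: ler_sum => S _.
by rewrite mul1r -scalerAl normrZ norm_blade_mul ler_wpM2r// clifford_coord_le.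
Qed.

Lemma cvg_clifford_mul (u v : nat -> G) A B :
  u k @[k --> \oo] --> A -> v k @[k --> \oo] --> B -> u k * v k @[k --> \oo] --> A * B.
Proof.
move=> uA vB; apply/subr_cvg0/norm_cvg0P.
pose M : R := #|{set 'I_m}|%:R.
apply: (@squeeze_cvgr _ _ _ _ (cst 0)
  (fun k => M * (`|u k - A| * `|v k|) + M * (`|A| * `|v k - B|))).
- apply: nearW => k; rewrite normr_ge0/=.
  have -> : u k * v k - A * B = (u k - A) * v k + A * (v k - B).
    by rewrite mulrBl mulrBr addrA subrK.
  by rewrite (le_trans (ler_normD _ _))// lerD// clifford_normM.
- exact: cvg_cst.
- have uA0 : `|u k - A| @[k --> \oo] --> (0 : R) by apply/norm_cvg0P/subr_cvg0.
  have vB0 : `|v k - B| @[k --> \oo] --> (0 : R) by apply/norm_cvg0P/subr_cvg0.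
  have vn : `|v k| @[k --> \oo] --> `|B| by exact: cvg_norm.
  have -> : 0 = M * (0 * `|B|) + M * (`|A| * 0) by rewrite mul0r !mulr0 addr0.
  apply: cvgD; apply: cvgMr; first exact: cvgM.
  exact: cvgMr.
Qed.

Definition exp_term A k : G := k`!%:R^-1 *: A ^+ k.

(** Convergence is recorded along with the limit, since an equation about [limn] alone would not
    give it. *)
Definition has_exp A (E : G) := series (exp_term A) k @[k --> \oo] --> E.

Lemma has_expE A E : has_exp A E -> clifford_exp A = E.
Proof. by move=> AE; apply/cvg_lim. Qed.

Lemma invfact_binomial k (i : 'I_k.+1) :
  k`!%:R^-1 * 'C(k, i)%:R = (k - i)`!%:R^-1 * i`!%:R^-1 :> R.
Proof.
have ik : (i <= k)%N by rewrite -ltnS.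
have f0 j : j`!%:R != 0 :> R by rewrite pnatr_eq0 -lt0n fact_gt0.
have := congr1 (fun z => z%:R : R) (bin_fact ik); rewrite !natrM => <-.
by field; rewrite !f0 /= pnatr_eq0 -lt0n bin_gt0.
Qed.

Lemma exp_termD A B k : GRing.comm A B ->
  exp_term (A + B) k = \sum_(i < k.+1) exp_term A (k - i) * exp_term B i.
Proof.
move=> AB; rewrite /exp_term exprDn_comm// scaler_sumr; apply: eq_bigr => i _.
by rewrite -[X in _ *: X]scaler_nat scalerA invfact_binomial -scalerAl -scalerAr scalerA.
Qed.

Lemma exp_coeffD (x y : R) k :
  exp_coeff (x + y) k = \sum_(i < k.+1) exp_coeff x (k - i)%N * exp_coeff y i.
Proof.
rewrite /exp_coeff/= exprDn mulr_suml; apply: eq_bigr => i _.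
transitivity (x ^+ (k - i)%N * y ^+ i * (k`!%:R^-1 * 'C(k, i)%:R)); first ring.
by rewrite invfact_binomial mulrACA.
Qed.

(** Each multiplication costs the constant of [clifford_normM], which is absorbed into the argument
    of the real exponential; the norm of 1 comes from the power 0. *)
Lemma norm_exp_term A k :
  `|exp_term A k| <= `|1 : G| * exp_coeff (#|{set 'I_m}|%:R * `|A|) k.
Proof.
rewrite /exp_term /exp_coeff/= normrZ gtr0_norm ?invr_gt0 ?ltr0n ?fact_gt0//.
rewrite mulrC mulrA ler_pM2r ?invr_gt0 ?ltr0n ?fact_gt0//.
elim: k => [|k IHk]; first by rewrite !expr0 mulr1.
rewrite exprSr (le_trans (clifford_normM _ _))// exprSr mulrCA [leRHS]mulrA.
by rewrite ler_wpM2r// mulr_ge0.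
Qed.

(** The square of index pairs is cut into the triangle i + j < N, a partial sum of the Cauchy
    product, and the remainder, which has to tend to 0. *)
Lemma seriesM (K : nzRingType) (f g : nat -> K) N :
  series f N * series g N =
  \sum_(0 <= i < N) \sum_(0 <= j < N - i) f j * g i +
  \sum_(0 <= i < N) \sum_(N - i <= j < N) f j * g i.
Proof.
rewrite /series/= mulr_sumr -big_split; apply: eq_bigr => i _.
by rewrite mulr_suml -big_cat_nat// leq_subr.
Qed.

(* The products missing from the partial sum of the exponential of A + B are bounded by
   the corresponding ones for real exponentials, where expR (x + y) is known. *)
Lemma has_expD A B E F : GRing.comm A B -> has_exp A E -> has_exp B F ->
  has_exp (A + B) (E * F).
Proof.
move=> AB hA hB; rewrite /has_exp.
pose x : R := #|{set 'I_m}|%:R * `|A|; pose y : R := #|{set 'I_m}|%:R * `|B|.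
pose D N : G := \sum_(0 <= i < N) \sum_(N - i <= j < N) exp_term A j * exp_term B i.
pose d N : R := \sum_(0 <= i < N) \sum_(N - i <= j < N) exp_coeff x j * exp_coeff y i.
have DE N : series (exp_term (A + B)) N = series (exp_term A) N * series (exp_term B) N - D N.
  rewrite seriesM addrK -(sum_antidiagonal (fun j i => exp_term A j * exp_term B i)).
  by rewrite /series/=; apply: eq_bigr => k _; rewrite exp_termD.
have dE N : d N = series (exp_coeff x) N * series (exp_coeff y) N - series
  (exp_coeff (x + y)) N.
  have -> : series (exp_coeff (x + y)) N =
      \sum_(0 <= i < N) \sum_(0 <= j < N - i) exp_coeff x j * exp_coeff y i.
    rewrite -(sum_antidiagonal (fun j i => exp_coeff x j * exp_coeff y i)).
    by apply: eq_bigr => k _; exact: exp_coeffD.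
  by rewrite seriesM addrAC subrr add0r.
pose K : R := #|{set 'I_m}|%:R * (`|1 : G| * `|1 : G|).
have Dd N : `|D N| <= K * d N.
  rewrite /D /d (le_trans (ler_norm_sum _ _ _))// mulr_sumr; apply: ler_sum => i _.
  rewrite (le_trans (ler_norm_sum _ _ _))// mulr_sumr; apply: ler_sum => j _.
  have -> : K * (exp_coeff x j * exp_coeff y i) =
      #|{set 'I_m}|%:R * ((`|1 : G| * exp_coeff x j) * (`|1 : G| * exp_coeff y i)).
    by rewrite /K; move: (exp_coeff x j) (exp_coeff y i) => u v; ring.
  rewrite (le_trans (clifford_normM _ _))// ler_wpM2l//.
  by apply: ler_pM => //; exact: norm_exp_term.
have cexp z : series (exp_coeff z) k @[k --> \oo] --> expR z.
  exact: is_cvg_series_exp_coeff.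
have d0 : d k @[k --> \oo] --> (0 : R).
  rewrite (_ : 0 = expR x * expR y - expR (x + y)); last by rewrite expRD subrr.
  under eq_cvg do rewrite dE.
  by apply: cvgB; [apply: cvgM|]; exact: cexp.
have D0 : D k @[k --> \oo] --> (0 : G).
  apply/norm_cvg0P; apply: (@squeeze_cvgr _ _ _ _ (cst 0) (fun k => K * d k)).
  - by apply: nearW => k; rewrite normr_ge0 Dd.
  - exact: cvg_cst.
  - by rewrite -[X in _ --> X](mulr0 K); exact: cvgMr.
have h := cvgB (cvg_clifford_mul hA hB) D0; rewrite subr0 in h.
rewrite (_ : series _ = (fun N => series (exp_term A) N * series (exp_term B) N - D N)).
  exact: h.
by apply/funext => N; exact: DE.
Qed.

Lemma has_exp0 : has_exp 0 1.
Proof.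
apply: cvg_near_cst; near=> k.
rewrite -[k]prednK; last by near: k; exact: nbhs_infty_gt.
rewrite /series/= big_nat_recl// big1 ?addr0 => [|i _].
  by rewrite /exp_term expr0 fact0 invr1 scale1r.
by rewrite /exp_term expr0n scaler0.
Unshelve. all: by end_near. Qed.

(** Even powers of [B] are signs and odd powers are signs times [B], so the partial sums split into
    those of the cosine and sine series. *)
Lemma has_exp_imaginary B (t : R) : B * B = -1 ->
  has_exp (t *: B) (cos t *: 1 + sin t *: B).
Proof.
move=> B2; rewrite /has_exp.
have tE k : exp_term (t *: B) k = cos_coeff t k *: 1 + sin_coeff t k *: B.
  have BE : B ^+ k = (~~ odd k)%:R * (-1) ^+ k./2 *: 1 + (odd k)%:R * (-1) ^+ k.-1./2 *: B.
    rewrite -{1}(odd_double_half k) exprD -mul2n exprM expr2 B2.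
    have -> : (-1 : G) ^+ k./2 = (-1 : R) ^+ k./2 *: 1.
      by rewrite -signr_odd -[in RHS]signr_odd; case: odd;
        rewrite ?expr0 ?expr1 ?scale1r ?scaleN1r.
    case: (boolP (odd k)) => ok /=.
      have -> : k.-1./2 = k./2 by rewrite -{1}(odd_double_half k) ok/= doubleK.
      by rewrite expr1 !mul0r scale0r add0r mul1r -scalerAr mulr1.
    by rewrite expr0 !mul1r mul0r scale0r addr0.
  rewrite /exp_term exprZn BE !scalerDr !scalerA /cos_coeff /sin_coeff/=.
  by congr (_ *: _ + _ *: _); rewrite -?exprnP; ring.
have cc : series (cos_coeff t) k @[k --> \oo] --> cos t.
  by rewrite unlock; exact: is_cvg_series_cos_coeff.
have cs : series (sin_coeff t) k @[k --> \oo] --> sin t.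
  by rewrite unlock; exact: is_cvg_series_sin_coeff.
rewrite (_ : series _ = (fun k => series (cos_coeff t) k *: 1 + series (sin_coeff t) k *: B)).
  by apply: cvgD; exact: cvgZr_tmp.
apply/funext => k; rewrite /series/= !scaler_suml -big_split.
by apply: eq_bigr => i _; rewrite tE.
Qed.

End CliffordAlgebra.

(** * The bivectors B_i and the expansion of the kernel *)

Section Kernel.
Context {R : realType} {n : nat}.
Local Notation G := (clifford R (n + n)).
Local Notation Rn := (n.-tuple (measurableTypeR R)).
Local Notation B := (@bivector R n).
Implicit Types (i j : 'I_n) (s : seq 'I_n) (P Q : {set 'I_n}) (x y : Rn).

Lemma bivector_comm i j : GRing.comm (B i) (B j).
Proof.
have [->//|ij] := eqVneq i j.
have gN (k l : 'I_(n + n)) : k != l -> generator k * generator l =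
  - (generator l * generator k) :> G.
  exact: generator_anticomm.
rewrite /GRing.comm /bivector.
set a := generator _; set b := generator _; set c := generator _; set d := generator _.
have bc : b * c = - (c * b) by apply: gN; rewrite eq_sym eq_lrshift.
have bd : b * d = - (d * b) by apply: gN; rewrite eq_rshift.
have ac : a * c = - (c * a) by apply: gN; rewrite eq_lshift.
have ad : a * d = - (d * a) by apply: gN; rewrite eq_lrshift.
(* A generator passes both factors of the other bivector, and the two signs cancel. *)
have bcd : b * (c * d) = c * d * b by rewrite mulrA bc mulNr -[X in - X]mulrA bd mulrN
  opprK mulrA.
have acd : a * (c * d) = c * d * a by rewrite mulrA ac mulNr -[X in - X]mulrA ad mulrN
  opprK mulrA.
by rewrite -mulrA bcd mulrA acd mulrA.
Qed.

Lemma reversion_bivector i : reversion (B i) = - B i.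
Proof.
by rewrite reversionM !reversion_generator generator_anticomm// eq_sym eq_lrshift.
Qed.

Lemma reversionZ (a : R) (A : G) : reversion (a *: A) = a *: reversion A.
Proof.
by apply/ffunP => S; rewrite !ffunE /GRing.scale/= mulrCA.
Qed.

Lemma reversion1 : reversion (1 : G) = 1.
Proof.
by have := reversionM (reversion 1) (1 : G); rewrite mulr1 !reversionK mulr1 => <-.
Qed.

Lemma comm_prod_bivector i s : GRing.comm (B i) (\prod_(j <- s) B j).
Proof. by apply: commr_prod => j _; exact: bivector_comm. Qed.

Lemma reversion_prod_bivector s :
  reversion (\prod_(i <- s) B i) = (-1) ^+ size s *: \prod_(i <- s) B i.
Proof.
elim: s => [|i s IHs]; first by rewrite !big_nil reversion1 scale1r.
rewrite !big_cons reversionM IHs reversion_bivector -scalerAl mulrN exprS mulN1r scaleNr.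
by rewrite scalerN comm_prod_bivector.
Qed.

Lemma reversion_prod_bivector_mul s :
  reversion (\prod_(i <- s) B i) * \prod_(i <- s) B i = 1.
Proof.
elim: s => [|i s IHs]; first by rewrite !big_nil reversion1 mulr1.
rewrite !big_cons reversionM reversion_bivector -mulrA (mulrA (- _)) mulNr bivector_sqr.
by rewrite opprK mul1r.
Qed.

Definition bivector_prod P : G := \prod_(i in P) B i.

Lemma reversion_bivector_prod P :
  reversion (bivector_prod P) = (-1) ^+ #|P| *: bivector_prod P.
Proof.
rewrite /bivector_prod -big_filter reversion_prod_bivector.
by rewrite cardE /enum_mem size_filter -size_filter.
Qed.

Lemma reversion_bivector_prod_mul P : reversion (bivector_prod P) * bivector_prod P = 1.
Proof. by rewrite /bivector_prod -big_filter reversion_prod_bivector_mul. Qed.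

Lemma mul_reversion_bivector_prod P : bivector_prod P * reversion (bivector_prod P) = 1.
Proof.
by rewrite reversion_bivector_prod -scalerAr scalerAl -reversion_bivector_prod
  reversion_bivector_prod_mul.
Qed.

Lemma act_bivector_prod b P (A C : G) :
  scalar_prod (act b (bivector_prod P) A) (act b (bivector_prod P) C) = scalar_prod A C.
Proof.
by apply: act_isometry; [exact: reversion_bivector_prod_mul|exact: mul_reversion_bivector_prod].
Qed.

Definition ker_fun (sg : R) P i (t : R) : R := if i \in P then sg * sin t else cos t.

Definition ker_coef sg P x y : R :=
  \prod_(i < n) ker_fun sg P i ((tnth x i : R) * tnth y i).

(* The expansion of prod_i (cos (x_i y_i) + sg sin (x_i y_i) B_i), see ker_prodE; it is
   e^(-I(x, y)) for sg = -1 and its reversion for sg = 1. *)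
Definition ker sg x y : G := \sum_P ker_coef sg P x y *: bivector_prod P.

(** Expanding the product by distributivity, [P] is the set of coordinates in which the sine term is
    taken. *)
Lemma ker_prodE sg x y : ker sg x y =
  \prod_(i < n) (cos ((tnth x i : R) * tnth y i) *: 1 +
    (sg * sin ((tnth x i : R) * tnth y i)) *: B i).
Proof.
under [RHS]eq_bigr do rewrite addrC.
rewrite bigA_distr; apply: eq_big => // P _.
rewrite /ker_coef /bivector_prod [X in _ *: X]big_mkcond -scaler_prod.
by apply: eq_bigr => i _; rewrite /ker_fun; case: ifP.
Qed.

Lemma clifford_exp_phase x y : clifford_exp (- phase x y) = ker (-1) x y.
Proof.
apply: has_expE; rewrite ker_prodE /phase -sumrN.
under eq_bigr do rewrite -scaleNr.
set t := fun i => (tnth x i : R) * tnth y i.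
rewrite (eq_bigr (fun i => (cos (- t i) *: 1 + sin (- t i) *: B i))); last first.
  by move=> i _; rewrite cosN sinN mulN1r.
elim: (index_enum _) => [|i s IHs]; first by rewrite !big_nil; exact: has_exp0.
rewrite !big_cons; apply: has_expD IHs.
  apply: commr_sum => j _; rewrite /GRing.comm -!scalerAl -!scalerAr scalerA [RHS]scalerA.
  by rewrite bivector_comm mulrC.
by apply: has_exp_imaginary; exact: bivector_sqr.
Qed.

(** Reversing a product over [P] gives the sign (-1)^#|P|, which is distributed over the #|P| sine
    factors. *)
Lemma reversion_ker sg x y : reversion (ker sg x y) = ker (- sg) x y.
Proof.
rewrite /ker (big_morph reversion (id1 := 0) (op1 := +%R)); last 2 first.
  by move=> A C; rewrite -[A]scale1r reversion_linear !scale1r.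
  by have := reversionZ 0 0; rewrite !scale0r.
apply: eq_bigr => P _; rewrite reversionZ reversion_bivector_prod scalerA; congr (_ *: _).
rewrite /ker_coef mulrC -prodr_const big_mkcond -big_split/=; apply: eq_bigr => i _.
by rewrite /ker_fun; case: ifP; rewrite ?mul1r// mulrA mulN1r.
Qed.

Lemma scalar_prod_act_ker b sg x y (A C : G) :
  scalar_prod (act b (ker sg x y) A) C = scalar_prod A (act b (ker (- sg) x y) C).
Proof. by rewrite scalar_prod_act reversion_ker. Qed.

Lemma ker_sym sg x y : ker sg x y = ker sg y x.
Proof.
apply: eq_bigr => P _; congr (_ *: _); apply: eq_bigr => i _.
by rewrite [in RHS]mulrC.
Qed.

Lemma ker_coef_le1 sg P x y : `|sg| = 1 -> `|ker_coef sg P x y| <= 1.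
Proof.
move=> sg1; rewrite normr_prod.
suff /andP[] : 0 <= \prod_(i < n) `|ker_fun sg P i ((tnth x i : R) * tnth y i)| <= 1 by [].
elim/big_ind: _ => [|u v /andP[u0 u1] /andP[v0 v1]|i _]; first by rewrite ler01 lexx.
  by rewrite mulr_ge0//= mulr_ile1.
rewrite normr_ge0/= /ker_fun; case: ifP => _.
  by rewrite normrM sg1 mul1r ler_norml sin_geN1 sin_le1.
by rewrite ler_norml cos_geN1 cos_le1.
Qed.

End Kernel.

Lemma norm_clifford1 {R : realType} {m : nat} : `|1 : clifford R m| = 1.
Proof.
apply/eqP; rewrite -(@eqrXn2 _ 2)// clifford_sqr_norm expr1n scalar_prodE.
rewrite (bigD1 finset.set0)//= big1 => [|S S0]; first by rewrite ffunE eqxx mulr1 addr0.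
by rewrite ffunE (negbTE S0) mul0r.
Qed.

(** * Extension of isometries by density *)

Lemma cvg_uniq {R : realType} {W : normedModType R} (u : nat -> W) (x y : W) :
  u k @[k --> \oo] --> x -> u k @[k --> \oo] --> y -> x = y.
Proof. exact: cvg_unique. Qed.

Lemma isometric_continuous {R : realType} {W : normedModType R} (U : W -> W) :
  (forall (t : R) x y, U (t *: x + y) = t *: U x + U y) -> (forall x, `|U x| = `|x|) ->
  continuous U.
Proof.
move=> Ulin UN x; apply/cvgrPdist_lt => e e0.
near=> y.
have -> : U x - U y = U (x - y).
  by rewrite addrC -[- U y]scaleN1r -Ulin scaleN1r addrC.
rewrite UN; near: y; exact: cvgr_dist_lt.
Unshelve. all: by end_near. Qed.

Section Hilbert.
Context {R : realType} {V : normedModType R}.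
Variable ip : V -> V -> R.
Hypothesis ipC : forall x y, ip x y = ip y x.
Hypothesis ip_lin : forall (a : R) x y z, ip (a *: x + y) z = a * ip x z + ip y z.
Hypothesis ip_norm : forall x, `|x| ^+ 2 = ip x x.
(** Fast Cauchy sequences suffice: every sequence built below is chosen with this rate. *)
Hypothesis complete : forall u : nat -> V,
  (forall k, `|u k.+1 - u k| <= 4 ^- k) -> exists l : V, u k @[k --> \oo] --> l.

Implicit Types (x y z h F G : V) (a : R).

Lemma ipDl x y z : ip (x + y) z = ip x z + ip y z.
Proof. by rewrite -[x]scale1r ip_lin mul1r scale1r. Qed.

Lemma ip0l z : ip 0 z = 0.
Proof. by apply: (addrI (ip 0 z)); rewrite -ipDl !addr0. Qed.

Lemma ipZl a x z : ip (a *: x) z = a * ip x z.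
Proof. by rewrite -[a *: x]addr0 ip_lin ip0l addr0. Qed.

Lemma ipDr x y z : ip z (x + y) = ip z x + ip z y.
Proof. by rewrite ipC ipDl !(ipC z). Qed.

Lemma ipZr a x z : ip z (a *: x) = a * ip z x.
Proof. by rewrite ipC ipZl ipC. Qed.

Lemma ipNl x z : ip (- x) z = - ip x z.
Proof. by rewrite -scaleN1r ipZl mulN1r. Qed.

Lemma ipBl x y z : ip (x - y) z = ip x z - ip y z.
Proof. by rewrite ipDl ipNl. Qed.

Lemma ip_suml I (s : seq I) (F : I -> V) z : ip (\sum_(i <- s) F i) z =
  \sum_(i <- s) ip (F i) z.
Proof. by elim/big_rec2: _ => [|i x y _ <-]; rewrite ?ip0l ?ipDl. Qed.

Lemma ip_sumr I (s : seq I) (F : I -> V) z : ip z (\sum_(i <- s) F i) =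
  \sum_(i <- s) ip z (F i).
Proof. by rewrite ipC ip_suml; apply: eq_bigr => i _; rewrite ipC. Qed.

Lemma sqr_normD x y : `|x + y| ^+ 2 = `|x| ^+ 2 + 2 * ip x y + `|y| ^+ 2.
Proof. by rewrite !ip_norm ipDl !ipDr (ipC y x); ring. Qed.

Lemma sqr_normB x y : `|x - y| ^+ 2 = `|x| ^+ 2 - 2 * ip x y + `|y| ^+ 2.
Proof. by rewrite sqr_normD normrN ipC ipNl ipC; ring. Qed.

Lemma parallelogram x y : `|x + y| ^+ 2 + `|x - y| ^+ 2 = 2 * `|x| ^+ 2 + 2 * `|y| ^+ 2.
Proof. by rewrite sqr_normD sqr_normB; ring. Qed.

Lemma polarization x y : ip x y = (`|x + y| ^+ 2 - `|x - y| ^+ 2) / 4.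
Proof. by rewrite sqr_normD sqr_normB; field. Qed.

Lemma cvg_sqr_norm (u : nat -> V) x :
  u k @[k --> \oo] --> x -> `|u k| ^+ 2 @[k --> \oo] --> `|x| ^+ 2.
Proof.
move=> ux; have nx : `|u k| @[k --> \oo] --> `|x| by exact: cvg_norm.
by rewrite expr2; under eq_cvg do rewrite expr2; exact: cvgM.
Qed.

Lemma cvg_ip (u v : nat -> V) x y : u k @[k --> \oo] --> x -> v k @[k --> \oo] --> y ->
  ip (u k) (v k) @[k --> \oo] --> ip x y.
Proof.
move=> ux vy; rewrite polarization; under eq_cvg do rewrite polarization.
by apply: cvgMl; apply: cvgB; apply: cvg_sqr_norm; [exact: cvgD|exact: cvgB].
Qed.

Lemma cvg_le_geometric (u : nat -> V) x : (forall k, `|x - u k| <= 2 ^- k) ->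
  u k @[k --> \oo] --> x.
Proof.
move=> ux; apply/subr_cvg0/norm_cvg0P.
apply: (@squeeze_cvgr _ _ _ _ (cst 0) (fun k => 2^-1 ^+ k)).
- by apply: nearW => k; rewrite normr_ge0/= distrC exprVn.
- exact: cvg_cst.
- by apply: cvg_expr; rewrite ger0_norm ?invr_ge0// invf_lt1// ltr1n.
Qed.

Section Span.
Variables (I : Type) (beta : I -> V).
Hypothesis total : forall h, (forall i, ip h (beta i) = 0) -> h = 0.

(** Coefficients are kept apart from vectors, so that one list can be evaluated on both [beta] and
    [tau]. Linear relations among the [beta i] then cause no problem: [norm_lincombB] carries them
    over. *)
Definition lincomb (b : I -> V) (s : seq (R * I)) : V := \sum_(p <- s) p.1 *: b p.2.

Lemma lincomb_cat b s t : lincomb b (s ++ t) = lincomb b s + lincomb b t.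
Proof. by rewrite /lincomb big_cat. Qed.

Definition scale_comb (a : R) (s : seq (R * I)) := [seq (a * p.1, p.2) | p <- s].

Lemma lincomb_scale b a s : lincomb b (scale_comb a s) = a *: lincomb b s.
Proof.
by rewrite /lincomb big_map scaler_sumr; apply: eq_bigr => p _; rewrite scalerA.
Qed.

Lemma lincomb_sub b s t : lincomb b (s ++ scale_comb (-1) t) = lincomb b s - lincomb b t.
Proof. by rewrite lincomb_cat lincomb_scale scaleN1r. Qed.

Lemma quadratic_ge0_linear0 (b c : R) : 0 <=
  c -> (forall t, 0 <= 2 * t * b + t ^+ 2 * c) -> b = 0.
Proof.
(* The minimiser would be - b / c; the denominator c + 1 also covers c = 0 and still gives the value
   - b^2 (c + 2) / (c + 1)^2. *)
move=> c0 /(_ (- b / (c + 1))) h.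
have c1 : 0 < c + 1 by lra.
have : 0 <= - (b ^+ 2 * (c + 2)) / (c + 1) ^+ 2.
  suff -> : - (b ^+ 2 * (c + 2)) / (c + 1) ^+ 2 =
    2 * (- b / (c + 1)) * b + (- b / (c + 1)) ^+ 2 * c by [].
  by field; rewrite gt_eqF.
rewrite pmulr_lge0 ?invr_gt0 ?exprn_gt0// oppr_ge0 => h2.
by apply/eqP; rewrite -sqrf_eq0; apply/eqP; nra.
Qed.

(* The nearest point to [F] in the closed span of [beta] is [F] itself, because
   the difference is orthogonal to [beta]. *)
Lemma lincomb_dense F (e : R) : 0 < e -> exists s, `|F - lincomb beta s| < e.
Proof.
pose E := [set `|F - lincomb beta s| ^+ 2 | s in [set: seq (R * I)]].
have E0 : E !=set0 by exists (`|F - lincomb beta [::]| ^+ 2); exists [::].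
have Elb : lbound E 0 by move=> _ [s _ <-]; exact: sqr_ge0.
have infE : has_inf E by split => //; exists 0.
pose d := inf E.
have dE s : d <= `|F - lincomb beta s| ^+ 2.
  by apply: ge_inf; [exists 0|exists s].
(* The slack is tuned to the parallelogram law: consecutive squared distances are at most 2 (16^-k /
   4 + 16^-(k+1) / 4), which is below (4^-k)^2. *)
have /choice[s sP] : forall k, exists s, `|F - lincomb beta s| ^+ 2 < d + 16 ^- k / 4.
  move=> k; have : 0 < (16 ^- k / 4 : R) by rewrite divr_gt0// invr_gt0 exprn_gt0.
  by move=> /(inf_adherent)/(_ infE)[_ [s _ <-] ?]; exists s.
pose v k := lincomb beta (s k).
have vv k : `|v k.+1 - v k| <= 4 ^- k.
  rewrite -(@ler_pXn2r _ 2)// ?nnegrE ?invr_ge0 ?exprn_ge0//.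
  have P := parallelogram (F - v k) (F - v k.+1).
  have e1 : (F - v k) - (F - v k.+1) = v k.+1 - v k.
    by rewrite opprB addrC addrA subrK.
  (* The midpoint of two approximations is again a combination, so its squared distance to [F] is at
     least [d]. *)
  have e2 : (F - v k) + (F - v k.+1) =
      2 *: (F - lincomb beta (scale_comb 2^-1 (s k ++ s k.+1))).
    rewrite lincomb_scale lincomb_cat scalerBr scalerA divff// scale1r.
    by rewrite scaler_nat mulr2n opprD addrACA.
  rewrite e1 e2 normrZ exprMn in P.
  have h1 := sP k; have h2 := sP k.+1.
  have h3 := dE (scale_comb 2^-1 (s k ++ s k.+1)).
  have h4 : (16 ^- k.+1 : R) = 16 ^- k / 16 by rewrite exprSr invfM.
  have h5 : (4 ^- k) ^+ 2 = 16 ^- k :> R.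
    by rewrite exprVn -exprM mulnC exprM -natrX.
  have h6 : `|2| ^+ 2 = 4 :> R by rewrite ger0_norm// -natrX.
  have h7 : 0 < 16 ^- k :> R by rewrite invr_gt0 exprn_gt0.
  rewrite h5; rewrite h6 in P; rewrite h4 in h2.
  rewrite -/(v k) in h1; rewrite -/(v k.+1) in h2.
  lra.
have [p vp] := complete vv.
have dp : `|F - p| ^+ 2 <= d.
  have h : `|F - v k| ^+ 2 @[k --> \oo] --> `|F - p| ^+ 2.
    by apply: cvg_sqr_norm; apply: cvgB => //; exact: cvg_cst.
  have h' : d + 16^-1 ^+ k / 4 @[k --> \oo] --> d.
    rewrite -[X in _ --> X]addr0; apply: cvgD; first exact: cvg_cst.
    rewrite -[X in _ --> X](mul0r 4^-1); apply: cvgMl; apply: cvg_expr.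
    by rewrite ger0_norm ?invr_ge0// invf_lt1// ltr1n.
  apply: (ler_cvg_to h h'); apply: nearW => k.
  by rewrite exprVn ltW// sP.
(* Minimality survives the limit. As [t] varies, the linear term of this quadratic, the inner
   product with [beta i], must vanish. *)
have dp' i t : d <= `|(F - p) + t *: beta i| ^+ 2.
  have h : `|F - v k + t *: beta i| ^+ 2 @[k --> \oo] --> `|F - p + t *: beta i| ^+ 2.
    apply: cvg_sqr_norm; apply: cvgD; last exact: cvg_cst.
    by apply: cvgB => //; exact: cvg_cst.
  apply: (ler_cvg_to (cvg_cst d) h); apply: nearW => k.
  have -> : F - v k + t *: beta i = F - lincomb beta (s k ++ [:: (- t, i)]).
    by rewrite lincomb_cat /lincomb big_seq1/= scaleNr opprB addrCA addrC -addrA.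
  exact: dE.
have Fp : F - p = 0.
  apply: total => i; apply: (@quadratic_ge0_linear0 _ (`|beta i| ^+ 2)); first exact: sqr_ge0.
  move=> t; have := dp' i t; rewrite sqr_normD ipZr normrZ exprMn.
  have : `|t| ^+ 2 = t ^+ 2 by rewrite -normrX ger0_norm ?sqr_ge0.
  by move=> ->; lra.
move=> e0; have {}vp : v k @[k --> \oo] --> F by move/eqP: Fp; rewrite subr_eq0 => /eqP ->.
move/cvgrPdist_lt : vp => /(_ e e0)[k _ /(_ k (leqnn k)) h].
by exists (s k).
Qed.

Section Extension.
Variable tau : I -> V.
Hypothesis tauE : forall i j, ip (tau i) (tau j) = ip (beta i) (beta j).

Lemma norm_lincomb s : `|lincomb tau s| = `|lincomb beta s|.
Proof.
apply/eqP; rewrite -(@eqrXn2 _ 2)// !ip_norm /lincomb !ip_suml; apply/eqP.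
apply: eq_bigr => p _; rewrite !ip_sumr; apply: eq_bigr => q _.
by rewrite !ipZl !ipZr tauE.
Qed.

Lemma norm_lincombB s t :
  `|lincomb tau s - lincomb tau t| = `|lincomb beta s - lincomb beta t|.
Proof. by rewrite -!lincomb_sub norm_lincomb. Qed.

(** [U F] is the limit along one chosen approximation. Quantifying over all sequences that
    approximate [F], which is legitimate because [tau] preserves distances of combinations, is what
    later carries linearity, isometry and adjointness to the limit. *)
Lemma isometric_extension : exists U : V -> V,
  forall F s, lincomb beta (s k) @[k --> \oo] --> F -> lincomb tau (s k) @[k --> \oo] --> U F.
Proof.
(* The half leaves room for two consecutive errors: 4^-k / 2 + 4^-(k+1) / 2 <= 4^-k. *)
have approx F : exists s : nat -> seq (R * I), forall k, `|F - lincomb beta (s k)| <=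
  4 ^- k / 2.
  suff /choice[s sP] : forall k, exists s, `|F - lincomb beta s| <= 4 ^- k / 2 by exists s.
  move=> k; have [|s sk] := @lincomb_dense F (4 ^- k / 2); last by exists s; exact: ltW.
  by rewrite divr_gt0// invr_gt0 exprn_gt0.
have /choice[U UP] : forall F, exists L : V, exists s : nat -> seq (R * I),
    lincomb beta (s k) @[k --> \oo] --> F /\ lincomb tau (s k) @[k --> \oo] --> L.
  move=> F; have [s sP] := approx F.
  have k0 k : 0 < 4 ^- k :> R by rewrite invr_gt0 exprn_gt0.
  have [|L LP] := @complete (fun k => lincomb tau (s k)).
    move=> k; rewrite norm_lincombB.
    have -> : lincomb beta (s k.+1) - lincomb beta (s k) =
       (F - lincomb beta (s k)) - (F - lincomb beta (s k.+1)).
      by rewrite opprB [RHS]addrC addrA subrK.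
    rewrite (le_trans (ler_normB _ _))//.
    have h1 := sP k; have h2 := sP k.+1.
    have h4 : (4 ^- k.+1 : R) = 4 ^- k / 4 by rewrite exprSr invfM.
    by rewrite h4 in h2; have := k0 k; lra.
  exists L, s; split => //; apply: cvg_le_geometric => k.
  rewrite (le_trans (sP k))//; have h : 4 ^- k <= 2 ^- k :> R.
    by rewrite lef_pV2 ?posrE ?exprn_gt0// lerXn2r ?nnegrE// ler_nat.
  by have := k0 k; lra.
exists U => F s sF; have [t [tF tU]] := UP F.
have h : lincomb tau (s k) - lincomb tau (t k) @[k --> \oo] --> (0 : V).
  apply/norm_cvg0P; under eq_cvg do rewrite norm_lincombB.
  by apply/norm_cvg0P; rewrite -(subrr F); exact: cvgB.
rewrite (_ : (fun k => _) = (fun k => (lincomb tau (s k) - lincomb tau (t k)) + lincomb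
  tau (t k))).
  by rewrite -[X in _ --> X]add0r; exact: cvgD.
by apply/funext => k; rewrite subrK.
Qed.

End Extension.

Lemma lincomb_approx F : exists s : nat -> seq (R * I), lincomb beta (s k) @[k --> \oo] --> F.
Proof.
suff /choice[s sP] : forall k, exists s, `|F - lincomb beta s| <= 2 ^- k.
  by exists s; exact: cvg_le_geometric.
move=> k; have [|s sk] := @lincomb_dense F (2 ^- k); last by exists s; exact: ltW.
by rewrite invr_gt0 exprn_gt0.
Qed.

Lemma extension_ip (tau tau' : I -> V) (U : V -> V) :
  (forall F s, lincomb beta (s k) @[k --> \oo] --> F -> lincomb tau (s k) @[k --> \oo] -->
    U F) ->
  (forall i j, ip (tau i) (beta j) = ip (beta i) (tau' j)) ->
  forall F j, ip (U F) (beta j) = ip F (tau' j).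
Proof.
move=> UP adj F j; have [s sF] := lincomb_approx F; have sU := UP _ _ sF.
have h1 := cvg_ip sU (cvg_cst (beta j)); have h2 := cvg_ip sF (cvg_cst (tau' j)).
rewrite -(cvg_lim (@Rhausdorff R) (h1 _)) -(cvg_lim (@Rhausdorff R) (h2 _)).
congr (lim (_ @ \oo)); apply/funext => k /=.
by rewrite /lincomb !ip_suml; apply: eq_bigr => p _; rewrite !ipZl adj.
Qed.

Lemma extension_norm (tau : I -> V) (U : V -> V) :
  (forall i j, ip (tau i) (tau j) = ip (beta i) (beta j)) ->
  (forall F s, lincomb beta (s k) @[k --> \oo] --> F -> lincomb tau (s k) @[k --> \oo] -->
    U F) ->
  (forall a F G, U (a *: F + G) = a *: U F + U G) /\
  (forall F G, ip (U F) (U G) = ip F G) /\ (forall i, U (beta i) = tau i).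
Proof.
move=> tauE UP; have UN F : `|U F| = `|F|.
  have [s sF] := lincomb_approx F; have sU := UP _ _ sF.
  have h1 := cvg_norm sU; have h2 := cvg_norm sF.
  rewrite -(cvg_lim (@Rhausdorff R) (h1 _)) -(cvg_lim (@Rhausdorff R) (h2 _)).
  congr (lim (_ @ \oo)); apply/funext => k /=.
  by rewrite (norm_lincomb tauE).
have Ulin a F G : U (a *: F + G) = a *: U F + U G.
  have [s sF] := lincomb_approx F; have [t tG] := lincomb_approx G.
  have st b X Y : lincomb b (s k) @[k --> \oo] --> X -> lincomb b (t k) @[k --> \oo] --> Y ->
      lincomb b (scale_comb a (s k) ++ t k) @[k --> \oo] --> a *: X + Y.
    move=> sX tY; under eq_cvg do rewrite lincomb_cat lincomb_scale.
    by apply: cvgD => //; exact: cvgZl_tmp.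
  have h := UP _ _ (st _ _ _ sF tG).
  exact: (cvg_uniq h (st _ _ _ (UP _ _ sF) (UP _ _ tG))).
split=> //; split.
  have UD F G : U (F + G) = U F + U G by rewrite -{1}[F]scale1r Ulin scale1r.
  have UB F G : U (F - G) = U F - U G.
    by rewrite addrC -[- G]scaleN1r Ulin scaleN1r addrC.
  by move=> F G; rewrite !polarization -UD -UB !UN.
move=> i; have e b : lincomb b [:: (1, i)] = b i by rewrite /lincomb big_seq1 scale1r.
have h := UP (beta i) (fun=> [:: (1, i)]); rewrite !e in h.
exact: (cvg_uniq (h (cvg_cst _)) (cvg_cst _)).
Qed.

(** The extension U' of [tau'] inverts [U]: <U' (U G), beta j> = <U G, tau j> = <U G, U (beta j)> =
    <G, beta j>, and [beta] is total. The other composition is symmetric. *)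
Lemma isometric_isomorphism (tau tau' : I -> V) :
  (forall i j, ip (tau i) (tau j) = ip (beta i) (beta j)) ->
  (forall i j, ip (tau' i) (tau' j) = ip (beta i) (beta j)) ->
  (forall i j, ip (tau i) (beta j) = ip (beta i) (tau' j)) ->
  exists U : V -> V, [/\ forall a F G, U (a *: F + G) = a *: U F + U G, bijective U,
    forall F G, ip (U F) (U G) = ip F G & forall F j, ip (U F) (beta j) = ip F (tau' j)].
Proof.
move=> h h' adj.
have adj' i j : ip (tau' i) (beta j) = ip (beta i) (tau j) by rewrite ipC -adj ipC.
have [U UP] := isometric_extension h; have [U' UP'] := isometric_extension h'.
have [Ul [Ui Ub]] := extension_norm h UP; have [Ul' [Ui' Ub']] := extension_norm h' UP'.
have Ua := extension_ip UP adj; have Ua' := extension_ip UP' adj'.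
exists U; split => //; exists U' => G; apply/eqP; rewrite -subr_eq0; apply/eqP.
  by apply: total => j; rewrite ipBl Ua' -Ub Ui subrr.
by apply: total => j; rewrite ipBl Ua -Ub' Ui' subrr.
Qed.

End Span.
End Hilbert.

(** * The Hilbert space L2 *)

(** The increments from k on sum to at most 2 D 2^-k. Shifting [a] down and up by this amount gives
    two monotone sequences that enclose the limit, hence the explicit rate. *)
Lemma geometric_cauchy (R : realType) (a : nat -> R) (D : R) :
  (forall k, `|a k.+1 - a k| <= D * 2 ^- k) ->
  exists l, a k @[k --> \oo] --> l /\ forall k, `|l - a k| <= 2 * D * 2 ^- k.
Proof.
move=> aD; have h2 k : 2 ^- k.+1 = 2 ^- k / 2 :> R by rewrite exprSr invfM.
have D0 : 0 <= D.
  by have := aD 0%N; rewrite expr0 invr1 mulr1; apply: le_trans.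
have p0 k : 0 <= 2 ^- k :> R by rewrite invr_ge0 exprn_ge0.
pose b k : R := a k - 2 * D * 2 ^- k; pose c k : R := a k + 2 * D * 2 ^- k.
have aD' k : - (D * 2 ^- k) <= a k.+1 - a k <= D * 2 ^- k by rewrite -ler_norml.
have nb : {homo b : m n / (m <= n)%N >-> m <= n}.
  apply/nondecreasing_seqP => k; rewrite /b h2.
  by have /andP[] := aD' k; lra.
have nc : {homo c : m n / (m <= n)%N >-> n <= m}.
  apply/nonincreasing_seqP => k; rewrite /c h2.
  by have /andP[] := aD' k; lra.
have bc k : b k <= c k by rewrite /b /c; have := mulr_ge0 D0 (p0 k); lra.
have bj k j : b j <= c k.
  have [kj|/ltnW jk] := leqP k j; first by rewrite (le_trans (bc j))// nc.
  by rewrite (le_trans (nb _ _ jk)).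
have cb : cvgn b.
  by apply: nondecreasing_is_cvgn => //; exists (c 0%N) => _ [k _ <-].
exists (limn b); split.
  rewrite (_ : a = fun k => b k + 2 * D * 2^-1 ^+ k); last first.
    by apply/funext => k; rewrite /b exprVn subrK.
  rewrite -[X in _ --> X]addr0; apply: cvgD => //.
  rewrite -[X in _ --> X](mulr0 (2 * D)); apply: cvgMr; apply: cvg_expr.
  by rewrite ger0_norm ?invr_ge0// invf_lt1// ltr1n.
move=> k; have h1 := nondecreasing_cvgn_le nb cb k.
have h3 : limn b <= c k by apply: limr_le => //; apply: nearW => j.
by rewrite ler_norml; move: h1 h3; rewrite /b /c; lra.
Qed.

Section L2Basics.
Context {R : realType} {n : nat}.
Local Notation Rn := (n.-tuple (measurableTypeR R)).
Local Notation G := (clifford R (n + n)).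
Local Notation dx := (@dx R n).
Local Notation dm := (@dm R n).

Definition kappa : R := (2 * pi) `^ (- (n%:R / 2)).

Lemma kappa_gt0 : 0 < kappa.
Proof. by rewrite powR_gt0// mulr_gt0// pi_gt0. Qed.

Lemma dmE (A : set Rn) : dm A = (kappa%:E * dx A)%E.
Proof. by []. Qed.

Lemma ae_dm (P : Rn -> Prop) : {ae dm, forall x, P x} <-> {ae dx, forall x, P x}.
Proof.
split=> -[A [mA A0 sA]]; exists A; split=> //.
  move: A0; rewrite dmE => /eqP; rewrite mule_eq0 eqe gt_eqF ?kappa_gt0//=.
  by move/eqP.
by rewrite dmE A0 mule0.
Qed.

Lemma ge0_integral_dm (f : Rn -> \bar R) : measurable_fun setT f -> (forall x, (0 <= f x)%E) ->
  (\int[dm]_x f x = kappa%:E * \int[dx]_x f x)%E.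
Proof. by move=> mf f0; rewrite ge0_integral_mscale. Qed.

Lemma Rintegral_dm (f : Rn -> R) : dx.-integrable setT (EFin \o f) ->
  \int[dm]_x f x = kappa * \int[dx]_x f x.
Proof.
move=> fi; have mf := measurable_int _ fi.
rewrite /Rintegral integralE [in RHS]integralE !ge0_integral_dm//; last 2 first.
- exact: measurable_funeneg.
- exact: measurable_funepos.
have := integrable_pos_fin_num measurableT fi; have := integrable_neg_fin_num measurableT fi.
case: (\int[dx]_x ((EFin \o f)^\- x))%E => // b _.
by case: (\int[dx]_x ((EFin \o f)^\+ x))%E => // a _ /=; rewrite mulrBr.
Qed.

Lemma cintegralE (f : Rn -> G) S : dx.-integrable setT (EFin \o (fun x => f x S)) ->
  cintegral f S = kappa * \int[dx]_x (f x S : R).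
Proof. by move=> fi; rewrite ffunE Rintegral_dm. Qed.

Lemma measurable_norm_sqr (f : Rn -> G) : cmeasurable f ->
  measurable_fun setT (fun x => `|f x| ^+ 2 : R).
Proof. by move=> mf; apply: measurable_funX; exact: cmeasurable_norm. Qed.

Lemma ge0_dm_lty (f : Rn -> R) : measurable_fun setT f -> (forall x, 0 <= f x) ->
  (\int[dm]_x (f x)%:E < +oo)%E <-> dx.-integrable setT (EFin \o f).
Proof.
move=> mf f0; rewrite ge0_integral_dm//; last exact/measurable_EFinP.
split=> [h|/integrableP[_ h]].
  apply/integrableP; split; first exact/measurable_EFinP.
  under eq_integral do rewrite /= ger0_norm//.
  have : (0 <= \int[dx]_x (f x)%:E)%E by apply: integral_ge0 => x _; rewrite lee_fin.
  case: (\int[dx]_x (f x)%:E)%E h => [r _ _|h _|//]; first by rewrite ltry.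
  by rewrite gt0_muley ?lte_fin ?kappa_gt0 in h.
rewrite lte_mul_pinfty ?lee_fin ?ltW ?kappa_gt0//.
by move: h; under eq_integral do rewrite /= ger0_norm//.
Qed.

(** Passes to real coordinates and to [dx]: a coordinate is bounded by the norm, and the squared
    norm is the sum of the squared coordinates. *)
Lemma in_L2P (f : Rn -> G) : in_Lp 2%:E f <->
  cmeasurable f /\ forall S, dx.-integrable setT (EFin \o (fun x => (f x S : R) ^+ 2)).
Proof.
have key : cmeasurable f -> (Lp_norm 2%:E f < +oo)%E <->
    dx.-integrable setT (EFin \o (fun x => `|f x| ^+ 2 : R)).
  move=> mf; rewrite -ge0_dm_lty; [|exact: measurable_norm_sqr|by move=> x; exact: sqr_ge0].
  have e : (Lp_norm 2%:E f `^ 2 = \int[dm]_x (`|f x| ^+ 2 : R)%:E)%E.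
    rewrite /Lp_norm poweR_Lnorm//; apply: eq_integral => x _ /=.
    by rewrite normr_id powR_mulrn.
  rewrite -e; split=> [|h]; first exact: poweR_lty.
  by apply: lty_poweRy h.
split=> -[mf h]; split=> //.
  move=> S; apply: integrable_le ((key mf).1 h).
    by apply: measurable_funX; exact: mf.
  by move=> x; rewrite normrX lerXn2r ?nnegrE// clifford_coord_le.
apply/(key mf).
have := @integrable_sumR R _ _ dx _ (index_enum _) (fun S x => (f x S : R) ^+ 2) h.
apply: eq_integrable => // x _ /=; rewrite clifford_sqr_norm scalar_prodE.
by congr EFin; apply: eq_bigr => S _; rewrite expr2.
Qed.

Lemma in_L1P (f : Rn -> G) : in_Lp 1%:E f <->
  cmeasurable f /\ forall S, dx.-integrable setT (EFin \o (fun x => f x S : R)).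
Proof.
have key : cmeasurable f -> (Lp_norm 1%:E f < +oo)%E <->
    dx.-integrable setT (EFin \o (fun x => `|f x| : R)).
  move=> mf; rewrite -ge0_dm_lty; [|exact: cmeasurable_norm|by move=> x; exact: normr_ge0].
  have -> : Lp_norm 1%:E f = (\int[dm]_x (`|f x| : R)%:E)%E.
    by rewrite /Lp_norm Lnorm1; apply: eq_integral => x _ /=; rewrite normr_id.
  by [].
split=> -[mf h]; split=> //.
  move=> S; apply: integrable_le ((key mf).1 h); first exact: mf.
  by move=> x; exact: clifford_coord_le.
apply/(key mf).
apply: (@integrable_le _ _ _ dx _ (fun x => \sum_S `|f x S : R|)).
- exact: cmeasurable_norm.
- move=> x; rewrite normr_id {1}(cliffordE (f x)) (le_trans (ler_norm_sum _ _ _))//.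
  by apply: ler_sum => S _; rewrite normrZ -[blade S]mulr1 norm_blade_mul norm_clifford1 mulr1.
- by apply: integrable_sumR => S; exact: integrable_norm.
Qed.

Lemma integrable_coordM (f g : Rn -> G) S T : in_Lp 2%:E f -> in_Lp 2%:E g ->
  dx.-integrable setT (EFin \o (fun x => (f x S : R) * g x T)).
Proof.
move=> /in_L2P[mf fi] /in_L2P[mg gi].
by apply: (integrable_mul_sqr _ _ (fi S) (gi T)).
Qed.

Lemma integrable_scalar_prod (f g : Rn -> G) : in_Lp 2%:E f -> in_Lp 2%:E g ->
  dx.-integrable setT (EFin \o (fun x => scalar_prod (f x) (g x))).
Proof.
move=> fi gi; rewrite (_ : (fun x => _) = (fun x => \sum_S (f x S : R) * g x S)).
  by apply: integrable_sumR => S; exact: integrable_coordM.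
by apply/funext => x; rewrite scalar_prodE.
Qed.

Lemma L2fun_in (f : @L2fun R n) : in_Lp 2%:E f.
Proof. exact/L2_predP/valP. Qed.

Definition mkL2 (f : Rn -> G) (hf : in_Lp 2%:E f) : L2 R n :=
  L2_class (MkL2fun (introT (L2_predP f) hf)).

Lemma mkL2_ae f (hf : in_Lp 2%:E f) : (mkL2 hf : Rn -> G) = f %[ae dx].
Proof.
by apply/ae_dm; have := L2_reprE (MkL2fun (introT (L2_predP f) hf)).
Qed.

Lemma L2_in (F : L2 R n) : in_Lp 2%:E F.
Proof. exact: L2fun_in. Qed.

Lemma L2_ext (F H : L2 R n) : (F : Rn -> G) = H %[ae dx] -> F = H.
Proof.
elim/(@L2W R n): F => f; elim/(@L2W R n): H => h fh; apply/L2_eqP.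
have hf := L2_reprE f; have hh := L2_reprE h; have {}fh := (ae_dm _).2 fh.
apply: filterS3 hf hh fh => x e1 e2 e3 xT.
by rewrite -(e1 xT) -(e2 xT); exact: e3.
Qed.

Lemma L2_lin_ae a (F H : L2 R n) : ((a *: F + H : L2 R n) : Rn -> G) =
  (fun x => a *: F x + H x) %[ae dx].
Proof.
apply/ae_dm; elim/(@L2W R n): F => f; elim/(@L2W R n): H => h.
have -> : a *: L2_class f + L2_class h = L2_class (a *: f + h).
  by rewrite [a *: _](pi_L2_scale a f) [LHS](pi_L2_add (a *: f) h).
have h1 := L2_reprE f; have h2 := L2_reprE h; have h3 := L2_reprE (a *: f + h).
apply: filterS3 h1 h2 h3 => x e1 e2 e3 xT.
by apply: (etrans (e3 xT)); congr (a *: _ + _); apply/esym; [exact: e1|exact: e2].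
Qed.

Lemma measurable_scalar_prod (f g : Rn -> G) : cmeasurable f -> cmeasurable g ->
  measurable_fun setT (fun x => scalar_prod (f x) (g x)).
Proof.
move=> mf mg; rewrite (_ : (fun x => _) = (fun x => \sum_S (f x S : R) * g x S)).
  by apply: measurable_sum => S; apply: measurable_funM; [exact: mf|exact: mg].
by apply/funext => x; rewrite scalar_prodE.
Qed.

Lemma L2_inner_ae (F H : L2 R n) (f h : Rn -> G) : cmeasurable f -> cmeasurable h ->
  (F : Rn -> G) = f %[ae dx] -> (H : Rn -> G) = h %[ae dx] ->
  L2_inner F H = \int[dx]_x scalar_prod (f x) (h x).
Proof.
move=> mf mh Ff Hh; apply: Rintegral_ae_eq.
- by apply: measurable_scalar_prod; [have [] := L2_in F|have [] := L2_in H].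
- exact: measurable_scalar_prod.
- by apply: filterS2 Ff Hh => x e1 e2; rewrite e1// e2.
Qed.

Lemma L2_innerC (F H : L2 R n) : L2_inner F H = L2_inner H F.
Proof. by apply: eq_Rintegral => x _; rewrite scalar_prodC. Qed.

Lemma L2_inner_lin a (F H K : L2 R n) :
  L2_inner (a *: F + H) K = a * L2_inner F K + L2_inner H K.
Proof.
have [mF _] := L2_in F; have [mH _] := L2_in H; have [mK _] := L2_in K.
rewrite (L2_inner_ae _ mK (L2_lin_ae a F H) (ae_eq_refl _ _ _)); last first.
  by have := cmeasurable_lincomb a mF mH.
have i1 := integrable_scalar_prod (L2_in F) (L2_in K).
have i2 := integrable_scalar_prod (L2_in H) (L2_in K).
rewrite /L2_inner -RintegralZl// -RintegralD//; last exact: integrableZR.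
by apply: eq_Rintegral => x _; rewrite scalar_prodDl scalar_prodZl.
Qed.

Lemma L2_norm_kappa (F : L2 R n) : `|F| ^+ 2 = kappa * L2_inner F F.
Proof. exact: L2_norm_inner. Qed.

Lemma mkL2_coe f (hf : in_Lp 2%:E f) (F : L2 R n) : (F : Rn -> G) = f %[ae dx] -> mkL2 hf = F.
Proof.
move=> Ff; apply: L2_ext; have h := mkL2_ae hf.
by apply: filterS2 h Ff => x e1 e2 xT; rewrite e1// e2.
Qed.

Lemma integral_sqr_L2 (F : L2 R n) :
  (\int[dx]_x (`|F x| ^+ 2 : R)%:E = (kappa^-1 * `|F| ^+ 2)%:E)%E.
Proof.
rewrite L2_norm_kappa mulKf ?gt_eqF ?kappa_gt0// /L2_inner /Rintegral fineK.
  by apply: eq_integral => x _; rewrite clifford_sqr_norm.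
by apply: integrable_fin_num => //; exact: (integrable_scalar_prod (L2_in F) (L2_in F)).
Qed.

Lemma L2_diff_ae (F H : L2 R n) : ((F - H : L2 R n) : Rn -> G) = (fun x => F x - H x) %[ae dx].
Proof.
have := L2_lin_ae (-1) H F; apply: filterS => x e xT.
by rewrite addrC -[- H]scaleN1r e// scaleN1r addrC.
Qed.

Lemma sum_geometric4 N : \sum_(k < N) 4 ^- k <= 2 :> R.
Proof.
suff : \sum_(k < N) 4 ^- k <= 2 - 2 * 4 ^- N :> R.
  by move/le_trans; apply; rewrite gerBl mulr_ge0// invr_ge0 exprn_ge0.
elim: N => [|N IHN]; first by rewrite big_ord0 expr0 invr1; lra.
rewrite big_ord_recr/= (le_trans (lerD IHN (lexx _)))//.
have h4 : 4 ^- N.+1 = 4 ^- N / 4 :> R by rewrite exprSr invfM.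
have : 0 <= 4 ^- N :> R by rewrite invr_ge0 exprn_ge0.
by rewrite h4; lra.
Qed.

(* The series of 4^k |F_(k+1) - F_k|^2 has a finite integral, hence is finite almost
   everywhere, and there it makes F_k(x) a geometrically fast Cauchy sequence. *)
Lemma L2_complete (F : nat -> L2 R n) : (forall k, `|F k.+1 - F k| <= 4 ^- k) ->
  exists L : L2 R n, F k @[k --> \oo] --> L.
Proof.
move=> Fk.
pose d k : Rn -> G := (F k.+1 - F k : L2 R n).
(* The integral of the squared norm of [d k] is of order 16^-k, so the weight 4^k leaves a summable
   4^-k; pointwise the same weight gives the decay 2^-k. *)
pose t k x : R := 4 ^+ k * `|d k x| ^+ 2.
have t0 k x : 0 <= t k x by rewrite mulr_ge0 ?exprn_ge0 ?sqr_ge0.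
have mt k : measurable_fun setT (t k).
  apply: measurable_funM => //; apply: measurable_norm_sqr.
  by have [] := L2_in (F k.+1 - F k).
pose g x : \bar R := (\sum_(0 <= k <oo) (t k x)%:E)%E.
have g0 x : (0 <= g x)%E by apply: nneseries_ge0 => k _ _; rewrite lee_fin.
have k1 := kappa_gt0.
have gint : (\int[dx]_x g x < +oo)%E.
  rewrite /g integral_nneseries//; last 2 first.
  - by move=> k; exact/measurable_EFinP.
  - by move=> k x _; rewrite lee_fin.
  apply: (@le_lt_trans _ _ (kappa^-1 * 2)%:E); last exact: ltry.
  apply: lime_le.
    by apply: is_cvg_nneseries => k _ _; apply: integral_ge0 => x _; rewrite lee_fin.
  apply: nearW => N; rewrite big_mkord.
  apply: (@le_trans _ _ (\sum_(k < N) (kappa^-1 * 4 ^- k)%:E)%E).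
    apply: lee_sum => k _; under eq_integral do rewrite EFinM.
    have md : measurable_fun setT (fun x => (`|d k x| ^+ 2)%:E).
      by apply/measurable_EFinP; apply: measurable_norm_sqr; have [] := L2_in (F k.+1 - F k).
    rewrite ge0_integralZl; [|by []|exact: md|
      by move=> x _; rewrite lee_fin sqr_ge0|by rewrite lee_fin exprn_ge0].
    rewrite integral_sqr_L2 -EFinM lee_fin mulrCA ler_pM2l ?invr_gt0//.
    have h : `|F k.+1 - F k| ^+ 2 <= (4 ^- k) ^+ 2.
      by rewrite lerXn2r ?nnegrE// invr_ge0 exprn_ge0.
    rewrite (le_trans (ler_wpM2l _ h)) ?exprn_ge0//.
    by rewrite expr2 mulrA mulfV ?mul1r// expf_neq0.
  by rewrite sumEFin -mulr_sumr lee_fin ler_pM2l ?invr_gt0// sum_geometric4.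
have mg : measurable_fun setT g.
  apply: ge0_emeasurable_sum => [k x _ _|k _]; first by rewrite lee_fin.
  exact/measurable_EFinP.
have gfin : {ae dx, forall x, (g x < +oo)%E}.
  have : dx.-integrable setT g.
    by apply/integrableP; split => //; under eq_integral do rewrite gee0_abs//.
  move=> /(integrable_ae measurableT); apply: filterS => x /(_ I).
  by rewrite ge0_fin_numE.
pose E := [set x | (g x < +oo)%E].
have mE : measurable E.
  have := emeasurable_fun_infty_o measurableT mg +oo%E; by rewrite setTI.
pose D x : R := Num.sqrt (fine (g x)).
have td k x : E x -> `|d k x| <= D x * 2 ^- k.
  move=> Ex; rewrite -(@ler_pXn2r _ 2)// ?nnegrE ?mulr_ge0 ?sqrtr_ge0 ?invr_ge0 ?exprn_ge0//.
  rewrite exprMn [D x ^+ 2]sqr_sqrtr ?fine_ge0// exprVn -exprM mulnC exprM -natrX.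
  rewrite ler_pdivlMr ?exprn_gt0// mulrC -lee_fin fineK ?ge0_fin_numE//.
  apply: le_trans (nneseries_lim_ge k.+1 _); last by move=> j _ _; rewrite lee_fin.
  rewrite big_nat_recr//= leeDr//.
  by apply: sume_ge0 => j _; rewrite lee_fin.
have dae : {ae dx, forall x, forall k, d k x = F k.+1 x - F k x}.
  apply: ae_foralln => k; have := L2_diff_ae (F k.+1) (F k).
  by apply: filterS => x; apply.
(* [F k x - F 0 x] equals this sum only almost everywhere, whereas the estimates for [a] hold at
   every point of [E]. *)
pose a k x := \sum_(j < k) d j x.
have Fa : {ae dx, forall x, forall k, F k x = F 0%N x + a k x}.
  apply: filterS dae => x dx k; elim: k => [|k IHk]; first by rewrite /a big_ord0 addr0.
  by rewrite /a big_ord_recr/= addrA -/(a k x) -IHk dx addrC subrK.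
have aS k x S : E x -> `|(a k.+1 x S : R) - a k x S| <= D x * 2 ^- k.
  move=> Ex; rewrite (le_trans _ (td k x Ex))// /a big_ord_recr/= ffunE addrC addKr.
  exact: clifford_coord_le.
have lims x S : exists l : R, E x ->
    a k x S @[k --> \oo] --> l /\ forall k, `|l - a k x S| <= 2 * D x * 2 ^- k.
  have [Ex|nE] := pselect (E x); last by exists 0.
  by have [l lP] := geometric_cauchy (fun k => aS k x S Ex); exists l.
have /choice[l lP] : forall xS : Rn * {set 'I_(n + n)}, exists l : R, E xS.1 ->
    a k xS.1 xS.2 @[k --> \oo] --> l /\ forall k, `|l - a k xS.1 xS.2| <= 2 * D xS.1 * 2 ^- k.
  by case=> x S; exact: lims.
(* With the default 0 outside [E], each coordinate of the second summand is the limit at every point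
   of [a k] times the indicator of [E], hence measurable. *)
pose f x : G := F 0%N x + [ffun S => if x \in E then l (x, S) else 0].
have mak k S : measurable_fun setT (fun x => a k x S : R).
  rewrite (_ : (fun x => _) = (fun x => \sum_(j < k) (d j x S : R))).
    by apply: measurable_sum => j; have [m _] := L2_in (F j.+1 - F j); exact: m.
  by apply/funext => x; rewrite sum_ffunE.
have mf : cmeasurable f.
  move=> S; rewrite (_ : (fun x => _) =
    (fun x => (F 0%N x S : R) + (if x \in E then l (x, S) else 0))).
    apply: measurable_funD; first by have [m _] := L2_in (F 0%N); exact: m.
    apply: (@measurable_realfun.measurable_fun_cvg _ _ R setT (fun k x => a k x S * \1_E x)).
      by move=> k; apply: measurable_funM => //; exact: measurable_indic.
    move=> x _; rewrite indicE; case: ifPn => xE.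
      under eq_fun do rewrite mulr1.
      by have [] := lP (x, S) (set_mem xE).
    by under eq_fun do rewrite mulr0; exact: cvg_cst.
  by apply/funext => x; rewrite !ffunE.
pose N : R := #|{set 'I_(n + n)}|%:R.
(* Each of the [N] coordinates has error at most 2 D 2^-k, and the square of [D x] is
   [fine (g x)]. *)
have fF k : {ae dx, forall x, `|f x - F k x| ^+ 2 <= N * 4 * 4 ^- k * fine (g x)}.
  apply: filterS2 Fa gfin => x Fax gx.
  have Ex : x \in E by rewrite inE.
  rewrite Fax /f opprD addrACA subrr add0r clifford_sqr_norm scalar_prodE.
  rewrite -!mulrA /N -sum1_card natr_sum mulr_suml; apply: ler_sum => S _.
  rewrite !ffunE Ex mul1r -expr2.
  have [_ /(_ k) h] := lP (x, S) gx.
  have : `|l (x, S) - a k x S| ^+ 2 <= (2 * D x * 2 ^- k) ^+ 2.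
    by rewrite lerXn2r ?nnegrE// !mulr_ge0 ?sqrtr_ge0// invr_ge0 exprn_ge0.
  rewrite -normrX ger0_norm ?sqr_ge0// => /le_trans; apply.
  rewrite !exprMn sqr_sqrtr ?fine_ge0// exprVn -exprM mulnC exprM -!natrX.
  by rewrite -mulrA (mulrC (fine _)).
have igR : dx.-integrable setT (EFin \o (fine \o g)).
  apply/integrableP; split.
    by apply/measurable_EFinP; apply: measurableT_comp => //; exact: fine_measurable.
  apply: le_lt_trans gint; apply: ge0_le_integral => //.
  - apply/measurable_EFinP; apply: measurableT_comp => //.
    by apply: measurableT_comp => //; exact: fine_measurable.
  - move=> x _ /=; rewrite ger0_norm ?fine_ge0//.
    by case: (g x) (g0 x) => // r; rewrite ?leey.
pose c k : R := N * 4 * 4 ^- k.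
have c0 k : 0 <= c k by rewrite /c !mulr_ge0// invr_ge0 exprn_ge0.
have igc k : dx.-integrable setT (EFin \o (fun x => c k * (fine \o g) x)) by exact:
  integrableZR.
have mfF k : cmeasurable (fun x => f x - F k x).
  move=> S; rewrite (_ : (fun x => _) = (fun x => (f x S : R) - F k x S)).
    by apply: measurable_funB; [exact: mf|have [m _] := L2_in (F k); exact: m].
  by apply/funext => x; rewrite !ffunE.
have fF2 k : in_Lp 2%:E (fun x => f x - F k x).
  apply/in_L2P; split => // S; apply/integrableP; split.
    by apply/measurable_EFinP; apply: measurable_funX; exact: mfF.
  have /integrableP[_] := igc k; apply: le_lt_trans.
  apply: ae_ge0_le_integral => //.
  - by apply: measurableT_comp => //; apply/measurable_EFinP; apply: measurable_funX;
    exact: mfF.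
  - by apply: measurableT_comp => //; exact: measurable_int (igc k).
  - apply: filterS (fF k) => x h _ /=; rewrite lee_fin.
    rewrite [leRHS]ger0_norm ?mulr_ge0 ?fine_ge0//; apply: le_trans h.
    by rewrite normrX lerXn2r ?nnegrE// clifford_coord_le.
pose W k : L2 R n := mkL2 (fF2 k).
(* Square integrability is known for the differences [f - F k], so the class of [f] is assembled
   from one of them. *)
pose L := W 0%N + F 0%N.
have WE k : L - F k = W k.
  apply/esym; apply: mkL2_coe.
  have h1 := L2_diff_ae L (F k); have h2 := L2_lin_ae 1 (W 0%N) (F 0%N); have h3 :=
    mkL2_ae (fF2 0%N).
  apply: filterS3 h1 h2 h3 => x e1 e2 e3 xT; rewrite e1// /L.
  by rewrite -[W 0%N]scale1r e2// scale1r e3// subrK.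
exists L; apply/subr_cvg0/norm_cvg0P.
pose C : R := kappa * (N * 4 * \int[dx]_x (fine (g x))).
have C0 : 0 <= C.
  by rewrite !mulr_ge0 ?(ltW k1)//; apply: Rintegral_ge0 => x _; rewrite fine_ge0.
apply: (@squeeze_cvgr _ _ _ _ (cst 0) (fun k => Num.sqrt C * 2^-1 ^+ k)); last 2 first.
- exact: cvg_cst.
- rewrite -[X in _ --> X](mulr0 (Num.sqrt C)); apply: cvgMr; apply: cvg_expr.
  by rewrite ger0_norm ?invr_ge0// invf_lt1// ltr1n.
apply: nearW => k; rewrite normr_ge0/= distrC WE.
rewrite -(@ler_pXn2r _ 2)// ?nnegrE ?mulr_ge0 ?sqrtr_ge0 ?exprn_ge0// ?invr_ge0//.
rewrite exprMn sqr_sqrtr// L2_norm_kappa.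
have mW : cmeasurable (W k) by have [] := L2_in (W k).
rewrite (L2_inner_ae (mfF k) (mfF k) (mkL2_ae (fF2 k)) (mkL2_ae (fF2 k))).
rewrite /C -!mulrA ler_pM2l//.
have -> : N * (4 * (\int[dx]_x fine (g x) * (2^-1 ^+ k) ^+ 2)) =
  \int[dx]_x (c k * (fine \o g) x).
  rewrite RintegralZl// /c exprVn -exprVn -exprM mulnC exprM expr2 -!mulrA.
  congr (_ * (_ * _)); rewrite [RHS]mulrC -exprVn; congr (_ * _ ^+ _).
  by rewrite -invfM -natrM.
apply: fine_le.
- by apply: integrable_fin_num => //; exact: (integrable_scalar_prod (fF2 k) (fF2 k)).
- exact: (integrable_fin_num measurableT (igc k)).
- apply: ae_ge0_le_integral => //.
  + by move=> x _; rewrite lee_fin scalar_prod_ge0.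
  + by apply/measurable_EFinP; exact: measurable_scalar_prod.
  + by move=> x _; rewrite lee_fin mulr_ge0// fine_ge0.
  + exact: measurable_int (igc k).
  + by apply: filterS (fF k) => x h _; rewrite lee_fin -clifford_sqr_norm.
Qed.

End L2Basics.

(** * Boxes generate the Borel sets *)

Section Boxes.
Context {R : realType} {n : nat}.
Local Notation mu := (@lebesgue_measure R).
Local Notation Rn := (n.-tuple (measurableTypeR R)).
Local Notation dx := (@dx R n).
Implicit Types (a b : 'I_n -> R).

Definition box a b : set Rn := [set x | forall i, (`]a i, b i]%classic : set R) (tnth x i)].

Lemma box_indic a b x : \1_(box a b) x = \prod_(i < n) \1_(`]a i, b i]%classic : set R)
  (tnth x i) :> R.
Proof.
rewrite indicE; case: (boolP (x \in box a b)) => [/set_mem xb|/negP xb].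
  by rewrite big1// => i _; rewrite indicE mem_set//; exact: xb.
have /existsNP[i xi] : ~ (forall i, (`]a i, b i]%classic : set R) (tnth x i)).
  by move=> h; apply: xb; exact/mem_set.
by rewrite (bigD1 i)//= indicE memNset// mul0r.
Qed.

Lemma measurable_box a b : measurable (box a b).
Proof.
rewrite (_ : box a b = \bigcap_(i in [set: 'I_n]) ((@tnth n _ ^~ i) @^-1` (`]a i,
  b i]%classic : set R))).
  apply: fin_bigcap_measurable => // i _.
  by rewrite -[X in measurable X]setTI; apply: measurable_tnth => //; exact: measurable_itv.
by apply/seteqP; split => t /= H i; [move=> _|]; exact: H.
Qed.

Lemma boxI a b a' b' : box a b `&` box a' b' =
  box (fun i => Num.max (a i) (a' i)) (fun i => Num.min (b i) (b' i)).
Proof.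
apply/seteqP; split => x /=.
  move=> [h h'] i; have := h i; have := h' i; rewrite /= !in_itv/= gt_max le_min.
  by move=> /andP[-> ->] /andP[-> ->].
move=> h; split=> i; have := h i; rewrite /= !in_itv/= gt_max le_min.
  by move=> /andP[/andP[-> _] /andP[-> _]].
by move=> /andP[/andP[_ ->] /andP[_ ->]].
Qed.

Definition boxes : set (set Rn) := [set box p.1 p.2 | p in [set: ('I_n -> R) * ('I_n -> R)]].

Lemma boxes_box a b : boxes (box a b).
Proof. by exists (a, b). Qed.

Lemma setI_closed_boxes : setI_closed boxes.
Proof. by move=> _ _ [[a b] _ <-] [[a' b'] _ <-] /=; rewrite boxI; exact: boxes_box. Qed.

Definition cube (N : nat) : set Rn := box (fun=> - N%:R) (fun=> N%:R).

Lemma cube_cover x : exists N, cube N x.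
Proof.
exists (\sum_(i < n) Num.bound (tnth x i : R))%N => i.
have h : (`|tnth x i : R| < (\sum_(i < n) Num.bound (tnth x i : R))%:R).
  apply: lt_le_trans (archi_boundP (normr_ge0 _)) _; rewrite ler_nat.
  rewrite (bigD1 i)//= (_ : Num.bound `|tnth x i : R| = Num.bound (tnth x i : R)) ?leq_addr//.
  by rewrite /Num.bound normr_id.
by move: h; rewrite /= in_itv/= ltr_norml => /andP[-> /ltW ->].
Qed.

(** The product sigma-algebra is generated by preimages under coordinates, and those of Borel sets
    by those of intervals. *)
Lemma measurable_sub_boxes : (measurable : set (set Rn)) `<=` <<s boxes >>.
Proof.
have sB : sigma_algebra [set: Rn] <<s boxes >> by exact: smallest_sigma_algebra.
apply: smallest_sub => //.
elim/big_ind: _ => [A []|A B hA hB|i _]; first by rewrite subUset.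
move=> _ [A mA <-]; rewrite setTI.
pose C := [set A : set (measurableTypeR R) | <<s boxes >>
  ((@tnth n (measurableTypeR R) ^~ i) @^-1` A)].
suff : <<s (@ocitv R) >> `<=` C by apply; exact: mA.
have [B0 BC BU] := sB.
apply: smallest_sub.
  split; rewrite /C /=.
  - by rewrite preimage_set0.
  - by move=> D hD; rewrite setTD preimage_setC -setTD; exact: BC.
  - by move=> D hD; rewrite preimage_bigcup; exact: BU.
move=> _ [[a b] _ <-]; rewrite /C /=.
(* A slab constrains one coordinate; it is the union of the boxes that cut all others at - N and
   N. *)
rewrite (_ : _ @^-1` _ = \bigcup_N box (fun j => if j == i then a else - N%:R)
   (fun j => if j == i then b else N%:R)).
  by apply: BU => N; apply: sub_sigma_algebra; exact: boxes_box.
apply/seteqP; split => x /=.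
  move=> xi; have [N xN] := cube_cover x; exists N => // j.
  by case: eqP => [->|_]; [exact: xi|exact: xN].
by move=> [N _ /(_ i)]; rewrite eqxx.
Qed.

(** Dynkin's argument inside a cube: there [h] is integrable, so the sets over which its integral
    vanishes form a Dynkin system, which contains the intersection-stable boxes and hence all Borel
    sets. The cubes cover the space. *)
Lemma integral_box_eq0_ae (h : Rn -> R) : measurable_fun setT h ->
  (forall a b, dx.-integrable (box a b) (EFin \o h)) ->
  (forall a b, (\int[dx]_(x in box a b) (h x)%:E = 0)%E) ->
  {ae dx, forall x, h x = 0}.
Proof.
move=> mh ih h0.
have mB := measurable_box.
have key N A : measurable A -> (\int[dx]_(x in A `&` cube N) (h x)%:E = 0)%E.
  pose H := [set A : set Rn | measurable A /\ (\int[dx]_(x in A `&` cube N) (h x)%:E = 0)%E].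
  suff : <<d boxes >> `<=` H.
    by move=> HH mA; apply HH; rewrite setI_closed_g_dynkin_g_sigma_algebra;
      [exact: measurable_sub_boxes|exact: setI_closed_boxes].
  apply: smallest_sub; last first.
    by move=> _ [[a b] _ <-] /=; split; [exact: mB|rewrite boxI h0].
  have mhE D : measurable_fun D (EFin \o h).
    by apply: measurable_funTS; exact/measurable_EFinP.
  split.
  - by split; rewrite ?setTI// h0.
  - move=> D [mD D0]; split; first exact: measurableC.
    have := h0 (fun=> - N%:R) (fun=> N%:R); rewrite -/(cube N).
    have {1}-> : cube N = (D `&` cube N) `|` (~` D `&` cube N).
      by rewrite -setIUl setUv setTI.
    rewrite integral_setU_EFin//.
    + by rewrite D0 add0e.
    + by apply: measurableI => //; exact: mB.
    + by apply: measurableI; [exact: measurableC|exact: mB].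
    + by apply/measurable_EFinP; exact: mhE.
    + by apply/disj_setPS => x [[Dx _] [nDx _]].
  - move=> F tF HF; split; first by apply: bigcup_measurable => k _; have [] := HF k.
    rewrite setI_bigcupl integral_bigcup.
    + by apply: eseries0 => k _ _; have [] := HF k.
    + apply/trivIsetP => i j _ _ ij; rewrite setIACA.
      by move/trivIsetP : tF => /(_ i j I I ij) ->; rewrite set0I.
    + by move=> k; apply: measurableI; [have [] := HF k|exact: mB].
    + apply: (@integrableS _ _ _ _ (cube N)); [exact: mB| | |exact: ih].
        by apply: bigcup_measurable => k _; apply: measurableI; [have [] := HF k|exact: mB].
      by move=> x [k _ []].
have : {ae dx, forall x N, cube N x -> h x = 0}.
  apply/ae_foralln => N.
  have := @integral_ae_eq _ _ _ dx (cube N) (mB _ _) (cst 0%E) (EFin \o h) (ih _ _).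
  have m0 : measurable_fun (cube N) (cst 0%E : Rn -> \bar R) by exact: measurable_cst.
  move=> /(_ m0) H; have {}H := H _.
  apply: filterS (H _) => [x hx xN|E EN mE]; first by have [] := hx xN.
  by rewrite integral0 -(key N E mE) setIidl.
by apply: filterS => x hx; have [N xN] := cube_cover x; exact: (hx N).
Qed.

End Boxes.

(** * The transform, its adjoint and the box functions *)

Section IntervalTransform.
Context {R : realType}.
Local Notation mu := (@lebesgue_measure R).
Implicit Types (a b sg y : R) (c : bool).

(** One coordinate of the transform of a box; [c] says whether the coordinate belongs to the subset
    [P] of the kernel expansion. *)
Definition trig_int c sg a b y : R := if c then sg * sinint a b y else cosint a b y.

Lemma trig_int_max c sg a b : trig_int c sg a b = trig_int c sg a (Num.max a b).
Proof. by apply/funext => y; rewrite /trig_int sinint_max cosint_max. Qed.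

Lemma integrable_trig_int c c' sg a b a' b' :
  mu.-integrable setT (EFin \o (fun y => trig_int c sg a b y * trig_int c' sg a' b' y)).
Proof.
rewrite trig_int_max (trig_int_max c').
set d := Num.max a b; set d' := Num.max a' b'.
have ab : a <= d by rewrite le_max lexx.
have ab' : a' <= d' by rewrite le_max lexx.
have e (k : R) (f g : R -> R) : (forall y, f y = k * g y) -> mu.-integrable setT (EFin \o g) ->
    mu.-integrable setT (EFin \o f).
  by move=> fg gi; rewrite (_ : f = fun y => k * g y); [exact: integrableZR|exact/funext].
case: c; case: c'; rewrite /trig_int.
- by apply: e (integrable_sin_sinint ab ab') => y; rewrite mulrACA.
- apply: (e sg _ (fun y => cosint a' d' y * sinint a d y)); last exact: integrable_cos_sinint.
  by move=> y; ring.
- by apply: e (integrable_cos_sinint ab ab') => y; rewrite mulrCA.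
- exact: integrable_cos_cosint.
Qed.

Lemma Rintegral_trig_int_neq c sg a b a' b' :
  \int[mu]_y (trig_int c sg a b y * trig_int (~~ c) sg a' b' y) = 0.
Proof.
rewrite trig_int_max (trig_int_max (~~ c)).
set d := Num.max a b; set d' := Num.max a' b'.
have ab : a <= d by rewrite le_max lexx.
have ab' : a' <= d' by rewrite le_max lexx.
case: c; rewrite /trig_int/=.
- transitivity (\int[mu]_y (sg * (cosint a' d' y * sinint a d y))).
    by apply: eq_Rintegral => y _; ring.
  rewrite RintegralZl//; last exact: integrable_cos_sinint.
  by rewrite Rintegral_cos_sinint// mulr0.
- transitivity (\int[mu]_y (sg * (cosint a d y * sinint a' d' y))).
    by apply: eq_Rintegral => y _; ring.
  rewrite RintegralZl//; last exact: integrable_cos_sinint.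
  by rewrite Rintegral_cos_sinint// mulr0.
Qed.

Lemma set_itv_max a b : `]a, b]%classic = `]a, Num.max a b]%classic :> set R.
Proof.
have [//|ba] := leP a b.
by rewrite set_itv_ge -?leNgt ?bnd_simp ?ltW// set_itv_ge// bnd_simp ltxx.
Qed.

(** [Rintegral_cosint_sinint] and [Rintegral_indic_itv] produce the same four absolute values. The
    sign enters squared, so the adjoint transform gives the same result. *)
Lemma Rintegral_trig_int_sum sg a b a' b' : sg * sg = 1 ->
  \int[mu]_y (trig_int true sg a b y * trig_int true sg a' b' y) +
  \int[mu]_y (trig_int false sg a b y * trig_int false sg a' b' y) =
  2 * pi * \int[mu]_x (\1_(`]a, b]%classic : set R) x * \1_(`]a', b']%classic : set R) x).
Proof.
move=> sg1; rewrite (trig_int_max true sg a) (trig_int_max true sg a')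
  (trig_int_max false sg a) (trig_int_max false sg a').
rewrite (set_itv_max a) (set_itv_max a').
set d := Num.max a b; set d' := Num.max a' b'.
have ab : a <= d by rewrite le_max lexx.
have ab' : a' <= d' by rewrite le_max lexx.
rewrite mulrAC mulrC [X in pi * X](Rintegral_indic_itv ab ab')
  -(Rintegral_cosint_sinint ab ab').
rewrite addrC; congr (_ + _); apply: eq_Rintegral => y _.
by rewrite /trig_int mulrACA sg1 mul1r.
Qed.

End IntervalTransform.

(** * The integral transform on L1 and its adjoint *)

Section Transform.
Context {R : realType} {n : nat}.
Local Notation mu := (@lebesgue_measure R).
Local Notation Rn := (n.-tuple (measurableTypeR R)).
Local Notation G := (clifford R (n + n)).
Local Notation dx := (@dx R n).
Local Notation kappa := (@kappa R n).
Implicit Types (f g : Rn -> G) (x y : Rn) (a c : 'I_n -> R) (P Q : {set 'I_n})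
  (S U : {set 'I_(n + n)}) (l : bool) (sg : R).

Definition in_L1 f := cmeasurable f /\
  forall S, dx.-integrable setT (EFin \o (fun x => f x S : R)).

Lemma ker_fun_le1 sg P i (t : R) : `|sg| = 1 -> `|ker_fun sg P i t| <= 1.
Proof.
move=> sg1; rewrite /ker_fun; case: ifP => _.
  by rewrite normrM sg1 mul1r ler_norml sin_geN1 sin_le1.
by rewrite ler_norml cos_geN1 cos_le1.
Qed.

Lemma measurable_ker_fun sg P i : measurable_fun setT (ker_fun sg P i : R -> R).
Proof.
rewrite /ker_fun; case: (i \in P).
  by apply: measurable_funM => //; apply: continuous_measurable_fun; exact: continuous_sin.
by apply: continuous_measurable_fun; exact: continuous_cos.
Qed.

Lemma measurable_ker_coef sg P :
  measurable_fun setT (fun p : Rn * Rn => ker_coef sg P p.1 p.2).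
Proof.
apply: measurable_prod => i _; apply: (measurableT_comp (measurable_ker_fun sg P i)).
have mt : measurable_fun setT (fun x : Rn => tnth x i) := measurable_tnth i.
apply: measurable_funM; first exact: (measurableT_comp mt measurable_fst).
exact: (measurableT_comp mt measurable_snd).
Qed.

Lemma measurable_ker_coefl sg P y : measurable_fun setT (fun x : Rn => ker_coef sg P x y).
Proof. exact: (measurableT_comp (measurable_ker_coef sg P) (measurable_pair2 y)). Qed.

Lemma integrable_ker sg P f y S : `|sg| = 1 -> in_L1 f ->
  dx.-integrable setT (EFin \o (fun x => ker_coef sg P x y * f x S)).
Proof.
move=> sg1 [mf fi]; apply: (@integrable_le _ _ _ dx _ (fun x => `|f x S : R|)).
- by apply: measurable_funM; [exact: measurable_ker_coefl|exact: mf].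
- by move=> x; rewrite normrM ler_piMl// ker_coef_le1.
- exact: (@integrable_norm _ _ _ dx setT (fun x => f x S) (fi S)).
Qed.

(** Confines the noncommutative part to constants, so that integrals of transforms become finite
    sums of real integrals. *)
Lemma act_ker_coord l sg x y (A : G) U :
  act l (ker sg x y) A U =
  \sum_P \sum_S act l (bivector_prod P) (blade S) U * (ker_coef sg P x y * A S) :> R.
Proof.
rewrite /ker act_suml sum_ffunE; apply: eq_bigr => P _.
rewrite {1}(cliffordE A) act_sumr sum_ffunE; apply: eq_bigr => S _.
by rewrite actZ actZr !ffunE /GRing.scale/=; ring.
Qed.

Lemma integrable_act_ker l sg f y U : `|sg| = 1 -> in_L1 f ->
  dx.-integrable setT (EFin \o (fun x => act l (ker sg x y) (f x) U : R)).
Proof.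
move=> sg1 fi.
rewrite (_ : (fun x => _) = (fun x => \sum_P \sum_S act l (bivector_prod P) (blade S) U *
  (ker_coef sg P x y * f x S))).
  apply: integrable_sumR => P; apply: integrable_sumR => S; apply: integrableZR.
  exact: integrable_ker.
by apply/funext => x; rewrite act_ker_coord.
Qed.

(* The left (l = true) or right Fourier transform for sg = -1, its adjoint for sg = 1. *)
Definition transform l sg f y : G := cintegral (fun x => act l (ker sg x y) (f x)).

Lemma fourier_leftE f : fourier_left f = transform true (-1) f.
Proof.
by apply/funext => y; congr cintegral; apply/funext => x; rewrite clifford_exp_phase.
Qed.

Lemma fourier_rightE f : fourier_right f = transform false (-1) f.
Proof.
by apply/funext => y; congr cintegral; apply/funext => x; rewrite clifford_exp_phase.
Qed.

Lemma transformE l sg f y U : `|sg| = 1 -> in_L1 f ->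
  transform l sg f y U = kappa * \int[dx]_x (act l (ker sg x y) (f x) U : R).
Proof. by move=> sg1 fi; rewrite cintegralE//; exact: integrable_act_ker. Qed.

Lemma transform_coord l sg f y U : `|sg| = 1 -> in_L1 f ->
  transform l sg f y U = kappa * \sum_P \sum_S
    act l (bivector_prod P) (blade S) U * \int[dx]_x (ker_coef sg P x y * (f x S : R)).
Proof.
move=> sg1 fi; rewrite transformE//; congr (_ * _).
have ik P S := integrable_ker P y S sg1 fi.
under eq_Rintegral do rewrite act_ker_coord.
rewrite Rintegral_sum; last first.
  by move=> P; apply: integrable_sumR => S; exact: integrableZR.
apply: eq_bigr => P _; rewrite Rintegral_sum; last by move=> S; exact: integrableZR.
by apply: eq_bigr => S _; rewrite RintegralZl.
Qed.

(** The real integral is [fine] of a difference of integrals of the positive and negative parts,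
    each measurable in [y] by Tonelli. *)
Lemma measurable_Rintegral_param (k : Rn * Rn -> R) : measurable_fun setT k ->
  measurable_fun setT (fun y => \int[dx]_x k (x, y)).
Proof.
move=> mk; have mk' : measurable_fun setT (EFin \o k) by exact/measurable_EFinP.
pose m := tuple_measure (@lebesgue_measure R) n.
have E : (fun y => \int[dx]_x k (x, y)) =
    fine \o (fubini_G m ((EFin \o k)^\+)%E \- fubini_G m ((EFin \o k)^\-)%E)%E.
  apply/funext => y; rewrite /Rintegral integralE /=; congr fine.
  by congr (_ - _)%E; apply: eq_integral => x _; rewrite ?funeposE ?funenegE.
rewrite E; apply: measurableT_comp; first exact: fine_measurable.
apply: emeasurable_funB.
  apply: measurable_fun_fubini_tonelli_G; first exact: measurable_funepos.
  by move=> p; exact: funepos_ge0.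
apply: measurable_fun_fubini_tonelli_G; first exact: measurable_funeneg.
by move=> p; exact: funeneg_ge0.
Qed.

Lemma cmeasurable_transform l sg f : `|sg| = 1 -> in_L1 f -> cmeasurable (transform l sg f).
Proof.
move=> sg1 fi U; rewrite (_ : (fun y => _) = (fun y => kappa * \sum_P \sum_S
    act l (bivector_prod P) (blade S) U * \int[dx]_x (ker_coef sg P x y * (f x S : R))));
      last first.
  by apply/funext => y; rewrite transform_coord.
apply: measurable_funM => //; apply: measurable_sum => P; apply: measurable_sum => S.
apply: measurable_funM => //.
apply: (@measurable_Rintegral_param (fun p => ker_coef sg P p.1 p.2 * f p.1 S)).
apply: measurable_funM; first exact: measurable_ker_coef.
by have [mf _] := fi; exact: (measurableT_comp (mf S) measurable_fst).
Qed.

(** Makes the transform of an L1 function integrable over boxes, so that it can be tested there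
    before it is known to lie in L2. *)
Lemma transform_bounded l sg f U : `|sg| = 1 -> in_L1 f ->
  exists M, forall y, `|transform l sg f y U : R| <= M.
Proof.
move=> sg1 fi; have [mf fi'] := fi.
exists (kappa * \sum_P \sum_S `|act l (bivector_prod P) (blade S) U : R| * \int[dx]_x `|f
  x S : R|).
move=> y; rewrite transform_coord// normrM (gtr0_norm (@kappa_gt0 R n)) ler_pM2l ?kappa_gt0//.
rewrite (le_trans (ler_norm_sum _ _ _))//; apply: ler_sum => P _.
rewrite (le_trans (ler_norm_sum _ _ _))//; apply: ler_sum => S _.
rewrite normrM ler_wpM2l//.
have ik := integrable_ker P y S sg1 fi.
rewrite (le_trans (le_normr_Rintegral _ _))//; apply: le_Rintegral => //.
- exact: integrable_norm.
- exact: (@integrable_norm _ _ _ dx setT (fun x => f x S) (fi' S)).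
- by move=> x _; rewrite normrM ler_piMl// ker_coef_le1.
Qed.

Lemma Rintegral_Fubini (k : Rn * Rn -> R) :
  let m := tuple_measure (@lebesgue_measure R) n in
  (m \x m)%E.-integrable setT (EFin \o k) ->
  (forall y, dx.-integrable setT (EFin \o (fun x => k (x, y)))) ->
  (forall x, dx.-integrable setT (EFin \o (fun y => k (x, y)))) ->
  [/\ dx.-integrable setT (EFin \o (fun y => \int[dx]_x k (x, y))),
      dx.-integrable setT (EFin \o (fun x => \int[dx]_y k (x, y))) &
   \int[dx]_y \int[dx]_x k (x, y) = \int[dx]_x \int[dx]_y k (x, y)].
Proof.
move=> m ik iy ix.
have EG : fubini_G m (EFin \o k) = EFin \o (fun y => \int[dx]_x k (x, y)).
  by apply/funext => y; rewrite /= fineK//; exact: (integrable_fin_num measurableT (iy y)).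
have EF : fubini_F m (EFin \o k) = EFin \o (fun x => \int[dx]_y k (x, y)).
  by apply/funext => x; rewrite /= fineK//; exact: (integrable_fin_num measurableT (ix x)).
split.
- have mk := measurable_int _ ik.
  (* Integrability of the other iterated integral is obtained by exchanging the two variables. *)
  pose w (p : Rn * Rn) := (p.2, p.1).
  have mw : measurable_fun setT w.
    by apply/measurable_fun_pairP; split; [exact: measurable_snd|exact: measurable_fst].
  have ms : measurable_fun setT ((EFin \o k) \o w) by exact: measurableT_comp.
  have iks : (m \x m)%E.-integrable setT ((EFin \o k) \o w).
    by apply/(integrable12ltyP _ _ ms); exact: ((integrable21ltyP _ _ mk).1 ik).
  by have := integrable_fubini_F iks; rewrite -[fubini_F _ _]/(fubini_G m (EFin \o k)) EG.
- by have := integrable_fubini_F ik; rewrite EF.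
- have h := Fubini ik; congr fine.
  transitivity (\int[m]_y fubini_G m (EFin \o k) y)%E; first by rewrite EG.
  by rewrite -[LHS]h; transitivity (\int[m]_x fubini_F m (EFin \o k) x)%E => //; rewrite EF.
Qed.

Lemma Rintegral_scalar_prodl f (C : G) :
  (forall S, dx.-integrable setT (EFin \o (fun x => f x S : R))) ->
  dx.-integrable setT (EFin \o (fun x => scalar_prod (f x) C)) /\
  \int[dx]_x scalar_prod (f x) C = \sum_S (\int[dx]_x (f x S : R)) * C S.
Proof.
move=> fi; have e : (fun x => scalar_prod (f x) C) = (fun x => \sum_S (C S : R) * f x S).
  by apply/funext => x; rewrite scalar_prodE; apply: eq_bigr => S _; rewrite mulrC.
have iS S : dx.-integrable setT (EFin \o (fun x => (C S : R) * f x S)) by exact: integrableZR.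
rewrite e; split; first exact: integrable_sumR.
by rewrite Rintegral_sum//; apply: eq_bigr => S _; rewrite RintegralZl// mulrC.
Qed.

(** The kernel moves to the other side of the scalar product as its reversion, the kernel of
    opposite sign, and it is symmetric in x and y. Fubini applies since its coefficients are bounded
    by 1 and [f], [g] are integrable. *)
Lemma transform_adjoint l sg f g : `|sg| = 1 -> in_L1 f -> in_L1 g ->
  \int[dx]_y scalar_prod (transform l sg f y) (g y) =
  \int[dx]_x scalar_prod (f x) (transform l (- sg) g x).
Proof.
move=> sg1 fi gi; have sgN1 : `|- sg| = 1 by rewrite normrN.
pose k (p : Rn * Rn) : R := scalar_prod (act l (ker sg p.1 p.2) (f p.1)) (g p.2).
have k' x y : k (x, y) = scalar_prod (f x) (act l (ker (- sg) y x) (g y)).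
  by rewrite /k scalar_prod_act_ker ker_sym.
have hy y := Rintegral_scalar_prodl (g y) (fun U => integrable_act_ker l y U sg1 fi).
have hx x := Rintegral_scalar_prodl (f x) (fun U => integrable_act_ker l x U sgN1 gi).
have ix x : dx.-integrable setT (EFin \o (fun y => k (x, y))).
  have [h _] := hx x; apply: eq_integrable h => // y _.
  by rewrite /= k' scalar_prodC.
have ik : (tuple_measure (@lebesgue_measure R) n \x tuple_measure (@lebesgue_measure R)
  n)%E.-integrable setT (EFin \o k).
  have -> : k = fun p => \sum_U \sum_P \sum_S act l (bivector_prod P) (blade S) U *
      (ker_coef sg P p.1 p.2 * (f p.1 S * g p.2 U)).
    apply/funext => p; rewrite /k scalar_prodE; apply: eq_bigr => U _.
    rewrite act_ker_coord mulr_suml; apply: eq_bigr => P _.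
    by rewrite mulr_suml; apply: eq_bigr => S _; ring.
  apply: integrable_sumR => U; apply: integrable_sumR => P; apply: integrable_sumR => S.
  apply: integrableZR; apply: (@integrable_dominated_tensor _ _ _ _ R _ _
    (fun p => ker_coef sg P p.1 p.2) (fun x => f x S) (fun y => g y U)).
  - exact: measurable_ker_coef.
  - by move=> p; exact: ker_coef_le1.
  - by have [_] := fi; apply.
  - by have [_] := gi; apply.
have [i1 i2 E] := Rintegral_Fubini ik (fun y => (hy y).1) ix.
transitivity (\int[dx]_y (kappa * \int[dx]_x k (x, y))).
  apply: eq_Rintegral => y _; rewrite (hy y).2 mulr_sumr scalar_prodE.
  by apply: eq_bigr => U _; rewrite (transformE _ _ _ sg1 fi) mulrA.
rewrite (RintegralZl _ measurableT i1) E -(RintegralZl _ measurableT i2).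
apply: eq_Rintegral => x _.
have -> : \int[dx]_y k (x, y) = \int[dx]_y scalar_prod (act l (ker (- sg) y x) (g y)) (f x).
  by apply: eq_Rintegral => y _; rewrite k' scalar_prodC.
rewrite (hx x).2 mulr_sumr scalar_prodE; apply: eq_bigr => U _.
by rewrite (transformE _ _ _ sgN1 gi) mulrA mulrC.
Qed.

End Transform.

(** * Transforms of box functions and their scalar products *)

Section BoxTransform.
Context {R : realType} {n : nat}.
Local Notation mu := (@lebesgue_measure R).
Local Notation Rn := (n.-tuple (measurableTypeR R)).
Local Notation G := (clifford R (n + n)).
Local Notation dx := (@dx R n).
Local Notation kappa := (@kappa R n).
Implicit Types (f g : Rn -> G) (x y : Rn) (a c : 'I_n -> R) (P Q : {set 'I_n})
  (S U : {set 'I_(n + n)}) (l : bool) (sg : R).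

Definition box_fun a c S : Rn -> G := fun x => (\1_(box a c) x : R) *: blade S.

Lemma box_fun_coord a c S x U : box_fun a c S x U = \1_(box a c) x * (U == S)%:R :> R.
Proof. by rewrite !ffunE. Qed.

Lemma scalar_prod_box_fun a c S x (A : G) :
  scalar_prod A (box_fun a c S x) = (A S : R) * \1_(box a c) x.
Proof.
rewrite scalar_prodE (bigD1 S)//= big1 => [|U US].
  by rewrite box_fun_coord eqxx mulr1 addr0.
by rewrite box_fun_coord (negbTE US) !mulr0.
Qed.

Lemma integrable_indic_box a c : dx.-integrable setT (EFin \o (\1_(box a c) : Rn -> R)).
Proof.
have [h _] := @integral_prod_tnth R n (fun i => \1_(`]a i, c i]%classic : set R))
  (fun i => @integrable_indic_itv R (a i) (c i) false false).
by apply: eq_integrable h => // x _; rewrite /= box_indic.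
Qed.

Lemma measurable_indic_box a c : measurable_fun setT (\1_(box a c) : Rn -> R).
Proof. exact: measurable_indic (measurable_box a c). Qed.

Lemma cmeasurable_box_fun a c S : cmeasurable (box_fun a c S).
Proof.
move=> U; rewrite (_ : (fun x => _) = (fun x => \1_(box a c) x * (U == S)%:R)).
  by apply: measurable_funM => //; exact: measurable_indic_box.
by apply/funext => x; rewrite box_fun_coord.
Qed.

Lemma in_L1_box_fun a c S : in_L1 (box_fun a c S).
Proof.
split; first exact: cmeasurable_box_fun.
move=> U; have := integrableZR (U == S)%:R (integrable_indic_box a c).
by apply: eq_integrable => // x _; rewrite /= box_fun_coord mulrC.
Qed.

Lemma indic_sqr (T : Type) (A : set T) (x : T) : (\1_A x : R) ^+ 2 = \1_A x.
Proof. by rewrite indicE; case: (x \in A); rewrite ?expr1n ?expr0n. Qed.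

Lemma in_L2_box_fun a c S : in_Lp 2%:E (box_fun a c S).
Proof.
apply/in_L2P; split; first exact: cmeasurable_box_fun.
move=> U; have := integrableZR (U == S)%:R (integrable_indic_box a c).
apply: eq_integrable => // x _; rewrite /= box_fun_coord mulrC exprMn indic_sqr.
by case: (U == S); rewrite ?expr1n ?expr0n.
Qed.

Lemma measurable_indic_oc (s t : R) : measurable_fun setT (\1_(`]s, t]%classic : set R) :
  R -> R).
Proof. by apply: measurable_indic; exact: measurable_itv. Qed.

(** The kernel coefficient and the indicator of a box are both products over the coordinates, so the
    integral factors. *)
Lemma Rintegral_ker_box sg P a c y : `|sg| = 1 ->
  \int[dx]_x (ker_coef sg P x y * \1_(box a c) x) =
  \prod_(i < n) trig_int (i \in P) sg (a i) (c i) (tnth y i).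
Proof.
move=> sg1; pose phi i (t : R) : R :=
  ker_fun sg P i (t * tnth y i) * \1_(`]a i, c i]%classic : set R) t.
have mphi i : measurable_fun setT (fun t : R => ker_fun sg P i (t * tnth y i)).
  by apply: (measurableT_comp (measurable_ker_fun sg P i)); exact: measurable_funM.
have iphi i : mu.-integrable setT (EFin \o phi i).
  apply: (integrable_le _ _ (@integrable_indic_itv R (a i) (c i) false false)).
    by apply: measurable_funM; [exact: mphi|exact: measurable_indic_oc].
  move=> t; rewrite /phi normrM [X in _ * X]ger0_norm; last by rewrite indicE.
  by rewrite ler_piMl// ?indicE// ker_fun_le1.
have [_ E] := integral_prod_tnth iphi.
transitivity (\int[dx]_x (\prod_(i < n) phi i (tnth x i))).
  by apply: eq_Rintegral => x _; rewrite box_indic /ker_coef -big_split.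
rewrite E; apply: eq_bigr => i _.
rewrite /trig_int /cosint /sinint /phi /ker_fun; case: ifP => iP; last first.
  rewrite [RHS]Rintegral_mkcond; apply: eq_Rintegral => t _.
  by rewrite patch_indic.
have si : mu.-integrable setT (EFin \o (fun t : R => sin (t * tnth y i) * \1_(`]a i,
  c i]%classic : set R) t)).
  apply: (integrable_le _ _ (@integrable_indic_itv R (a i) (c i) false false)).
    apply: measurable_funM; last exact: measurable_indic_oc.
    by apply: continuous_measurable_fun; exact: continuous_sin_scaler.
  move=> t; rewrite normrM [X in _ * X]ger0_norm; last by rewrite indicE.
  by rewrite ler_piMl// ?indicE// ler_norml sin_geN1 sin_le1.
rewrite [X in _ = _ * X]Rintegral_mkcond patch_indic.
by rewrite -RintegralZl//; apply: eq_Rintegral => t _; rewrite mulrA.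
Qed.

Lemma transform_box_fun l sg a c S y : `|sg| = 1 ->
  transform l sg (box_fun a c S) y = kappa *:
    \sum_(P : {set 'I_n}) (\prod_(i < n) trig_int (i \in P) sg (a i) (c i) (tnth y i)) *:
      act l (bivector_prod P) (blade S).
Proof.
move=> sg1; have fi := in_L1_box_fun a c S.
apply/ffunP => U; rewrite transform_coord// [RHS]ffunE sum_ffunE; congr (_ * _).
apply: eq_bigr => P _; rewrite (bigD1 S)//= big1 ?addr0 => [|S' S'S].
  rewrite [RHS]ffunE -Rintegral_ker_box// mulrC; congr (_ * _).
  by apply: eq_Rintegral => x _; rewrite box_fun_coord eqxx mulr1.
rewrite (_ : Rintegral _ _ _ = 0) ?mulr0//.
rewrite /Rintegral integral0_eq// => x _.
by rewrite box_fun_coord (negbTE S'S) !mulr0.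
Qed.

Lemma trig_prodM P Q sg a c a' c' y :
  (\prod_(i < n) trig_int (i \in P) sg (a i) (c i) (tnth y i)) *
  (\prod_(i < n) trig_int (i \in Q) sg (a' i) (c' i) (tnth y i)) =
  \prod_(i < n) (fun t => trig_int (i \in P) sg (a i) (c i) t * trig_int (i \in Q) sg
    (a' i) (c' i) t) (tnth y i).
Proof. by rewrite -big_split. Qed.

Lemma integrable_trig_prodM P Q sg a c a' c' :
  dx.-integrable setT (EFin \o (fun y =>
  (\prod_(i < n) trig_int (i \in P) sg (a i) (c i) (tnth y i)) *
  (\prod_(i < n) trig_int (i \in Q) sg (a' i) (c' i) (tnth y i)))).
Proof.
have [h _] := @integral_prod_tnth R n
  (fun i t => trig_int (i \in P) sg (a i) (c i) t * trig_int (i \in Q) sg (a' i) (c' i) t)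
  (fun i => integrable_trig_int _ _ sg _ _ _ _).
by apply: eq_integrable h => // y _; rewrite /= trig_prodM.
Qed.

Definition trig_mean (c1 c2 : bool) sg (a c a' c' : R) : R :=
  \int[mu]_t (trig_int c1 sg a c t * trig_int c2 sg a' c' t).

Lemma Rintegral_trig_prodM P Q sg a c a' c' :
  \int[dx]_y (
  (\prod_(i < n) trig_int (i \in P) sg (a i) (c i) (tnth y i)) *
  (\prod_(i < n) trig_int (i \in Q) sg (a' i) (c' i) (tnth y i))) =
  \prod_(i < n) trig_mean (i \in P) (i \in Q) sg (a i) (c i) (a' i) (c' i).
Proof.
have [_ h] := @integral_prod_tnth R n
  (fun i t => trig_int (i \in P) sg (a i) (c i) t * trig_int (i \in Q) sg (a' i) (c' i) t)
  (fun i => integrable_trig_int _ _ sg _ _ _ _).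
by rewrite -[RHS]h; apply: eq_Rintegral => y _; rewrite trig_prodM.
Qed.

Lemma in_L2_transform_box_fun l sg a c S : `|sg| = 1 ->
  in_Lp 2%:E (transform l sg (box_fun a c S)).
Proof.
move=> sg1; apply/in_L2P; split; first by apply: cmeasurable_transform => //;
  exact: in_L1_box_fun.
move=> U.
pose w P y : R := \prod_(i < n) trig_int (i \in P) sg (a i) (c i) (tnth y i).
pose b P : R := act l (bivector_prod P) (blade S) U.
rewrite (_ : (fun y => _) =
  (fun y => kappa ^+ 2 * \sum_P \sum_Q (b P * b Q) * (w P y * w Q y))); last first.
  apply/funext => y; rewrite transform_box_fun// ffunE sum_ffunE exprMn; congr (_ * _).
  rewrite expr2 mulr_suml; apply: eq_bigr => P _; rewrite mulr_sumr; apply: eq_bigr => Q _.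
  by rewrite !ffunE /GRing.scale/= -/(w P y) -/(w Q y) -/(b P) -/(b Q); ring.
apply: integrableZR; apply: integrable_sumR => P; apply: integrable_sumR => Q.
by apply: integrableZR; exact: integrable_trig_prodM.
Qed.

(** The normalisation cancels the factor 2 pi that [Rintegral_trig_int_sum] yields in each
    coordinate. *)
Lemma kappa_sqr : kappa ^+ 2 * (2 * pi) ^+ n = 1.
Proof.
have pi2 : 0 < 2 * pi :> R by rewrite mulr_gt0// pi_gt0.
rewrite expr2 /kappa -powRD; last by apply/implyP => _; rewrite gt_eqF.
rewrite -powR_mulrn ?ltW// -powRD; last by apply/implyP => _; rewrite gt_eqF.
rewrite (_ : _ + _ = 0) ?powRr0//; lra.
Qed.

(* A pair of subsets P != Q contributes 0, by parity in a coordinate where they differ; the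
   diagonal terms recombine into a product over the coordinates of overlap lengths. *)
Lemma transform_box_fun_isometry l sg a c S a' c' S' : `|sg| = 1 ->
  \int[dx]_y scalar_prod (transform l sg (box_fun a c S) y)
    (transform l sg (box_fun a' c' S') y) =
  \int[dx]_x scalar_prod (box_fun a c S x) (box_fun a' c' S' x).
Proof.
move=> sg1; have sg2 : sg * sg = 1 by rewrite -expr2 -[sg ^+ 2]ger0_norm ?sqr_ge0// normrX
  sg1 expr1n.
pose w P y : R := \prod_(i < n) trig_int (i \in P) sg (a i) (c i) (tnth y i).
pose w' P y : R := \prod_(i < n) trig_int (i \in P) sg (a' i) (c' i) (tnth y i).
pose b P Q : R := scalar_prod (act l (bivector_prod P) (blade S))
  (act l (bivector_prod Q) (blade S')).
pose ov i := \int[mu]_t (\1_(`]a i, c i]%classic : set R) t * \1_(`]a' i, c' i]%classic :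
  set R) t).
have iw P Q : dx.-integrable setT (EFin \o (fun y => b P Q * (w P y * w' Q y))).
  by apply: integrableZR; exact: integrable_trig_prodM.
transitivity (\int[dx]_y (kappa ^+ 2 * \sum_P \sum_Q b P Q * (w P y * w' Q y))).
  apply: eq_Rintegral => y _; rewrite !transform_box_fun// scalar_prodZl scalar_prodZr
    mulrA -expr2.
  congr (_ * _); rewrite scalar_prod_suml; apply: eq_bigr => P _.
  rewrite scalar_prod_sumr; apply: eq_bigr => Q _.
  by rewrite scalar_prodZl scalar_prodZr mulrA mulrC.
rewrite RintegralZl//; last by apply: integrable_sumR => P; exact: integrable_sumR.
rewrite Rintegral_sum; last by move=> P; exact: integrable_sumR.
(* Multiplication by [bivector_prod P] is an isometry, so the Clifford factor of a diagonal term is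
   the same for all [P]. *)
transitivity (kappa ^+ 2 * \sum_(P : {set 'I_n}) scalar_prod (blade S) (blade S' : G) *
    \prod_(i < n) trig_mean (i \in P) (i \in P) sg (a i) (c i) (a' i) (c' i)).
  congr (_ * _); apply: eq_bigr => P _; rewrite Rintegral_sum//.
  rewrite (bigD1 P)//= big1 ?addr0 => [|Q QP].
    rewrite RintegralZl//; last exact: integrable_trig_prodM.
    by rewrite Rintegral_trig_prodM /b act_bivector_prod.
  rewrite RintegralZl//; last exact: integrable_trig_prodM.
  rewrite Rintegral_trig_prodM.
  have [i iPQ] : exists i, (i \in Q) != (i \in P).
    by apply/existsP; apply: contraR QP; rewrite negb_exists => /forallP h; apply/eqP/setP => i;
      apply/eqP; rewrite -[_ == _]negbK.
  rewrite (bigD1 i)//= (_ : (i \in Q) = ~~ (i \in P)); last by move: iPQ; case: (i \in Q);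
    case: (i \in P).
  by rewrite /trig_mean Rintegral_trig_int_neq mul0r mulr0.
rewrite -mulr_sumr.
have -> : \sum_(P : {set 'I_n}) \prod_(i < n) trig_mean (i \in P) (i \in P) sg (a i) (c i)
  (a' i) (c' i) =
    \prod_(i < n) (2 * pi * ov i).
  transitivity (\prod_(i < n) (trig_mean true true sg (a i) (c i) (a' i) (c' i) +
     trig_mean false false sg (a i) (c i) (a' i) (c' i))).
    rewrite bigA_distr; apply: eq_big => // P _; apply: eq_bigr => i _; by case: ifP.
  by apply: eq_bigr => i _; exact: Rintegral_trig_int_sum.
rewrite big_split/= prodr_const card_ord mulrCA (mulrA (kappa ^+ 2)) kappa_sqr mul1r.
have iov i : mu.-integrable setT (EFin \o (fun t : R => \1_(`]a i, c i]%classic : set R) t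
  * \1_(`]a' i, c' i]%classic : set R) t)).
  apply: (integrable_le _ _ (@integrable_indic_itv R (a i) (c i) false false)).
    by apply: measurable_funM; exact: measurable_indic_oc.
  by move=> t; rewrite ger0_norm ?mulr_ge0 ?indicE// ler_piMr ?indicE// lern1; case: (_ \in _).
have [io E] := integral_prod_tnth iov.
rewrite -[X in _ * X]E -RintegralZl//; apply: eq_Rintegral => x _.
by rewrite scalar_prodZl scalar_prodZr !box_indic mulrA -big_split/= mulrC.
Qed.

End BoxTransform.

(** * Plancherel's theorem *)

Section Plancherel.
Context {R : realType} {n : nat}.
Local Notation Rn := (n.-tuple (measurableTypeR R)).
Local Notation G := (clifford R (n + n)).
Local Notation dx := (@dx R n).
Local Notation kappa := (@kappa R n).
Implicit Types (f g : Rn -> G) (x y : Rn) (a c : 'I_n -> R)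
  (S U : {set 'I_(n + n)}) (l : bool) (sg : R) (F H : L2 R n).

Lemma integral_indic_box_eq0_ae (h : Rn -> R) : measurable_fun setT h ->
  (forall a c, dx.-integrable setT (EFin \o (fun x => h x * \1_(box a c) x))) ->
  (forall a c, \int[dx]_x (h x * \1_(box a c) x) = 0) ->
  {ae dx, forall x, h x = 0}.
Proof.
move=> mh ih h0.
have e a c : ((EFin \o h) \_ (box a c) = EFin \o (fun x => (h x * \1_(box a c) x)%R))%E.
  by apply/funext => x; rewrite restrict_EFin patch_indic.
apply: integral_box_eq0_ae => // a c.
  by apply/(integrable_mkcond _ (measurable_box a c)); rewrite e.
rewrite integral_mkcond e -(fineK (integrable_fin_num measurableT (ih a c))).
by congr EFin; exact: h0.
Qed.

Definition box_index : Type := (('I_n -> R) * ('I_n -> R) * {set 'I_(n + n)})%type.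

Definition box_vector (i : box_index) : L2 R n := mkL2 (in_L2_box_fun i.1.1 i.1.2 i.2).

Definition box_image l sg (sg1 : `|sg| = 1) (i : box_index) : L2 R n :=
  mkL2 (in_L2_transform_box_fun l i.1.1 i.1.2 i.2 sg1).

Lemma box_vector_ae i : (box_vector i : Rn -> G) = box_fun i.1.1 i.1.2 i.2 %[ae dx].
Proof. exact: mkL2_ae. Qed.

Lemma box_image_ae l sg (sg1 : `|sg| = 1) i :
  (box_image l sg1 i : Rn -> G) = transform l sg (box_fun i.1.1 i.1.2 i.2) %[ae dx].
Proof. exact: mkL2_ae. Qed.

(* The inner product of the norm of L2, which differs from L2_inner by the factor kappa. *)
Definition dm_inner F H : R := kappa * L2_inner F H.

Lemma dm_innerC F H : dm_inner F H = dm_inner H F. Proof. by rewrite /dm_inner L2_innerC. Qed.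

Lemma dm_inner_lin (t : R) F H K : dm_inner (t *: F + H) K = t * dm_inner F K + dm_inner H K.
Proof. by rewrite /dm_inner L2_inner_lin mulrDr mulrCA. Qed.

Lemma L2_inner_box F i : L2_inner F (box_vector i) =
  \int[dx]_x ((F x i.2 : R) * \1_(box i.1.1 i.1.2) x).
Proof.
have [mF _] := L2_in F.
rewrite (L2_inner_ae mF (cmeasurable_box_fun _ _ _) (ae_eq_refl _ _ _) (box_vector_ae i)).
by apply: eq_Rintegral => x _; rewrite scalar_prod_box_fun.
Qed.

Lemma integrable_L2_box F a c S :
  dx.-integrable setT (EFin \o (fun x => (F x S : R) * \1_(box a c) x)).
Proof.
have := integrable_coordM S S (L2_in F) (in_L2_box_fun a c S).
by apply: eq_integrable => // x _; rewrite /= box_fun_coord eqxx mulr1.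
Qed.

(** Box functions along the blade [S] see only the coordinate [S] of [F], which reduces the claim to
    real functions. *)
Lemma box_vector_total F : (forall i, dm_inner F (box_vector i) = 0) -> F = 0.
Proof.
move=> F0; have [mF _] := L2_in F.
have coord0 S : {ae dx, forall x, F x S = 0}.
  apply: integral_indic_box_eq0_ae => [|a c|a c]; first exact: mF.
    exact: integrable_L2_box.
  have /eqP := F0 (a, c, S); rewrite /dm_inner L2_inner_box mulf_eq0.
  by rewrite gt_eqF ?kappa_gt0//= => /eqP.
have all0 := ae_forall_finType coord0.
(* The chosen representative of the zero class vanishes only almost everywhere; this is read off
   from -F + F. *)
have z : (0 : L2 R n) = (fun=> 0 : G) %[ae dx].
  have := L2_lin_ae (-1) F F; apply: filterS => x h xT.
  by have := h xT; rewrite scaleN1r addNr scaleN1r addNr.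
apply: L2_ext; apply: filterS2 all0 z => x Fx zx xT.
by rewrite [RHS](zx xT); apply/ffunP => S; rewrite ffunE Fx.
Qed.

Lemma box_image_inner l sg (sg1 : `|sg| = 1) i j :
  dm_inner (box_image l sg1 i) (box_image l sg1 j) = dm_inner (box_vector i) (box_vector j).
Proof.
have ci (k : box_index) : cmeasurable (transform l sg (box_fun k.1.1 k.1.2 k.2)).
  by apply: cmeasurable_transform => //; exact: in_L1_box_fun.
rewrite /dm_inner (L2_inner_ae (ci i) (ci j) (box_image_ae l sg1 i) (box_image_ae l sg1 j)).
rewrite (L2_inner_ae (cmeasurable_box_fun _ _ _) (cmeasurable_box_fun _ _ _)
  (box_vector_ae i) (box_vector_ae j)).
by rewrite transform_box_fun_isometry.
Qed.

Lemma box_image_adjoint l sg (sg1 : `|sg| = 1) (sgN1 : `|- sg| = 1) i j :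
  dm_inner (box_image l sg1 i) (box_vector j) = dm_inner (box_vector i) (box_image l sgN1 j).
Proof.
have ci (s : R) (k : box_index) : `|s| =
  1 -> cmeasurable (transform l s (box_fun k.1.1 k.1.2 k.2)).
  by move=> s1; apply: cmeasurable_transform => //; exact: in_L1_box_fun.
have cb (k : box_index) := cmeasurable_box_fun (n := n) (R := R) k.1.1 k.1.2 k.2.
rewrite /dm_inner (L2_inner_ae (ci _ i sg1) (cb j) (box_image_ae l sg1 i) (box_vector_ae j)).
rewrite (L2_inner_ae (cb i) (ci _ j sgN1) (box_vector_ae i) (box_image_ae l sgN1 j)).
by rewrite transform_adjoint//; exact: in_L1_box_fun.
Qed.

Lemma in_L1_ae F f : in_L1 f -> (F : Rn -> G) = f %[ae dx] -> in_L1 F.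
Proof.
move=> [mf fi] Ff; have [mF _] := L2_in F; split=> // S; apply/integrableP; split.
  by apply/measurable_EFinP; exact: mF.
have /integrableP[_] := fi S; congr (_ < _)%E; apply: ge0_ae_eq_integral => //.
- by apply: measurableT_comp => //; apply/measurable_EFinP; exact: mf.
- by apply: measurableT_comp => //; apply/measurable_EFinP; exact: mF.
- by apply: filterS Ff => x e xT; rewrite /= e.
Qed.

Lemma in_L1_lin (t : R) F H : in_L1 F -> in_L1 H -> in_L1 (t *: F + H : L2 R n).
Proof.
move=> [mF iF] [mH iH]; apply: in_L1_ae (L2_lin_ae t F H); split.
  by have := cmeasurable_lincomb t mF mH.
move=> S; have := integrableDR (integrableZR t (iF S)) (iH S).
by apply: eq_integrable => // x _; rewrite /= !ffunE.
Qed.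

(** Provides a dense set inside L1, on which any two continuous extensions agree. *)
Lemma in_L1_lincomb s : in_L1 (lincomb box_vector s : L2 R n).
Proof.
elim: s => [|p s IHs]; rewrite /lincomb ?big_cons ?big_nil.
  apply: (@in_L1_ae _ (fun=> 0)).
    split=> S; rewrite (_ : (fun x => _) = cst 0); try by apply/funext => x; rewrite ffunE.
      exact: measurable_cst.
    by have := @integrable0 _ _ _ dx setT.
  have := L2_lin_ae (-1) (0 : L2 R n) 0; apply: filterS => x h xT.
  by have := h xT; rewrite scaleN1r addNr scaleN1r addNr.
apply: in_L1_lin IHs; apply: in_L1_ae (box_vector_ae _); exact: in_L1_box_fun.
Qed.

(* The extension U agrees with the integral transform on L1 because both have the same
   integrals over boxes: <U F, box> = <F, adjoint transform of box> by continuity for the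
   former, by Fubini for the latter. *)
Lemma transform_extension l sg : `|sg| = 1 -> exists U : L2 R n -> L2 R n,
  hilbert_isomorphism U /\ continuous_extension (transform l sg) U.
Proof.
move=> sg1; have sgN1 : `|- sg| = 1 by rewrite normrN.
have [U [Ulin Ubij Uip Uadj]] := isometric_isomorphism dm_innerC dm_inner_lin
  (@L2_norm_kappa R n)
  (@L2_complete R n) box_vector_total (box_image_inner l sg1) (box_image_inner l sgN1)
  (box_image_adjoint l sg1 sgN1).
have k0 : kappa != 0 by rewrite gt_eqF ?kappa_gt0.
have UN F : `|U F| = `|F|.
  apply/eqP; rewrite -(@eqrXn2 _ 2)// !L2_norm_kappa; apply/eqP; exact: Uip.
exists U; split.
  split => //; move=> F H; apply: (mulfI k0); exact: Uip.
split; first exact: isometric_continuous.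
move=> F /in_L1P F1.
apply/ae_dm.
pose UF : L2 R n := U F; have [mUF _] := L2_in UF; have mTF := cmeasurable_transform l sg1 F1.
have coord S : {ae dx, forall y, (UF y S : R) - transform l sg F y S = 0}.
  have iT a c : dx.-integrable setT (EFin \o (fun y => transform l sg F y S * \1_(box a c) y)).
    have [M hM] := transform_bounded l S sg1 F1.
    apply: (integrable_le _ _ (integrableZR M (integrable_indic_box a c))).
      by apply: measurable_funM; [exact: mTF|exact: measurable_indic_box].
    move=> y; rewrite normrM [X in _ * X]ger0_norm; last by rewrite indicE.
    by rewrite ler_wpM2r// indicE.
  have e a c : (fun y => ((UF y S : R) - transform l sg F y S) * \1_(box a c) y) =
      (fun y => (UF y S : R) * \1_(box a c) y - transform l sg F y S * \1_(box a c) y).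
    by apply/funext => y; rewrite mulrBl.
  apply: integral_indic_box_eq0_ae.
  - by apply: measurable_funB; [exact: mUF|exact: mTF].
  - move=> a c; rewrite e.
    by have := integrableB measurableT (integrable_L2_box UF a c S) (iT a c).
  - move=> a c; rewrite e RintegralB//; last exact: integrable_L2_box.
    apply/eqP; rewrite subr_eq0; apply/eqP.
    have := Uadj F (a, c, S); rewrite /dm_inner => /(mulfI k0); rewrite L2_inner_box => ->.
    have [mF _] := F1; have b1 := in_L1_box_fun (n := n) (R := R) a c S.
    rewrite (L2_inner_ae mF (cmeasurable_transform l sgN1 b1) (ae_eq_refl _ _ _)
      (box_image_ae l sgN1 (a, c, S))).
    rewrite -transform_adjoint//; apply: eq_Rintegral => y _.
    by rewrite scalar_prod_box_fun.
apply: filterS (ae_forall_finType coord) => x h _; apply/ffunP => S.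
by apply/eqP; rewrite -subr_eq0; apply/eqP; exact: h.
Qed.

Lemma continuous_extension_unique (T : (Rn -> G) -> (Rn -> G)) (U V : L2 R n -> L2 R n) :
  continuous_extension T U -> continuous_extension T V -> U = V.
Proof.
move=> [cU UT] [cV VT]; apply/funext => F.
have [s sF] := lincomb_approx dm_innerC dm_inner_lin (@L2_norm_kappa R n)
  (@L2_complete R n) box_vector_total F.
have sU : U (lincomb box_vector (s k)) @[k --> \oo] --> U F by apply:
  continuous_cvg => //; exact: cU.
have sV : V (lincomb box_vector (s k)) @[k --> \oo] --> V F by apply:
  continuous_cvg => //; exact: cV.
have e : (fun k => U (lincomb box_vector (s k))) = (fun k => V (lincomb box_vector (s k))).
  apply/funext => k; apply: L2_ext; apply/ae_dm.
  have h : in_Lp 1%:E (lincomb box_vector (s k) : L2 R n) by apply/in_L1P; exact: in_L1_lincomb.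
  apply: filterS2 (UT _ h) (VT _ h) => x e1 e2 xT.
  by rewrite e1// e2.
by rewrite e in sU; exact: (cvg_uniq sU sV).
Qed.

(** [xget] selects an unspecified continuous extension; existence rules out the default value, and
    uniqueness identifies the selected map with the isomorphism already built. *)
Lemma L2_extend_transform l sg : `|sg| = 1 -> hilbert_isomorphism
  (L2_extend (transform (n := n) (R := R) l sg)).
Proof.
move=> sg1; have [U [Uiso Uext]] := transform_extension l sg1.
have hext : continuous_extension (transform l sg)
  (L2_extend (transform (n := n) (R := R) l sg)).
  by apply: xgetPex; exists U.
by rewrite (continuous_extension_unique hext Uext).
Qed.

End Plancherel.

Theorem mainTheorem11 (R : realType) (n : nat) :
  hilbert_isomorphism (L2_fourier_left R n) /\
  hilbert_isomorphism (L2_fourier_right R n).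
Proof.
have N1 : `|-1 : R| = 1 by rewrite normrN normr1.
split.
  rewrite /L2_fourier_left (_ : fourier_left = transform true (-1)).
    exact: L2_extend_transform.
  by apply/funext => f; exact: fourier_leftE.
rewrite /L2_fourier_right (_ : fourier_right = transform false (-1)).
  exact: L2_extend_transform.
by apply/funext => f; exact: fourier_rightE.
Qed.
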